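(* Consider the three-term relation $${}_2\phi_1(aq^k,bq^l;cq^m;q,xq^n)=Q\cdot{}_2\phi_1(aq,bq;cq;q,x)+R\cdot{}_2\phi_1(a,b;c;q,x),\qquad ( * )$$ with $k,l,m,n\in\mathbb{Z}$ and $Q,R$ the rational functions of $a,b,c,q,x$ uniquely determined by $(k,l,m,n)$. Here ''$( * )$ leads to (yields, gives) an identity'' means that the identity is derived from $( * )$ by the $q$-analogue of Ebisu's method described in the context. (1) When $(k,l,m,n)=(0,0,0,2)$, the relation $( * )$ leads to the identity $${}_2\phi_1(a,-a;-q;q,x)=\frac{(a^2x;q^2)_\infty}{(x;q^2)_\infty},\qquad |x|<1.$$ (2) When $(k,l,m,n)=(0,1,1,0)$, the relation $( * )$ yields $${}_2\phi_1\left(a,b;c;q,\frac{c}{ab}\right)=\frac{(c/a;q)_\infty\,(c/b;q)_\infty}{(c;q)_\infty\,(c/ab;q)_\infty},\qquad |c/ab|<1.$$ (3) When $(k,l,m,n)=(0,2,2,0)$, the relation $( * )$ gives $${}_2\phi_1\left(a,b;\frac{bq}{a};q,-\frac{q}{a}\right)=\frac{(-q;q)_\infty\,(bq;q^2)_\infty\,(bq^2/a^2;q^2)_\infty}{(-q/a;q)_\infty\,(bq/a;q)_\infty},\qquad |-q/a|<1.$$ (4) When $(k,l,m,n)=(1,2,1,-1)$, the relation $( * )$ leads to the following values of ${}_2\phi_1\left(a,b;\frac{bq}{a};q,-\frac{q}{a}\right)$: (4a) if $a=q^{M+2}$ and $b=q^{-2N}$, it equals $\dfrac{(-q^{M+2};q)_N\,(q;q^2)_N}{(q^{M+N+2};q)_N}$;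 (4b) if $a=q^{M+2}$ and $b=q^{-2N-1}$, it equals $0$; (4c) if $a=q^{-N}$ and $b=q^{-M-2N-2}$, it equals $\dfrac{(-q;q)_N\,(q^{M+3};q^2)_N}{q^{N(N+1)/2}\,(q^{M+2};q)_N}$. (5) When $(k,l,m,n)=(0,3,3,0)$, the relation $( * )$ yields $${}_2\phi_1(\omega q,q^{-N};\omega q^{-N};q,1)=\frac{1-\omega^{N+1}}{1-\omega}\,\frac{(q^{-N};q)_N}{(\omega q^{-N};q)_N},\qquad \omega^3=1,\ \omega\neq1.$$ In these identities, $M$ and $N$ denote arbitrary non-negative integers.
   Context: Assume $|q|<1$ (and $q\neq0$). For $|p|<1$ put $(a;p)_\infty=\prod_{j=0}^\infty(1-ap^j)$ and $(a;p)_i=(a;p)_\infty/(ap^i;p)_\infty$. The basic hypergeometric series is $${}_2\phi_1(a,b;c;q,x)=\sum_{i=0}^\infty\frac{(a;q)_i(b;q)_i}{(q;q)_i(c;q)_i}x^i,$$ where normally $c\neq q^{-j}$ for $j=0,1,2,\ldots$. The definition is extended: if $a$ or $b$ equals $q^{-r}$ and $c=q^{-s}$ with integers $0\le r<s$, then ${}_2\phi_1(a,b;c;q,x):=\sum_{i=0}^{r}\frac{(a;q)_i(b;q)_i}{(q;q)_i(c;q)_i}x^i$. Parameters are such that the expressions written are defined (no division by zero). Three-term relation: for every $(k,l,m,n)\in\mathbb{Z}^4$ there is a unique pair $(Q,R)$ of rational functions of $a,b,c,q,x$ for which the three-term relation $( * )$ of the claim holds. The $q$-analogue of Ebisu's method: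 for a positive integer $\nu$ let $(a_\nu,b_\nu,c_\nu,x_\nu)=(aq^{k(\nu-1)},bq^{l(\nu-1)},cq^{m(\nu-1)},xq^{n(\nu-1)})$, and let $Q^{(\nu)},R^{(\nu)}$ be $Q,R$ with $(a,b,c,x)$ replaced by $(a_\nu,b_\nu,c_\nu,x_\nu)$. Take a solution $(a,b,c,x)$ of the system $Q^{(\nu)}=0$, $\nu=1,2,\ldots$. For it the three-term relation reduces to the first-order difference equation ${}_2\phi_1(a_{\nu+1},b_{\nu+1};c_{\nu+1};q,x_{\nu+1})=R^{(\nu)}\,{}_2\phi_1(a_\nu,b_\nu;c_\nu;q,x_\nu)$, whence $${}_2\phi_1(a,b;c;q,x)=\frac{1}{R^{(1)}R^{(2)}\cdots R^{(\nu)}}\;{}_2\phi_1(aq^{k\nu},bq^{l\nu};cq^{m\nu};q,xq^{n\nu}),\qquad \nu=1,2,\ldots.$$ Manipulating this so that the right-hand side is expressed through $q$-shifted factorials (for example, by letting $\nu\to\infty$ when permissible, or by specializing a free parameter to a negative integer power of $q$ so that the series on the right becomes a finite sum that can be evaluated explicitly) yields a basic hypergeometric identity. *)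

(* Defs.v *)
From HB Require Import structures.
From mathcomp Require Import all_boot all_order all_algebra.
From mathcomp Require Import complex.
From mathcomp Require Import all_classical all_reals all_analysis.
From mathcomp Require Import -(notations) mpoly.
Import Order.TTheory GRing.Theory Num.Theory numFieldNormedType.Exports.
Set Implicit Arguments.
Unset Strict Implicit.
Unset Printing Implicit Defensive.
Local Open Scope classical_set_scope.
Local Open Scope ring_scope.

(* The complex numbers over R, typed as a numClosedFieldType so that they
   carry the canonical topology of numeric fields. *)
Definition Cplx (R : realType) : numClosedFieldType := R[i].

Section Definitions.
Variable C : numClosedFieldType.
Implicit Types (a b c p q x v y z : C) (k l m n : int).

(* (a; p)_i for i a natural number; this is (a; p)_oo / (a p ^ i; p)_oo
   with the common factors cancelled, so it also makes sense when
   (a p ^ i; p)_oo = 0. *)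
Definition qpoch a p (i : nat) : C := \prod_(j < i) (1 - a * p ^+ j).

Definition qpochinf a p : C := lim (qpoch a p i @[i --> \oo]).

Record params := Params { pa : C; pb : C; pc : C; pq : C; px : C }.

Definition phi21_term (P : params) (i : nat) : C :=
  qpoch (pa P) (pq P) i * qpoch (pb P) (pq P) i
  / (qpoch (pq P) (pq P) i * qpoch (pc P) (pq P) i) * px P ^+ i.

(* The series 2phi1(a, b; c; q, x) is defined and has value v.  The second
   alternative is the extended definition: a or b is q ^ (- r) and
   c = q ^ (- s) with 0 <= r < s. *)
Definition is_phi21 (P : params) v : Prop :=
  ((forall j : nat, pc P != pq P ^- j) /\
   \sum_(i < N) phi21_term P i @[N --> \oo] --> v)
  \/
  (exists r s : nat,
     [/\ (r < s)%N, pa P = pq P ^- r \/ pb P = pq P ^- r, pc P = pq P ^- s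
       & v = \sum_(i < r.+1) phi21_term P i]).

(* Rational functions of the five variables a, b, c, q, x, in this order. *)
Definition ratfun := {fraction (mpoly 5 C)}.

Definition coords (P : params) : 'I_5 -> C :=
  tnth [tuple pa P; pb P; pc P; pq P; px P].

(* f is defined at P and has value v there: some representation of f as a
   quotient of polynomials has a denominator that does not vanish at P. *)
Definition ratfun_eval (f : ratfun) (P : params) v : Prop :=
  exists num den : mpoly 5 C,
    [/\ f = tofrac num / tofrac den, meval (coords P) den != 0
      & v = meval (coords P) num / meval (coords P) den].

Definition shift k l m n (P : params) : params :=
  Params (pa P * pq P ^ k) (pb P * pq P ^ l) (pc P * pq P ^ m) (pq P)
         (px P * pq P ^ n).

(* The relation holds at every point where all the expressions in it are
   defined. *)
Definition three_term k l m n (Q S : ratfun) : Prop :=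
  forall (P : params) v0 v1 v y z,
    0 < `|pq P| < 1 ->
    is_phi21 (shift k l m n P) v0 -> is_phi21 (shift 1 1 1 0 P) v1 ->
    is_phi21 P v -> ratfun_eval Q P y -> ratfun_eval S P z ->
    v0 = y * v1 + z * v.

Definition unique_three_term k l m n (Q S : ratfun) : Prop :=
  three_term k l m n Q S /\
  (forall Q' S', three_term k l m n Q' S' -> Q' = Q /\ S' = S).

(* (a_nu, b_nu, c_nu, q, x_nu), for nu >= 1. *)
Definition ebisu_point k l m n (P : params) (nu : nat) : params :=
  shift (k * (nu%:Z - 1)) (l * (nu%:Z - 1)) (m * (nu%:Z - 1))
        (n * (nu%:Z - 1)) P.

Definition ebisu_solution k l m n (Q : ratfun) (P : params) : Prop :=
  forall nu, (0 < nu)%N -> ratfun_eval Q (ebisu_point k l m n P nu) 0.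

(* The first K steps of the method starting from P: the equations
   Q^(nu) = 0, the resulting first-order difference equation, and the
   resulting product formula; phi nu is the value of the series at the nu-th
   point and r nu the value of R^(nu).  A bound K is needed because for
   terminating series the chain may only be defined up to some nu. *)
Definition ebisu_chain k l m n (Q S : ratfun) (P : params) (K : nat) : Prop :=
  exists r phi : nat -> C,
    [/\ forall nu, (0 < nu <= K.+1)%N ->
          is_phi21 (ebisu_point k l m n P nu) (phi nu),
        forall nu, (0 < nu <= K)%N ->
          [/\ ratfun_eval Q (ebisu_point k l m n P nu) 0,
              ratfun_eval S (ebisu_point k l m n P nu) (r nu), r nu != 0
            & phi nu.+1 = r nu * phi nu]
      & forall nu, (0 < nu <= K)%N ->
          phi 1%N = (\prod_(1 <= j < nu.+1) r j)^-1 * phi nu.+1].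

End Definitions.

(* Main.v *)
Require Import Defs.
From HB Require Import structures.
From mathcomp Require Import all_boot all_order all_algebra.
From mathcomp Require Import complex.
From mathcomp Require Import all_classical all_reals all_analysis.
From mathcomp Require Import -(notations) mpoly.
From mathcomp Require Import ring zify.
Import Order.TTheory GRing.Theory Num.Theory numFieldNormedType.Exports.
Set Implicit Arguments.
Unset Strict Implicit.
Unset Printing Implicit Defensive.
Local Open Scope classical_set_scope.
Local Open Scope ring_scope.

(** Write V, W, V1 and W1 for the series with parameters (a, b; c), (a q, b q; c q),
    (a, b q; c q) and (a q, b q^2; c q^2) at the same argument x.

    Three-term relations.  Contiguous relations, checked coefficient by
    coefficient (contiguous_V1, contiguous_W1), express V1 and W1 by V and W.  So
    the pair (V, W) at (b, c) determines the pair at (b q, c q), and one, two or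
    three such steps give the relations for (0, 1, 1, 0), (0, 2, 2, 0) and
    (0, 3, 3, 0).  The second-order q-difference equation in x gives (0, 0, 0, 2)
    (relation_xq2), and a relation between V, W and W at x / q gives (1, 2, 1, -1)
    (relation_x_over_q).  A relation has to hold wherever its series and its
    coefficients have values, also where the denominator D of the quotients found
    here vanishes.  There the coefficient S has no value: a denominator of any
    other representation of S would vanish along a whole curve inside D = 0 through
    the point (undefined_on_curve).

    Uniqueness.  The difference of two three-term relations is F W + G V = 0 with
    polynomials F and G.  For a = q^-r the series V and W are polynomials in x, of
    degree r and less than r, and they are coprime when b, c and c / b are not
    powers of q, because a common root would spread to infinitely many roots of V
    (coprime_vw).  So V divides F, which is impossible once r exceeds the degree of
    F in x unless F = 0 there.  The points used are dense enough to force F = G = 0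
    as polynomials (mpoly_dense).

    Identities.  On each of the families of parameters, Q vanishes, S factors into
    linear terms, and the shift maps the family to itself (special_0002 and its
    analogues, ebisu_chainI).  When b and c are multiplied by powers of q, the
    series on the far right of the product formula tends to a 1phi0, which the
    q-binomial theorem sums; this gives the q-Gauss sum (qgauss) and the
    Bailey-Daum sum (bailey_daum).  They also hold at the exceptional points where
    some S has no value, so their first-order difference equations are derived from
    contiguous relations without division by c - a (relation_V1, relation_W1).  For
    (0, 0, 0, 2) the series itself is a 1phi0 in base q^2.  For (1, 2, 1, -1) and
    (0, 3, 3, 0) the chain starts from a terminating series and ends at a sum of at
    most three terms (value_4a, value_4b, value_4c, value_5). *)

(** * Power series as limits of partial sums *)

Section PowerSeries.
Variable C : numClosedFieldType.
Implicit Types (x v w k : C) (f g : nat -> C).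

Definition psum x f (N : nat) : C := \sum_(i < N) f i * x ^+ i.

Definition converges x f v := psum x f N @[N --> \oo] --> v.

(** The coefficients of x f(x): contiguous relations whose coefficients depend on x
    are linear relations between coefficient sequences and their delays. *)
Definition delay f i : C := if i is j.+1 then f j else 0.

Lemma cvg_seq_unique (u : nat -> C) v w :
  u N @[N --> \oo] --> v -> u N @[N --> \oo] --> w -> v = w.
Proof.
move=> uv uw; apply: (@cvg_unique _ (@norm_hausdorff C C^o : hausdorff_space C) (u @ \oo)) => //.
Qed.

Lemma cvg_seq_ext (u u' : nat -> C) v w :
  u N @[N --> \oo] --> v -> (forall n, u n = u' n) -> v = w -> u' N @[N --> \oo] --> w.
Proof. by move=> uv /funext <- <-. Qed.

Lemma cvg_seqD (u u' : nat -> C) v w :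
  u N @[N --> \oo] --> v -> u' N @[N --> \oo] --> w ->
  (u N + u' N) @[N --> \oo] --> v + w.
Proof. exact: (@cvgD C C^o). Qed.

Lemma cvg_seqM (u u' : nat -> C) v w :
  u N @[N --> \oo] --> v -> u' N @[N --> \oo] --> w ->
  (u N * u' N) @[N --> \oo] --> v * w.
Proof. exact: (@cvgM C). Qed.

Lemma cvg_seq_cst v : v @[N --> \oo] --> v.
Proof. exact: cvg_cst. Qed.

Lemma converges_unique x f v w : converges x f v -> converges x f w -> v = w.
Proof. exact: cvg_seq_unique. Qed.

Lemma converges_ext x f g v : f =1 g -> converges x f v -> converges x g v.
Proof.
move=> fg; rewrite /converges (_ : psum x f = psum x g)//.
by apply/funext => N; apply: eq_bigr => i _; rewrite fg.
Qed.

Lemma converges_eq x f g v w : converges x f v -> f =1 g -> v = w -> converges x g w.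
Proof. by move=> fv /converges_ext fg <-; apply: fg. Qed.

Lemma convergesD x f g v w :
  converges x f v -> converges x g w -> converges x (fun i => f i + g i) (v + w).
Proof.
move=> fv gw; rewrite /converges.
rewrite (_ : psum x _ = psum x f \+ psum x g); first exact: cvg_seqD.
by apply/funext => N; rewrite /psum /= -big_split; apply: eq_bigr => i _; rewrite mulrDl.
Qed.

Lemma convergesZ x f v k : converges x f v -> converges x (fun i => k * f i) (k * v).
Proof.
move=> fv; rewrite /converges.
rewrite (_ : psum x _ = (fun N => k * psum x f N)); first by apply: cvg_seqM => //; exact: cvg_seq_cst.
by apply/funext => N; rewrite /psum big_distrr; apply: eq_bigr => i _; rewrite -mulrA.
Qed.

Lemma psumS x f N : psum x f N.+1 = psum x f N + f N * x ^+ N.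
Proof. by rewrite /psum big_ord_recr. Qed.

Lemma psum_delay x f N : psum x (delay f) N.+1 = x * psum x f N.
Proof.
rewrite /psum big_ord_recl /= mul0r add0r big_distrr; apply: eq_bigr => i _ /=.
by rewrite /bump /= add1n exprS mulrCA.
Qed.

Lemma converges_delay x f v : converges x f v -> converges x (delay f) (x * v).
Proof.
move=> fv; rewrite /converges -cvg_shiftS.
rewrite (_ : (fun _ => _) = (fun N => x * psum x f N)); first by apply: cvg_seqM => //; exact: cvg_seq_cst.
by apply/funext => N /=; rewrite psum_delay.
Qed.

Lemma converges_undelay x f v : x != 0 -> converges x (delay f) v -> converges x f (v / x).
Proof.
move=> x0; rewrite /converges -cvg_shiftS => fv.
rewrite (_ : psum x f = (fun N => psum x (delay f) N.+1 / x)); first by apply: cvg_seqM => //; exact: cvg_seq_cst.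
by apply/funext => N; rewrite psum_delay mulrC mulKf.
Qed.

Lemma converges_scale x k f v :
  converges (x * k) f v <-> converges x (fun i => f i * k ^+ i) v.
Proof.
rewrite /converges (_ : psum (x * k) f = psum x (fun i => f i * k ^+ i))//.
apply/funext => N; apply: eq_bigr => i _.
by rewrite exprMn -mulrA [k ^+ i * _]mulrC.
Qed.

Lemma converges_finite x f n :
  (forall i, (n <= i)%N -> f i = 0) -> converges x f (psum x f n).
Proof.
move=> f0; rewrite /converges -(cvg_shiftn n).
rewrite (_ : (fun _ => _) = cst (psum x f n)); first exact: cvg_cst.
apply/funext => N /=; rewrite addnC /psum big_split_ord /= [X in _ + X]big1 ?addr0//.
by move=> i _; rewrite f0 ?mul0r// leq_addr.
Qed.

End PowerSeries.

Arguments convergesZ {C x f v} k _.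

Arguments cvg_seq_cst {C} v.
Arguments cvg_seq_ext {C u u' v w} _ _ _.
Arguments cvg_seqD {C u u' v w} _ _.
Arguments cvg_seqM {C u u' v w} _ _.
Arguments converges_eq {C x f g v w} _ _ _.

(** * Convergence and exchange of limits over the complex numbers *)

Section ComplexSeries.
Variable R : realType.
Local Notation C := (Cplx R).
Implicit Types (x v w : C) (f : nat -> C) (u : nat -> R).

Lemma pos_Cplx (e : C) : 0 <= e -> exists2 r : R, 0 <= r & e = r%:C%C.
Proof.
move=> e0; exists (complex.Re e); last first.
  by rewrite RRe_real// ger0_real.
by move: e0; rewrite (@lecE R 0 e) => /andP[_].
Qed.

Lemma cvg_real_complex u (l : R) :
  u N @[N --> \oo] --> l -> ((u N)%:C%C : C) @[N --> \oo] --> (l%:C%C : C).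
Proof.
move=> ul; apply/(@cvgrPdist_lt C C^o) => e e0.
have [r r0 er] := pos_Cplx (ltW e0).
have {}r0 : 0 < r by move: e0; rewrite er (ltcR 0 r).
move/cvgrPdist_lt : ul => /(_ r r0); apply: filterS => N ltr.
rewrite er -(raddfB (real_complex R)) normc_def/= expr0n addr0 sqrtr_sqr.
by rewrite ltcR.
Qed.

Lemma cvg_expr0 x : `|x| < 1 -> x ^+ N @[N --> \oo] --> (0 : C).
Proof.
have [r r0 xr] := pos_Cplx (normr_ge0 x) => x1.
have r1 : r < 1 by move: x1; rewrite xr (ltcR r 1).
apply/(@cvgrPdist_lt C C^o) => e e0.
have : r ^+ N @[N --> \oo] --> (0 : R) by apply: cvg_expr; rewrite ger0_norm.
move=> /cvg_real_complex /(@cvgrPdist_lt C C^o) /(_ e e0); apply: filterS => N.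
rewrite !sub0r !normrN normrX xr => ltr.
by apply: le_lt_trans ltr; rewrite rmorphXn/= real_ler_norm// -xr rpredX// normr_real.
Qed.

(** The real and the imaginary parts of the terms are dominated by the geometric
    series of M |x|^i. *)
Lemma bounded_converges x f (M : C) :
  `|x| < 1 -> (forall i, `|f i| <= M) -> exists v, converges x f v.
Proof.
have [r r0 xr] := pos_Cplx (normr_ge0 x) => x1 fM.
have r1 : r < 1 by move: x1; rewrite xr (ltcR r 1).
have M0 : 0 <= M by apply: le_trans (fM 0%N).
have [m m0 Mm] := pos_Cplx M0.
have key u : (forall i, `|u i|%:C%C <= `|f i * x ^+ i|) -> cvgn (series u).
  move=> uf; apply: normed_cvg.
  apply: (@series_le_cvg _ _ (geometric m r)) => [n|n|n|] /=.
  - exact: normr_ge0.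
  - by rewrite mulr_ge0// exprn_ge0.
  - rewrite -lecR; apply: (le_trans (uf n)).
    rewrite normrM normrX xr rmorphM rmorphXn/=.
    by rewrite ler_wpM2r// -?Mm// -xr exprn_ge0.
  - by apply: is_cvg_geometric_series; rewrite ger0_norm.
have /key cRe i : `|complex.Re (f i * x ^+ i)|%:C%C <= `|f i * x ^+ i| := normc_ge_Re _.
have /key cIm i : `|complex.Im (f i * x ^+ i)|%:C%C <= `|f i * x ^+ i|.
  by rewrite -normrN -ReiNIm (le_trans (normc_ge_Re _))// normrM (_ : `|(@complex.Complex R 0 1) : C| = 1) ?mulr1// normc_def/= expr0n expr1n add0r sqrtr1.
exists ((limn (series (fun i => complex.Re (f i * x ^+ i))))%:C%C
       + 'i%C * (limn (series (fun i => complex.Im (f i * x ^+ i))))%:C%C).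
rewrite /converges.
rewrite (_ : psum x f = (fun N => ((series (fun i => complex.Re (f i * x ^+ i)) N)%:C%C : C)
       + 'i%C * ((series (fun i => complex.Im (f i * x ^+ i)) N)%:C%C : C))).
  apply: cvg_seqD; first exact: cvg_real_complex.
  by apply: cvg_seqM; [exact: cvg_seq_cst|exact: cvg_real_complex].
apply/funext => N; rewrite /series/= !big_mkord !(raddf_sum (real_complex R))/=.
by rewrite big_distrr -big_split; apply: eq_bigr => i _; exact: complexE.
Qed.

Lemma norm_limit_le (u : nat -> C) v (M : C) :
  M \is Num.real -> u N @[N --> \oo] --> v -> (forall N, `|u N| <= M) -> `|v| <= M.
Proof.
move=> Mr uv uM; rewrite real_leNgt ?normr_real//; apply/negP => Mv.
have [N _ /(_ N (leqnn _))] := @cvgr_norm_gt C C^o _ _ _ _ _ uv _ Mv.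
by rewrite /= => /lt_le_trans /(_ (uM N)); rewrite ltxx.
Qed.

Lemma psum_tail x f v (M : C) N :
  `|x| < 1 -> (forall i, `|f i| <= M) -> converges x f v ->
  `|v - psum x f N| <= M * `|x| ^+ N / (1 - `|x|).
Proof.
move=> x1 fM fv; pose B n := M * `|x| ^+ n / (1 - `|x|).
have x1' : 1 - `|x| != 0 by rewrite subr_eq0 eq_sym lt_eqF.
have M0 : 0 <= M by apply: le_trans (fM 0%N).
have B0 n : 0 <= B n.
  by rewrite /B divr_ge0 ?mulr_ge0 ?exprn_ge0// subr_ge0 ltW.
have BS n : B n = M * `|x| ^+ n + B n.+1 by rewrite /B exprS; field.
have step k : `|psum x f (k + N)%N - psum x f N| <= B N - B (k + N)%N.
  elim: k => [|k ih]; first by rewrite add0n !subrr normr0.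
  rewrite addSn psumS addrAC (le_trans (ler_normD _ _))//.
  rewrite [leRHS](_ : _ = B N - B (k + N)%N + M * `|x| ^+ (k + N)); last first.
    by rewrite (BS (k + N)%N); ring.
  by apply: lerD => //; rewrite normrM normrX ler_wpM2r// exprn_ge0.
apply: (@norm_limit_le (fun k => psum x f (k + N)%N - psum x f N)).
- exact/ger0_real/B0.
- apply: (@cvgB C C^o); last exact: cvg_seq_cst.
  by have := fv; rewrite /converges -(cvg_shiftn N).
- by move=> k; apply: le_trans (step k) _; rewrite gerBl.
Qed.

Lemma cvg_psum (F : nat -> nat -> C) f x N :
  (forall i, F n i @[n --> \oo] --> f i) -> psum x (F n) N @[n --> \oo] --> psum x f N.
Proof.
move=> Ff; elim: N => [|N ih].
  rewrite /psum big_ord0 (_ : (fun _ => _) = cst 0); first exact: cvg_seq_cst.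
  by apply/funext => n; rewrite big_ord0.
rewrite psumS (_ : (fun _ => _) = (fun n => psum x (F n) N + F n N * x ^+ N)); last first.
  by apply/funext => n; rewrite psumS.
apply: cvg_seqD; first exact: ih.
by apply: cvg_seqM; [exact: Ff|exact: cvg_seq_cst].
Qed.

(** The tails are below M |x|^N / (1 - |x|) for all n at once, which reduces the
    exchange of the limits to finite partial sums. *)
Lemma tannery (F : nat -> nat -> C) f x (M : C) (s : nat -> C) v :
  `|x| < 1 -> (forall n i, `|F n i| <= M) ->
  (forall i, F n i @[n --> \oo] --> f i) ->
  (forall n, converges x (F n) (s n)) -> converges x f v ->
  s n @[n --> \oo] --> v.
Proof.
move=> x1 FM Ff Fs fv.
have M0 : 0 <= M by apply: le_trans (FM 0%N 0%N).
have fM i : `|f i| <= M by apply: norm_limit_le (Ff i) _ => //; exact: ger0_real.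
have B0 : M * `|x| ^+ N / (1 - `|x|) @[N --> \oo] --> (0 : C).
  rewrite -(mul0r (1 - `|x|)^-1) -(mulr0 M).
  apply: cvg_seqM; last exact: cvg_seq_cst.
  apply: cvg_seqM; first exact: cvg_seq_cst.
  by apply: cvg_expr0; rewrite normr_id.
apply/(@cvgrPdist_lt C C^o) => e e0.
have e4 : 0 < e / 4 by rewrite divr_gt0.
have [N _ /(_ N (leqnn _))/= BN] := (@cvgrPdist_lt C C^o _ _ _ _ _).1 B0 _ e4.
rewrite sub0r normrN ger0_norm in BN; last first.
  by rewrite divr_ge0 ?mulr_ge0 ?exprn_ge0// subr_ge0 ltW.
have /(@cvgrPdist_lt C C^o) /(_ _ e4) := @cvg_psum F f x N Ff.
apply: filterS => n psn.
have t1 := le_lt_trans (psum_tail N x1 fM fv) BN.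
have t2 := le_lt_trans (psum_tail N x1 (FM n) (Fs n)) BN.
rewrite (_ : v - s n = (v - psum x f N) + (psum x f N - psum x (F n) N)
   - (s n - psum x (F n) N)); last by ring.
apply: (le_lt_trans (ler_normB _ _)).
apply: (@lt_trans _ _ (e / 4 + e / 4 + e / 4)).
  by rewrite ltrD// (le_lt_trans (ler_normD _ _))// ltrD.
rewrite -subr_gt0 (_ : _ - _ = e / 4)//.
by field.
Qed.

End ComplexSeries.

(** * Shifted factorials: algebra, bounds and limits *)

Section ShiftedFactorials.
Variable C : numClosedFieldType.
Implicit Types (a b c q x : C).

Lemma qpoch0 a q : qpoch a q 0 = 1.
Proof. by rewrite /qpoch big_ord0. Qed.

Lemma qpochS a q i : qpoch a q i.+1 = qpoch a q i * (1 - a * q ^+ i).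
Proof. by rewrite /qpoch big_ord_recr. Qed.

Lemma qpochD a q m n : qpoch a q (m + n) = qpoch a q m * qpoch (a * q ^+ m) q n.
Proof.
rewrite /qpoch big_split_ord; congr (_ * _); apply: eq_bigr => i _ /=.
by rewrite exprD mulrA.
Qed.

Lemma qpochSl a q i : qpoch a q i.+1 = (1 - a) * qpoch (a * q) q i.
Proof. by rewrite -add1n qpochD qpochS qpoch0 expr0 mulr1 mul1r expr1. Qed.

Lemma qpoch_eq0 a q i : (qpoch a q i == 0) = [exists j : 'I_i, a * q ^+ j == 1].
Proof.
apply/prodf_eq0/existsP => [[j _]|[j]]; rewrite ?subr_eq0 => e; exists j => //.
  by rewrite eq_sym.
by rewrite subr_eq0 eq_sym.
Qed.

Lemma qpoch_neq0 a q i :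
  (forall j, (j < i)%N -> a * q ^+ j != 1) -> qpoch a q i != 0.
Proof. by move=> ne; rewrite qpoch_eq0; apply/existsPn => j; apply: ne. Qed.

Lemma eq_expNr a q j : q != 0 -> (a == q ^- j) = (a * q ^+ j == 1).
Proof.
by move=> q0; rewrite -[RHS](inj_eq (mulIf (expf_neq0 j (invr_neq0 q0)))) exprVn mul1r mulfK ?expf_neq0.
Qed.

Lemma norm_exp_lt1 q i : `|q| < 1 -> (0 < i)%N -> `|q ^+ i| < 1.
Proof. by move=> q1 i0; rewrite normrX exprn_ilt1 ?normr_ge0// -lt0n. Qed.

Lemma qexp_neq1 q i : `|q| < 1 -> (0 < i)%N -> q ^+ i != 1.
Proof.
move=> q1 i0; apply/eqP => e; have := norm_exp_lt1 q1 i0.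
by rewrite e normr1 ltxx.
Qed.

Lemma qpoch_qq_neq0 q i : `|q| < 1 -> qpoch q q i != 0.
Proof. by move=> q1; apply: qpoch_neq0 => j _; rewrite -exprS qexp_neq1. Qed.

Lemma qexp_inj q i j : 0 < `|q| < 1 -> q ^+ i = q ^+ j -> i = j.
Proof.
move=> /andP[q0 q1]; wlog ij : i j / (i <= j)%N => [H e|].
  by case/orP: (leq_total i j) => ij; [|apply/esym]; apply: H => //.
rewrite -(subnK ij) exprD => /eqP.
rewrite eq_sym -subr_eq0 -{2}[q ^+ i]mul1r -mulrBl mulf_eq0 expf_eq0.
rewrite -[q == 0]normr_eq0 (gt_eqF q0) andbF orbF subr_eq0.
by case: (posnP (j - i)) => [->//|d0]; rewrite (negPf (qexp_neq1 q1 d0)).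
Qed.

End ShiftedFactorials.

Section QLimits.
Variable R : realType.
Local Notation C := (Cplx R).
Implicit Types (a b c q x p : C).

(** Weierstrass' inequalities: with s = |a| (1 + |q| + ... + |q|^(i-1)), which is at
    most 1/2 here, the product lies between 1 - s and 1 / (1 - s). *)
Lemma qpoch_small_bounds a q i :
  `|q| < 1 -> `|a| <= (1 - `|q|) / 2 -> 2^-1 <= `|qpoch a q i| <= 2.
Proof.
move=> q1 aq; pose s i := `|a| * (1 - `|q| ^+ i) / (1 - `|q|).
have q1' : 0 < 1 - `|q| by rewrite subr_gt0.
have s2 j : s j <= 2^-1.
  rewrite /s ler_pdivrMr// (le_trans _ (_ : `|a| <= _))//; last by rewrite mulrC.
  by rewrite ler_piMr// gerBl exprn_ge0.
have s0 j : 0 <= s j.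
  by rewrite /s divr_ge0 ?(ltW q1')// mulr_ge0// subr_ge0 exprn_ile1// ltW.
have sS j : s j.+1 = s j + `|a| * `|q| ^+ j.
  by rewrite /s exprS; field; rewrite gt_eqF.
have u0 j : 0 <= `|a| * `|q| ^+ j by rewrite mulr_ge0// exprn_ge0.
have half1 : (2^-1 : C) <= 1 by rewrite invf_le1// ler1n.
have : 1 - s i <= `|qpoch a q i| /\ `|qpoch a q i| * (1 - s i) <= 1.
  elim: i => [|i [lo hi]].
    by rewrite qpoch0 normr1 /s expr0 subrr mulr0 mul0r subr0 mulr1.
  rewrite qpochS normrM; have := normr_ge0 (qpoch a q i).
  set P := `|qpoch a q i| in lo hi * => P0.
  set u := `|a| * `|q| ^+ i; have ui0 : 0 <= u := u0 i; have uE : `|a * q ^+ i| = u by rewrite normrM normrX.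
  have u1 : 0 <= 1 - u.
    by rewrite subr_ge0 (le_trans _ half1)// (le_trans _ (s2 i.+1))// sS lerDr.
  have S1 : 0 <= 1 - s i.+1 by rewrite subr_ge0 (le_trans (s2 _)).
  have lou : 1 - u <= `|1 - a * q ^+ i|.
    by rewrite -uE -[X in X - _]normr1 lerB_dist.
  have hiu : `|1 - a * q ^+ i| <= 1 + u.
    by rewrite -uE (le_trans (ler_normB _ _))// normr1.
  split.
    apply: (@le_trans _ _ ((1 - s i) * (1 - u))).
      have -> : 1 - s i.+1 = (1 - s i) * (1 - u) - s i * u by rewrite sS -/u; ring.
      by rewrite gerBl mulr_ge0.
    apply: (@le_trans _ _ (P * (1 - u))); first exact: ler_wpM2r.
    by apply: ler_wpM2l.
  apply: le_trans hi; rewrite -mulrA; apply: ler_wpM2l => //.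
  apply: (@le_trans _ _ ((1 + u) * (1 - s i.+1))); first exact: ler_wpM2r.
  have -> : (1 + u) * (1 - s i.+1) = 1 - s i - (u * s i + u * u).
    by rewrite sS -/u; ring.
  by rewrite gerBl addr_ge0 // mulr_ge0.
case=> lo hi; have S2 : 2^-1 <= 1 - s i.
  by rewrite lerBrDr -lerBrDl (le_trans (s2 i))// [leRHS](_ : _ = 2^-1)//; field.
rewrite (le_trans S2 lo)/=.
have : `|qpoch a q i| * 2^-1 <= 1 by apply: le_trans hi; apply: ler_wpM2l.
by rewrite ler_pdivrMr// mul1r.
Qed.

Lemma eventually_small a q :
  `|q| < 1 -> exists J, `|a * q ^+ J| <= (1 - `|q|) / 2.
Proof.
move=> q1; have e0 : 0 < (1 - `|q|) / 2 by rewrite divr_gt0// subr_gt0.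
have : a * q ^+ N @[N --> \oo] --> (0 : C).
  by rewrite -(mulr0 a); apply: cvg_seqM; [exact: cvg_seq_cst|exact: cvg_expr0].
move=> /(@cvgrPdist_lt C C^o) /(_ _ e0)[J _ /(_ J (leqnn _))] /=.
by rewrite sub0r normrN => /ltW aJ; exists J.
Qed.

Lemma bounded_prefix (u : nat -> C) J (M : C) :
  (forall i, `|u (J + i)%N| <= M) -> exists M', forall i, `|u i| <= M'.
Proof.
move=> uM; exists (\sum_(j < J) `|u j| + M) => i.
have M0 : 0 <= M by apply: le_trans (uM 0%N).
case: (ltnP i J) => iJ.
  by rewrite (bigD1 (Ordinal iJ)) //= -addrA lerDl addr_ge0 // sumr_ge0.
by rewrite -(subnKC iJ) (le_trans (uM _))// lerDr sumr_ge0.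
Qed.

Lemma qpoch_bounded a q : `|q| < 1 -> exists M, forall i, `|qpoch a q i| <= M.
Proof.
move=> q1; have [J aJ] := eventually_small a q1.
apply: (@bounded_prefix _ J (`|qpoch a q J| * 2)) => i.
rewrite qpochD normrM ler_wpM2l//.
by have /andP[] := qpoch_small_bounds i q1 aJ.
Qed.

(** Past a finite prefix the factors are near 1, and a vanishing symbol has the
    inverse 0; so zeros of (a; q)_i are harmless. *)
Lemma qpoch_inv_bounded a q :
  `|q| < 1 -> exists M, forall i, `|(qpoch a q i)^-1| <= M.
Proof.
move=> q1; have [J aJ] := eventually_small a q1.
apply: (@bounded_prefix (fun i => (qpoch a q i)^-1) J (`|(qpoch a q J)^-1| * 2)) => i.
rewrite qpochD invfM normrM ler_wpM2l//.
have /andP[lo _] := qpoch_small_bounds i q1 aJ.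
rewrite normfV -[leRHS]invrK lef_pV2// posrE ?invr_gt0//.
by apply: lt_le_trans lo; rewrite invr_gt0.
Qed.

(** The difference of consecutive symbols is - a (a; q)_i q^i, so they are the partial
    sums of a power series with bounded coefficients, taken at q. *)
Lemma cvg_qpoch a q : `|q| < 1 -> qpoch a q i @[i --> \oo] --> qpochinf a q.
Proof.
move=> q1; have [M aM] := qpoch_bounded a q1.
have [v vE] : exists v, converges q (fun i => - a * qpoch a q i) v.
  apply: (@bounded_converges _ _ _ (`|a| * M)) => // i.
  by rewrite normrM normrN ler_wpM2l.
have cv : qpoch a q i @[i --> \oo] --> 1 + v.
  rewrite (_ : qpoch a q = fun N => 1 + psum q (fun i => - a * qpoch a q i) N).
    by apply: cvg_seqD; [exact: cvg_seq_cst|exact: vE].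
  apply/funext; elim=> [|N ih]; first by rewrite qpoch0 /psum big_ord0 addr0.
  by rewrite psumS addrA -ih qpochS; ring.
by rewrite /qpochinf (cvg_lim _ cv).
Qed.

Lemma qpochinf_neq0 a q :
  `|q| < 1 -> (forall j, a * q ^+ j != 1) -> qpochinf a q != 0.
Proof.
move=> q1 ne; have [M aM] := qpoch_inv_bounded a q1.
have M0 : 0 <= M by apply: le_trans (aM 0%N).
apply/eqP => e; have := cvg_qpoch (a := a) q1.
have e0 : 0 < (M + 1)^-1 by rewrite invr_gt0 ltr_wpDl.
rewrite e => /(@cvgrPdist_lt C C^o) /(_ _ e0)[J _ /(_ J (leqnn _))] /=.
rewrite sub0r normrN => lt1; have := aM J; rewrite normfV.
have P0 : 0 < `|qpoch a q J| by rewrite normr_gt0 qpoch_neq0.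
rewrite -[_^-1]mul1r ler_pdivrMr// => le1; move: lt1.
rewrite -[(M + 1)^-1]mul1r ltr_pdivlMr ?ltr_wpDl// mulrDr mulr1 mulrC => lt1.
suff : (1 : C) < 1 by rewrite ltxx.
by apply: (le_lt_trans le1); apply: le_lt_trans lt1; rewrite lerDl.
Qed.

End QLimits.

(** * The coefficients of 2phi1 and the limit to 1phi0 *)

Definition coef (C : numClosedFieldType) (a b c q : C) (i : nat) : C :=
  qpoch a q i * qpoch b q i / (qpoch q q i * qpoch c q i).

Section Evaluation.
Variable R : realType.
Local Notation C := (Cplx R).
Implicit Types (a b c q x p : C).

Lemma coef_bounded a b c q : `|q| < 1 -> exists M, forall i, `|coef a b c q i| <= M.
Proof.
move=> q1.
have [A aA] := qpoch_bounded a q1; have [B bB] := qpoch_bounded b q1.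
have [Q qQ] := qpoch_inv_bounded q q1; have [D cD] := qpoch_inv_bounded c q1.
exists (A * B * (Q * D)) => i; rewrite /coef invfM !normrM.
by rewrite !ler_pM ?mulr_ge0.
Qed.

Lemma coef_converges a b c q x :
  `|q| < 1 -> `|x| < 1 -> exists v, converges x (coef a b c q) v.
Proof.
move=> q1 x1; have [M aM] := coef_bounded a b c q1.
exact: (bounded_converges x1 aM).
Qed.

Lemma cvg_geometric0 a q k :
  `|q| < 1 -> (0 < k)%N -> a * q ^+ (k * n) @[n --> \oo] --> (0 : C).
Proof.
move=> q1 k0; rewrite -(mulr0 a); apply: cvg_seqM; first exact: cvg_seq_cst.
rewrite (_ : (fun _ => _) = (fun n => (q ^+ k) ^+ n)); first exact/cvg_expr0/norm_exp_lt1.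
by apply/funext => n; rewrite exprM.
Qed.

(** Continuity of a power series at 0, along the geometric sequences to which a
    q-difference equation leads. *)
Lemma power_series_at0 (f : nat -> C) x q k (s : nat -> C) (M : C) :
  `|q| < 1 -> (0 < k)%N -> `|x| < 1 -> (forall i, `|f i| <= M) ->
  (forall n, converges (x * q ^+ (k * n)) f (s n)) -> s n @[n --> \oo] --> f 0%N.
Proof.
move=> q1 k0 x1 fM fs.
pose g i := if i is 0 then f 0%N else 0.
apply: (@tannery _ (fun n i => f i * (q ^+ (k * n)) ^+ i) g x M s _ x1).
- move=> n i; rewrite normrM normrX -[leRHS]mulr1 ler_pM// ?exprn_ge0//.
  by rewrite exprn_ile1// normrX exprn_ile1// ltW.
- case=> [|i].
    by apply: (cvg_seq_ext (cvg_seq_cst (f 0%N))) => // n; rewrite expr0 mulr1.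
  rewrite /g -(mulr0 (f i.+1)); apply: cvg_seqM; first exact: cvg_seq_cst.
  rewrite (_ : (fun _ => _) = (fun n => 1 * q ^+ (k * i.+1 * n))).
    by apply: cvg_geometric0; rewrite // muln_gt0 k0.
  by apply/funext => n; rewrite mul1r -exprM mulnAC.
- by move=> n; apply/converges_scale.
- have -> : f 0%N = psum x g 1 by rewrite psumS /psum big_ord0 add0r mulr1.
  by apply: converges_finite; case.
Qed.

Lemma cvg_seqV (u : nat -> C) (v : C) :
  v != 0 -> u N @[N --> \oo] --> v -> (u N)^-1 @[N --> \oo] --> v^-1.
Proof. exact: (@cvgV C). Qed.

(** The sum s satisfies (1 - x) s(x) = (1 - a x) s(p x), as a comparison of
    coefficients shows; iterate and let the argument tend to 0, where s = 1. *)
Lemma q_binomial a p x : 0 < `|p| < 1 -> `|x| < 1 ->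
  converges x (fun i => qpoch a p i / qpoch p p i)
    (qpochinf (a * x) p / qpochinf x p).
Proof.
move=> /andP[p0 p1] x1; set f := (fun i : nat => _).
have fM : exists M, forall i, `|f i| <= M.
  have [A aA] := qpoch_bounded a p1; have [Q qQ] := qpoch_inv_bounded p p1.
  by exists (A * Q) => i; rewrite normrM ler_pM.
have [M {}fM] := fM.
have xp1 n : `|x * p ^+ n| < 1.
  rewrite normrM normrX (le_lt_trans _ x1)// -[leRHS]mulr1 ler_wpM2l//.
  by rewrite exprn_ile1// ltW.
have /choice[s sE] n : exists v, converges (x * p ^+ n) f v.
  exact: bounded_converges (xp1 n) fM.
have rel n : (1 - x * p ^+ n) * s n = (1 - a * x * p ^+ n) * s n.+1.
  pose y := x * p ^+ n; have s1 := sE n; have := sE n.+1.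
  rewrite exprSr mulrA => /converges_scale s2.
  have := convergesD s1 (convergesZ (-1) (converges_delay s1)).
  have := convergesD s2 (convergesZ (- a) (converges_delay s2)).
  move=> c2 c1; rewrite -/y in c1 c2.
  have fS i : f i.+1 * (1 - p ^+ i.+1) = f i * (1 - a * p ^+ i).
    rewrite /f !qpochS -exprS invfM.
    have := qexp_neq1 p1 (ltn0Sn i); have := qpoch_qq_neq0 i p1.
    by move=> h1 h2; field; rewrite h1 subr_eq0 eq_sym h2.
  have -> : (1 - x * p ^+ n) * s n = s n + -1 * (y * s n) by rewrite /y; ring.
  have -> : (1 - a * x * p ^+ n) * s n.+1 = s n.+1 + - a * (y * s n.+1).
    by rewrite /y; ring.
  apply: converges_unique c1 _; apply: converges_ext c2 => -[|i] /=.
    by rewrite expr0 mulr1 !mulr0.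
  by apply/eqP; rewrite -subr_eq0; apply/eqP; transitivity
    (f i * (1 - a * p ^+ i) - f i.+1 * (1 - p ^+ i.+1)); [ring|rewrite fS subrr].
have prod n : qpoch x p n * s 0%N = qpoch (a * x) p n * s n.
  elim: n => [|n ih]; first by rewrite !qpoch0.
  by rewrite !qpochS mulrAC ih mulrAC -mulrA -[RHS]mulrA -rel mulrA mulrC mulrA mulrC.
have s1 : s n @[n --> \oo] --> f 0%N.
  apply: (@power_series_at0 f x p 1 s M) => // n.
  by rewrite mul1n.
have f0 : f 0%N = 1 by rewrite /f !qpoch0 divr1.
rewrite f0 in s1.
have xn0 : qpochinf x p != 0.
  apply: qpochinf_neq0 => // j; apply/eqP => e; have := xp1 j.
  by rewrite e normr1 ltxx.
have : qpochinf x p * s 0%N = qpochinf (a * x) p * 1.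
  apply: (@cvg_seq_unique _ (fun n => qpoch x p n * s 0%N)).
    by apply: cvg_seqM; [exact: cvg_qpoch|exact: cvg_seq_cst].
  rewrite (_ : (fun _ => _) = (fun n => qpoch (a * x) p n * s n)).
    by apply: cvg_seqM; [exact: cvg_qpoch|].
  by apply/funext => n; rewrite prod.
rewrite mulr1 => <-; rewrite mulrAC (divff xn0) mul1r.
by have := sE 0%N; rewrite expr0 mulr1; apply.
Qed.

(** The majorant (- |b|; |q|)_i does not involve n. *)
Lemma qpoch_shift_bounded b q :
  `|q| < 1 -> exists M, forall n i, `|qpoch (b * q ^+ n) q i| <= M.
Proof.
move=> q1; have q1' : `| `|q| | < 1 by rewrite normr_id.
have [M bM] := qpoch_bounded (- `|b|) q1'; exists M => n i.
apply: le_trans (bM i); rewrite /qpoch !normr_prod; apply: ler_prod => j _.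
rewrite normr_ge0/= mulNr opprK [leRHS]ger0_norm ?addr_ge0 ?mulr_ge0 ?exprn_ge0//.
rewrite (le_trans (ler_normB _ _))// normr1 lerD2l !normrM !normrX ler_wpM2r ?exprn_ge0//.
by rewrite ler_piMr// exprn_ile1// ltW.
Qed.

Lemma qpoch_shift_inv_bounded c q : `|q| < 1 -> (forall j, c * q ^+ j != 1) ->
  exists M, forall n i, `|(qpoch (c * q ^+ n) q i)^-1| <= M.
Proof.
move=> q1 ne; have [M cM] := qpoch_bounded c q1.
have [M' cM'] := qpoch_inv_bounded c q1; exists (M * M') => n i.
have c0 k : qpoch c q k != 0 by apply: qpoch_neq0.
rewrite (_ : _^-1 = qpoch c q n * (qpoch c q (n + i))^-1).
  by rewrite normrM ler_pM.
by rewrite qpochD invfM mulrA divff// mul1r.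
Qed.

Lemma cvg_qpoch_shift b q k i : `|q| < 1 -> (0 < k)%N ->
  qpoch (b * q ^+ (k * n)) q i @[n --> \oo] --> (1 : C).
Proof.
move=> q1 k0; elim: i => [|i ih].
  by apply: (cvg_seq_ext (cvg_seq_cst 1)) => // n; rewrite qpoch0.
have c0 : b * q ^+ i * q ^+ (k * n) @[n --> \oo] --> (0 : C) by apply: cvg_geometric0.
apply: (cvg_seq_ext (cvg_seqM ih (cvg_seqD (cvg_seq_cst 1) (cvg_seqM (cvg_seq_cst (- 1)) c0)))).
  by move=> n; rewrite qpochS; ring.
by rewrite mulr0 addr0 mulr1.
Qed.

(** As b and c tend to 0 along powers of q, the coefficients tend to those of 1phi0
    and stay bounded uniformly in n, so the sums converge to the sum of 1phi0. *)
Lemma phi21_limit_1phi0 a b c q x k (s : nat -> C) :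
  0 < `|q| < 1 -> (0 < k)%N -> `|x| < 1 -> (forall j, c * q ^+ j != 1) ->
  (forall n, converges x (coef a (b * q ^+ (k * n)) (c * q ^+ (k * n)) q) (s n)) ->
  s n @[n --> \oo] --> qpochinf (a * x) q / qpochinf x q.
Proof.
move=> q01 k0 x1 ne fs; have /andP[q0 q1] := q01.
have [A aA] := qpoch_bounded a q1; have [B bB] := qpoch_shift_bounded b q1.
have [Q qQ] := qpoch_inv_bounded q q1; have [D cD] := qpoch_shift_inv_bounded q1 ne.
apply: (@tannery _ _ (fun i => qpoch a q i / qpoch q q i) x (A * B * (Q * D)) s _ x1 _ _ fs).
- move=> n i; rewrite /coef invfM !normrM.
  by rewrite !ler_pM ?mulr_ge0.
- move=> i; have cb := cvg_qpoch_shift b i q1 k0; have cc := cvg_qpoch_shift c i q1 k0.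
  have ci := cvg_seqV (oner_neq0 _) cc.
  apply: (cvg_seq_ext (cvg_seqM (cvg_seq_cst (qpoch a q i / qpoch q q i)) (cvg_seqM cb ci))).
    by move=> n; rewrite /coef invfM mulrACA.
  by rewrite invr1 !mulr1.
- exact: q_binomial.
Qed.

End Evaluation.

(** * Contiguous relations between coefficients *)

Section Contiguity.
Variables (C : numClosedFieldType) (q : C).
Hypothesis q1 : `|q| < 1.
Implicit Types (a b c : C).

(** The common form of a parameter c that is no q^-j and of a truncated series:
    (a q; q)_i (b q; q)_i vanishes wherever (c q; q)_i does, and c is not 1. As
    1 / 0 = 0, the coefficients then vanish past the truncation without being cut
    off, and they satisfy the recurrences of the generic case. Stated like this,
    the condition passes from (b, c) to (b q, c q). *)
Definition truncating a b c : Prop :=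
  forall i, c * q ^+ i = 1 ->
  exists r, [/\ (0 < r)%N, (r <= i)%N & a * q ^+ r = 1 \/ b * q ^+ r = 1].

Lemma qpoch_vanishes a j i : a * q ^+ j = 1 -> (j < i)%N -> qpoch a q i = 0.
Proof.
by move=> e ji; apply/eqP; rewrite qpoch_eq0; apply/existsP; exists (Ordinal ji); rewrite e.
Qed.

Lemma subr_inverse (x y : C) : x * y = 1 -> 1 - x = - x * (1 - y).
Proof. by move=> e; rewrite mulrBr mulr1 mulNr e opprK addrC. Qed.

Lemma truncating_neq1 a b c : truncating a b c -> c != 1.
Proof.
by move=> t; apply/eqP => c1; case: (t 0%N) => [|[|r] []//]; rewrite expr0 mulr1.
Qed.

Lemma subr_qexp_neq0 i : 1 - q ^+ i.+1 != 0.
Proof. by rewrite subr_eq0 eq_sym qexp_neq1. Qed.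

Lemma coefV a b c i : c != 1 ->
  coef a b c q i.+1 =
  (1 - a) * (1 - b) / ((1 - q ^+ i.+1) * (1 - c)) * coef (a * q) (b * q) (c * q) q i.
Proof.
move=> c1; rewrite /coef 2!(qpochSl _ q i) (qpochSl c q i) (qpochS q) -exprS !invfM; ring.
Qed.

Lemma coefV1 a b c i : c * q ^+ i.+1 != 1 ->
  coef a (b * q) (c * q) q i.+1 =
  (1 - a) * (1 - b * q ^+ i.+1) / ((1 - q ^+ i.+1) * (1 - c * q ^+ i.+1))
  * coef (a * q) (b * q) (c * q) q i.
Proof.
move=> c1; rewrite /coef (qpochSl a q i) !(qpochS _ q i) -!exprS -!mulrA -!exprS !invfM.
ring.
Qed.

Lemma coefW a b c i : c * q ^+ i.+1 != 1 ->
  coef (a * q) (b * q) (c * q) q i.+1 =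
  (1 - a * q ^+ i.+1) * (1 - b * q ^+ i.+1) / ((1 - q ^+ i.+1) * (1 - c * q ^+ i.+1))
  * coef (a * q) (b * q) (c * q) q i.
Proof.
move=> c1; rewrite /coef !(qpochS _ q i) -!exprS -!mulrA -!exprS !invfM; ring.
Qed.

Lemma coefW1 a b c i : c * q ^+ i.+1 != 1 -> c * q != 1 ->
  (1 - b * q) * coef (a * q) (b * q * q) (c * q * q) q i =
  (1 - b * q ^+ i.+1) * (1 - c * q) / (1 - c * q ^+ i.+1)
  * coef (a * q) (b * q) (c * q) q i.
Proof.
move=> c1 c2.
have eb := qpochSl (b * q) q i; have ec := qpochSl (c * q) q i.
rewrite !qpochS -!mulrA -!exprS in eb ec.
have n1 : 1 - c * q ^+ i.+1 != 0 by rewrite subr_eq0 eq_sym.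
have n2 : 1 - c * q != 0 by rewrite subr_eq0 eq_sym.
have ec' : (qpoch (c * q * q) q i)^-1 =
    (1 - c * q) / (1 - c * q ^+ i.+1) * (qpoch (c * q) q i)^-1.
  have -> : qpoch (c * q * q) q i = qpoch (c * q) q i * (1 - c * q ^+ i.+1) / (1 - c * q).
    by rewrite -[c * q * q]mulrA ec mulrAC divff// mul1r.
  by rewrite !invfM invrK; ring.
rewrite /coef invfM ec' -[in RHS]mulrA.
rewrite [LHS](_ : _ = (1 - b * q) * qpoch (b * q * q) q i * (qpoch (a * q) q i *
   ((qpoch q q i)^-1 * ((1 - c * q) / (1 - c * q ^+ i.+1) * (qpoch (c * q) q i)^-1)))); last by ring.
rewrite -[b * q * q]mulrA -eb invfM; ring.
Qed.

(* The inverse of 0 is 0: from the first zero of (c q; q)_i on, coefficients with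
   that denominator vanish whatever their numerator is. *)
Lemma coef_denominator0 a b c i : c * q ^+ i.+1 = 1 -> coef a b (c * q) q i.+1 = 0.
Proof.
move=> e; rewrite /coef (@qpoch_vanishes (c * q) i i.+1)// ?mulr0 ?invr0 ?mulr0//.
by rewrite -mulrA -exprS.
Qed.

Lemma coefW1_denominator0 a b c i : c * q != 1 -> c * q ^+ i.+1 = 1 ->
  coef a b (c * q * q) q i = 0.
Proof.
case: i => [|i] cq e; first by move: cq; rewrite -e expr1 eqxx.
by rewrite coef_denominator0// -mulrA -exprS.
Qed.

(** At the first zero of (c q; q)_(i+1) the numerator has either its first zero, too,
    or an earlier one, and then the coefficient of W is already 0. *)
Lemma truncating_zero a b c i : truncating a b c -> c * q ^+ i.+1 = 1 ->
  [\/ a * q ^+ i.+1 = 1, b * q ^+ i.+1 = 1 | coef (a * q) (b * q) (c * q) q i = 0].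
Proof.
move=> t /t[[|r] []// _ ri ab].
case: (ltnP r i) => ri'.
  apply: Or33; rewrite /coef.
  have vanish y : y * q ^+ r.+1 = 1 -> qpoch (y * q) q i = 0.
    by move=> e; apply: (@qpoch_vanishes _ r) => //; rewrite -mulrA -exprS.
  by case: ab => /vanish ->; rewrite ?(mul0r, mulr0).
have -> : i = r by apply/eqP; rewrite eqn_leq ri' -ltnS ri.
by case: ab => e; [apply: Or31|apply: Or32].
Qed.

Lemma coefW_rec a b c i : truncating a b c ->
  (1 - q ^+ i.+1) * (1 - c * q ^+ i.+1) * coef (a * q) (b * q) (c * q) q i.+1 =
  (1 - a * q ^+ i.+1) * (1 - b * q ^+ i.+1) * coef (a * q) (b * q) (c * q) q i.
Proof.
move=> t; case: (eqVneq (c * q ^+ i.+1) 1) => [e|ne].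
  rewrite e subrr mulr0 mul0r.
  by case: (truncating_zero t e) => ->; rewrite ?(subrr, mulr0, mul0r).
rewrite coefW//; field.
by rewrite subr_qexp_neq0 subr_eq0 eq_sym ne.
Qed.

(** If c is not a, then only b can give the numerator its first zero at the index
    where the denominator has its own. *)
Lemma distinct_zeros a c : c != a -> forall j, c * q ^+ j = 1 -> a * q ^+ j != 1.
Proof.
move=> ca j e; apply: contra ca => /eqP e'; apply/eqP.
have q0 : q ^+ j != 0.
  by apply/eqP => q0; move: e; rewrite q0 mulr0 => /eqP; rewrite eq_sym oner_eq0.
by apply: (mulIf q0); rewrite e e'.
Qed.

(** At index i + 1 all coefficients are rational multiples of the coefficient of W at
    index i, which leaves an identity of rational functions; where 1 - c q^(i+1)
    vanishes, the terms that 1 / 0 = 0 removes cancel by truncating_zero. The same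
    argument proves the other contiguous relations. *)
Lemma contiguous_V1 a b c i : truncating a b c ->
  (forall j, c * q ^+ j = 1 -> a * q ^+ j != 1) ->
  (c - a) * coef a (b * q) (c * q) q i =
  (1 - a) * c * coef (a * q) (b * q) (c * q) q i - a * (1 - c) * coef a b c q i
  - (1 - a) * (a * b) * delay (coef (a * q) (b * q) (c * q) q) i.
Proof.
move=> t ca; case: i => [|i] /=.
  by rewrite /coef !qpoch0 !mulr1 divr1; ring.
have c1 := truncating_neq1 t; have c1' : 1 - c != 0 by rewrite subr_eq0 eq_sym.
have X1 := subr_qexp_neq0 i.
rewrite (@coefV a b c)//; case: (eqVneq (c * q ^+ i.+1) 1) => [e|ne]; last first.
  have ne' : 1 - c * q ^+ i.+1 != 0 by rewrite subr_eq0 eq_sym.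
  by rewrite coefV1// coefW//; field; rewrite X1 ne' c1'.
rewrite !coef_denominator0//.
have [ea|eb|->] := truncating_zero t e; last by ring.
  by move: (ca _ e); rewrite ea eqxx.
rewrite (subr_inverse eb).
by field; rewrite X1 c1'.
Qed.

(** The exponents at which b and c reach 1 both drop by one; b q is not 1, so that of
    b does not drop to 0, and a does not reach 1 together with c. *)
Lemma truncating_step a b c : truncating a b c ->
  (forall j, c * q ^+ j = 1 -> a * q ^+ j != 1) -> b * q != 1 ->
  truncating a (b * q) (c * q) /\ c * q != 1.
Proof.
move=> t ca bq.
have key i : c * q ^+ i.+1 = 1 -> exists r, [/\ (0 < r)%N, (r <= i)%N &
    a * q ^+ r = 1 \/ (b * q) * q ^+ r = 1].
  move=> e; have [[|r] []// _ ri ab] := t _ e.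
  case: ab => ab.
    exists r.+1; split=> //; last by left.
    rewrite ltn_neqAle -ltnS ri andbT; apply/eqP => ir.
    by move: (ca _ e); rewrite -ir ab eqxx.
  case: r ri ab => [|r] ri ab.
    by move: bq; rewrite expr1 in ab; rewrite ab eqxx.
  exists r.+1; split=> //; right.
  by rewrite -mulrA -exprS.
split; first by move=> i e; apply: key; rewrite exprS mulrA.
apply/eqP => e; have := key 0%N; rewrite expr1 => /(_ e)[[|r] []//].
Qed.

Lemma contiguous_W1 a b c i : truncating a b c ->
  (forall j, c * q ^+ j = 1 -> a * q ^+ j != 1) -> c * q != 1 ->
  (1 - b * q) * (c - a) * delay (coef (a * q) (b * q * q) (c * q * q) q) i =
  (1 - c * q) * ((c - 1) * coef (a * q) (b * q) (c * q) q i
    + (1 - c) * coef a b c q i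
    + (1 - a) * b * delay (coef (a * q) (b * q) (c * q) q) i).
Proof.
move=> t ca cq; case: i => [|i] /=.
  by rewrite /coef !qpoch0 !mulr1 divr1; ring.
have c1 := truncating_neq1 t; have c1' : 1 - c != 0 by rewrite subr_eq0 eq_sym.
have X1 := subr_qexp_neq0 i.
rewrite [LHS]mulrAC (@coefV a b c)//; case: (eqVneq (c * q ^+ i.+1) 1) => [e|ne]; last first.
  have ne' : 1 - c * q ^+ i.+1 != 0 by rewrite subr_eq0 eq_sym.
  by rewrite coefW1// coefW//; field; rewrite X1 ne' c1'.
rewrite coef_denominator0//.
rewrite coefW1_denominator0 ?mulr0//.
have [ea|eb|->] := truncating_zero t e; last by ring.
  by move: (ca _ e); rewrite ea eqxx.
rewrite (subr_inverse eb).
by field; rewrite X1 c1'.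
Qed.

(** Free of the factor c - a, unlike contiguous_W1, hence usable where c = a. *)
Lemma contiguous_W1_V1 a b c i : c * q != 1 ->
  a * (1 - b * q) * delay (coef (a * q) (b * q * q) (c * q * q) q) i =
  (1 - c * q) * (coef (a * q) (b * q) (c * q) q i - coef a (b * q) (c * q) q i).
Proof.
move=> cq; case: i => [|i] /=; first by rewrite /coef !qpoch0 !mulr1 divr1; ring.
case: (eqVneq (c * q ^+ i.+1) 1) => [e|ne].
  by rewrite !coef_denominator0// coefW1_denominator0// subrr !mulr0.
have X1 := subr_qexp_neq0 i.
have ne' : 1 - c * q ^+ i.+1 != 0 by rewrite subr_eq0 eq_sym.
rewrite -[LHS]mulrA coefW1// coefW// coefV1//; field.
by rewrite X1 ne'.
Qed.

(** Divided by q^i, this relates V and W to W at x / q: the source of relations that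
    shift x to x / q. *)
Lemma contiguous_W_scaled a b c i : truncating a b c ->
  (1 - c * q ^+ i) * coef (a * q) (b * q) (c * q) q i
  - (1 - a * b * q ^+ i) * delay (coef (a * q) (b * q) (c * q) q) i =
  (1 - c) * q ^+ i * coef a b c q i.
Proof.
move=> t; case: i => [|i] /=; first by rewrite /coef !qpoch0 expr0 !mulr1 divr1; ring.
have c1 := truncating_neq1 t; have c1' : 1 - c != 0 by rewrite subr_eq0 eq_sym.
have X1 := subr_qexp_neq0 i; have rec := coefW_rec i t.
rewrite (@coefV a b c)//; apply: (mulfI X1).
rewrite [LHS]mulrBr [X in X - _]mulrA rec; field.
by rewrite X1 c1'.
Qed.

Lemma coefV_rec a b c i : truncating a b c ->
  (1 - q ^+ i.+1) * (1 - c * q ^+ i) * coef a b c q i.+1 =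
  (1 - a * q ^+ i) * (1 - b * q ^+ i) * coef a b c q i.
Proof.
move=> t; have c1 := truncating_neq1 t; have c1' : 1 - c != 0 by rewrite subr_eq0 eq_sym.
case: i => [|i].
  have X1 := subr_qexp_neq0 0; rewrite expr1 in X1.
  by rewrite coefV// expr0 expr1 !mulr1 /coef !qpoch0; field; rewrite c1' X1.
have := coefW_rec i t; rewrite !(@coefV a b c)//.
have X1 := subr_qexp_neq0 i; have X2 := subr_qexp_neq0 i.+1.
move: (coef (a * q) _ _ q i.+1) (coef (a * q) _ _ q i) => w w' rec.
apply: (mulfI X1); transitivity ((1 - a) * (1 - b) / (1 - c) * ((1 - q ^+ i.+1) * (1 - c * q ^+ i.+1) * w)).
  by field; rewrite X2 c1'.
by rewrite rec; field; rewrite X1 c1'.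
Qed.

(** The coefficients at x q are q^i times those at x, so 1 - q^i stands for the
    q-difference operator: this is Heine's equation of second order in x. *)
Lemma contiguous_xq2 a b c i : truncating a b c ->
  c * (coef a b c q i * (q ^+ 2) ^+ i)
  - a * b * q * delay (fun j => coef a b c q j * (q ^+ 2) ^+ j) i =
  c * coef a b c q i + q * (1 - a - b) * delay (coef a b c q) i
  - (q + c) * ((1 - q ^+ i) * coef a b c q i)
  + (a + b) * q * delay (fun j => (1 - q ^+ j) * coef a b c q j) i.
Proof.
move=> t; case: i => [|i] /=; first by rewrite !expr0; ring.
have rec := coefV_rec i t; rewrite -!exprM !mulnS !mul2n -!addnn !exprD !exprS expr0 in rec *.
apply/eqP; rewrite -subr_eq0; apply/eqP.
transitivity (q * ((1 - q * q ^+ i) * (1 - c * q ^+ i) * coef a b c q i.+1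
   - (1 - a * q ^+ i) * (1 - b * q ^+ i) * coef a b c q i)); first by ring.
by rewrite rec subrr mulr0.
Qed.

End Contiguity.

(** * Quotients of polynomials and the points where they have values *)

(** A polynomial in the five variables, given uniformly in the ring of
    coefficients: the same expression can then be read in the ring of
    polynomials, at a point, and along a polynomial curve. *)
Definition polyfun := forall T : comNzRingType, T -> T -> T -> T -> T -> T.

Definition natural (N : polyfun) : Prop :=
  forall (T1 T2 : comNzRingType) (f : {rmorphism T1 -> T2}) (a b c q x : T1),
  f (N T1 a b c q x) = N T2 (f a) (f b) (f c) (f q) (f x).

Section RationalFunctions.
Variable C : numClosedFieldType.
Implicit Types (P : params C) (N D : polyfun).

Definition variable (i : nat) : mpoly 5 C := mpolyX C (mnm1 (inord i : 'I_5)).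

Definition mpoly_of N : mpoly 5 C :=
  N (mpoly 5 C) (variable 0) (variable 1) (variable 2) (variable 3) (variable 4).

Definition at_point N P : C := N C (pa P) (pb P) (pc P) (pq P) (px P).

Definition quotient N D : ratfun C := tofrac (mpoly_of N) / tofrac (mpoly_of D).

Lemma mmap_mpoly_of (S : comNzRingType) (f : {rmorphism C -> S}) (h : 'I_5 -> S) N :
  natural N ->
  mmap f h (mpoly_of N) =
  N S (h (inord 0)) (h (inord 1)) (h (inord 2)) (h (inord 3)) (h (inord 4)).
Proof.
move=> natN; rewrite (natN _ _ (mmap f h)); congr (N S).
all: by etransitivity; [exact: (mmapX h f)|exact: mmap1U].
Qed.

Lemma coordsE P (i : nat) : (i < 5)%N ->
  coords P (inord i) = nth 0 [:: pa P; pb P; pc P; pq P; px P] i.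
Proof. by move=> i5; rewrite /coords (tnth_nth 0) inordK. Qed.

Lemma meval_mpoly_of N P : natural N -> meval (coords P) (mpoly_of N) = at_point N P.
Proof.
move=> natN; rewrite /meval (mmap_mpoly_of idfun)//.
by rewrite !coordsE.
Qed.

Lemma quotient_eval N D P : natural N -> natural D -> at_point D P != 0 ->
  ratfun_eval (quotient N D) P (at_point N P / at_point D P).
Proof.
move=> natN natD D0; exists (mpoly_of N), (mpoly_of D).
by rewrite !meval_mpoly_of.
Qed.

Lemma quotient_rep N D (num den : mpoly 5 C) P :
  mpoly_of D != 0 -> quotient N D = tofrac num / tofrac den ->
  meval (coords P) den != 0 -> num * mpoly_of D = mpoly_of N * den.
Proof.
move=> D0 e den0.
have den0' : den != 0 by apply: contraNneq den0 => ->; rewrite meval0.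
move/eqP: e; rewrite /quotient eq_sym eqr_div ?tofrac_eq0// -!tofracM tofrac_eq.
by move/eqP.
Qed.

(** D may vanish at P: multiplied out, the value does not depend on the representation
    of the fraction. *)
Lemma quotient_eval_inv N D P y : natural N -> natural D -> mpoly_of D != 0 ->
  ratfun_eval (quotient N D) P y -> y * at_point D P = at_point N P.
Proof.
move=> natN natD D0 [num [den [e den0 ->]]].
have := quotient_rep D0 e den0 => /(congr1 (meval (coords P))).
rewrite !mevalM !meval_mpoly_of// => e'.
by rewrite mulrAC e' mulfK.
Qed.

Lemma mpoly_of_neq0 D P : natural D -> at_point D P != 0 -> mpoly_of D != 0.
Proof. by move=> natD; rewrite -meval_mpoly_of//; apply: contraNneq => ->; rewrite meval0. Qed.

Definition line (u v : C) : {poly C} := u%:P + (v - u)%:P * 'X.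

Lemma line0 u v : (line u v).[0] = u.
Proof. by rewrite /line !hornerE/=; ring. Qed.

Lemma line1 u v : (line u v).[1] = v.
Proof. by rewrite /line !hornerE/=; ring. Qed.

(** If N / D = num / den, then num D = N den. Along a curve inside D = 0 on which N is
    not identically 0, den therefore vanishes identically, hence also at P, the
    starting point of the curve. The variable q is kept fixed along the curve. *)
Lemma undefined_on_curve N D P y (A B Y X : {poly C}) (t : C) :
  natural N -> natural D -> mpoly_of D != 0 ->
  A.[0] = pa P -> B.[0] = pb P -> Y.[0] = pc P -> X.[0] = px P ->
  D {poly C} A B Y (pq P)%:P X = 0 ->
  N C A.[t] B.[t] Y.[t] (pq P) X.[t] != 0 ->
  ~ ratfun_eval (quotient N D) P y.
Proof.
move=> natN natD D0 a0 b0 c0 x0 Dcurve Nt [num [den [e den0 _]]].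
pose h (i : 'I_5) := nth 0 [:: A; B; Y; (pq P)%:P; X] i.
have hE (i : nat) : (i < 5)%N -> h (inord i) = nth 0 [:: A; B; Y; (pq P)%:P; X] i.
  by move=> i5; rewrite /h inordK.
have := quotient_rep D0 e den0 => /(congr1 (mmap (polyC : {rmorphism C -> {poly C}}) h)).
rewrite !rmorphM /= !mmap_mpoly_of// !hE//= Dcurve mulr0 => /esym/eqP.
rewrite mulf_eq0 => /orP[/eqP N0|/eqP hden].
  rewrite -[pq P](hornerC _ t) in Nt; apply: (elimN eqP Nt).
  transitivity (horner_eval t (N {poly C} A B Y (pq P)%:P X)).
    by apply/esym/(natN _ _ (horner_eval t)).
  by rewrite [X in horner_eval t X]N0 /horner_eval horner0.
move: den0; have -> : meval (coords P) den = (mmap polyC h den).[0].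
  rewrite /meval /mmap horner_sum; apply: eq_bigr => m _.
  rewrite hornerM hornerC; congr (_ * _); rewrite /mmap1 horner_prod.
  apply: eq_bigr => i _; rewrite horner_exp; congr (_ ^+ _).
  rewrite /coords (tnth_nth 0) /h.
  by case: i => [[|[|[|[|[|i]]]]] i5] //=; rewrite hornerC.
by rewrite hden horner0 eqxx.
Qed.

End RationalFunctions.

(** * Relations between the values of the series *)

Section Values.
Variables (C : numClosedFieldType) (q : C).
Hypothesis q01 : 0 < `|q| < 1.
Implicit Types (a b c x v w : C).

Let q1 : `|q| < 1. Proof. by case/andP: q01. Qed.

Lemma qbase_neq0 : q != 0.
Proof. by rewrite -normr_gt0; case/andP: q01. Qed.

Lemma qinv_inj y i j : y * q ^+ i = 1 -> y * q ^+ j = 1 -> i = j.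
Proof.
move=> ei ej; apply: (qexp_inj q01); rewrite -[LHS]mulr1 -[RHS]mulr1.
by rewrite -{1}ej -ei; ring.
Qed.

(** With 1 / 0 = 0 the terms past the truncation are 0, so a series in the extended
    sense is an ordinary one. *)
Lemma is_phi21_converges a b c x v :
  is_phi21 (Params a b c q x) v -> converges x (coef a b c q) v.
Proof.
case=> [[_] //|[r [s [/= rs ab _ ->]]]].
apply: converges_finite => i ri.
have vanish y : y = q ^- r -> qpoch y q i = 0.
  by move=> ->; apply: (@qpoch_vanishes _ _ _ r) => //; rewrite mulVf// expf_neq0// qbase_neq0.
by rewrite /coef; case: ab => /vanish ->; rewrite ?(mul0r, mulr0).
Qed.

Lemma is_phi21_generic a b c x v : (forall j, c * q ^+ j != 1) ->
  converges x (coef a b c q) v -> is_phi21 (Params a b c q x) v.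
Proof.
by move=> ne cv; left; split=> //= j; rewrite eq_expNr ?qbase_neq0.
Qed.

Lemma is_phi21_neq1 a b c x v : is_phi21 (Params a b c q x) v -> c != 1.
Proof.
case=> [[/= /(_ 0%N)]|[r [s [/= rs _ -> _]]]]; first by rewrite expr0 invr1.
apply/eqP => /(congr1 (fun y => y^-1)); rewrite invrK invr1 => /eqP.
by rewrite (negPf (qexp_neq1 q1 _))// (leq_ltn_trans _ rs).
Qed.

(** For a truncated series (a, b; c) alone, a or b may be 1, and then W need not be
    truncated; that W has a value excludes this. *)
Lemma is_phi21_truncating a b c x x' v v' :
  is_phi21 (Params a b c q x) v ->
  is_phi21 (Params (a * q) (b * q) (c * q) q x') v' -> truncating q a b c.
Proof.
move=> /is_phi21_neq1 c1 /= H [|i] e; first by move: c1; rewrite -e expr0 mulr1 eqxx.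
have e' : (c * q) * q ^+ i = 1 by rewrite -mulrA -exprS.
have inv y j : y = q ^- j -> y * q ^+ j = 1 by move=> ->; rewrite mulVf// expf_neq0// qbase_neq0.
case: H => [[/= /(_ i)]|[r [s [/= rs ab /inv cs _]]]].
  by rewrite eq_expNr ?qbase_neq0// e' eqxx.
have {cs}si := qinv_inj cs e'; subst s.
exists r.+1; split=> //; first by rewrite (leq_trans rs).
by rewrite !exprS !mulrA; case: ab => /inv ->; [left|right].
Qed.

Lemma converges_V1 a b c x v w : truncating q a b c -> c != a ->
  converges x (coef a b c q) v -> converges x (coef (a * q) (b * q) (c * q) q) w ->
  converges x (coef a (b * q) (c * q) q)
    (((1 - a) * (c - a * b * x) * w - a * (1 - c) * v) / (c - a)).
Proof.
move=> t ca cv cw; have ca' : c - a != 0 by rewrite subr_eq0.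
have cl := convergesZ (c - a)^-1 (convergesD (convergesD
  (convergesZ ((1 - a) * c) cw) (convergesZ (- (a * (1 - c))) cv))
  (convergesZ (- ((1 - a) * (a * b))) (converges_delay cw))).
have -> : ((1 - a) * (c - a * b * x) * w - a * (1 - c) * v) / (c - a) =
  (c - a)^-1 * ((1 - a) * c * w + - (a * (1 - c)) * v + - ((1 - a) * (a * b)) * (x * w)).
  by ring.
apply: converges_ext cl => i /=; apply: (mulfI ca').
rewrite (contiguous_V1 q1 i t (distinct_zeros ca)).
by rewrite mulVKf//; ring.
Qed.

Lemma converges_W1 a b c x v w : truncating q a b c -> c != a -> c * q != 1 ->
  x * (1 - b * q) != 0 ->
  converges x (coef a b c q) v -> converges x (coef (a * q) (b * q) (c * q) q) w ->
  converges x (coef (a * q) (b * q * q) (c * q * q) q)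
    ((1 - c * q) * ((c - 1 + (1 - a) * b * x) * w + (1 - c) * v)
     / (x * (1 - b * q) * (c - a))).
Proof.
move=> t ca cq; rewrite mulf_eq0 negb_or => /andP[x0 bq] cv cw.
have ca' : c - a != 0 by rewrite subr_eq0.
have cl := convergesZ ((1 - c * q) / ((1 - b * q) * (c - a))) (convergesD (convergesD
  (convergesZ (c - 1) cw) (convergesZ (1 - c) cv))
  (convergesZ ((1 - a) * b) (converges_delay cw))).
have n0 : (1 - b * q) * (c - a) != 0 by rewrite mulf_neq0.
have cl' := converges_eq (g := delay (coef (a * q) (b * q * q) (c * q * q) q)) cl _ erefl.
apply: (converges_eq (converges_undelay x0 (cl' _))) => // [i|].
  apply: (mulfI n0); rewrite (contiguous_W1 q1 i t (distinct_zeros ca) cq).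
  by rewrite mulrA mulrCA mulfV// mulr1.
by field; rewrite x0 bq ca'.
Qed.

Lemma q_difference a b c x v v1 v2 : truncating q a b c ->
  converges x (coef a b c q) v -> converges (x * q) (coef a b c q) v1 ->
  converges (x * q ^+ 2) (coef a b c q) v2 ->
  (c - a * b * q * x) * v2 = q * (x - 1) * v + (q + c - (a + b) * q * x) * v1.
Proof.
move=> t cv /converges_scale cv1 /converges_scale cv2.
have cl := convergesD (convergesZ c cv2) (convergesZ (- (a * b * q)) (converges_delay cv2)).
have cr := convergesD
  (convergesD (convergesZ (- q) cv) (convergesZ q (converges_delay cv)))
  (convergesD (convergesZ (q + c) cv1) (convergesZ (- ((a + b) * q)) (converges_delay cv1))).
have e : c * v2 + - (a * b * q) * (x * v2) =
    - q * v + q * (x * v) + ((q + c) * v1 + - ((a + b) * q) * (x * v1)).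
  apply: converges_unique cl _; apply: converges_ext cr => i.
  have := contiguous_xq2 q1 i t => /eqP; rewrite -subr_eq0 => /eqP r0.
  apply/eqP; rewrite -subr_eq0 -oppr_eq0 -r0; apply/eqP; case: i {r0} => [|i] /=; ring.
transitivity (c * v2 + - (a * b * q) * (x * v2)); first by ring.
by rewrite e; ring.
Qed.

Lemma converges_xq a b c x v w : c != 1 ->
  converges x (coef a b c q) v -> converges x (coef (a * q) (b * q) (c * q) q) w ->
  converges (x * q) (coef a b c q) (v - (1 - a) * (1 - b) / (1 - c) * (x * w)).
Proof.
move=> c1 cv cw; have c1' : 1 - c != 0 by rewrite subr_eq0 eq_sym.
apply/converges_scale.
have cl := convergesD cv (convergesZ (- ((1 - a) * (1 - b) / (1 - c))) (converges_delay cw)).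
apply: (converges_eq cl) => [[|i]|] /=; last by rewrite mulNr.
  by rewrite expr0 mulr0 addr0 mulr1.
by rewrite coefV//; field; rewrite c1' subr_qexp_neq0.
Qed.

Lemma relation_xq2 a b c x v v0 w : truncating q a b c ->
  converges x (coef a b c q) v -> converges x (coef (a * q) (b * q) (c * q) q) w ->
  converges (x * q ^+ 2) (coef a b c q) v0 ->
  (c - a * b * q * x) * (1 - c) * v0 =
  (c + q * x * (1 - a - b)) * (1 - c) * v
  - (q + c - (a + b) * q * x) * (1 - a) * (1 - b) * x * w.
Proof.
move=> t cv cw cv0; have c1 := truncating_neq1 t.
have c1' : 1 - c != 0 by rewrite subr_eq0 eq_sym.
rewrite mulrAC (q_difference t cv (converges_xq c1 cv cw) cv0); field.
exact: c1'.
Qed.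

(** The factor 1 - b q^(i+1) of (b q; q)_(i+1) expresses W at x / q by W at x and by the
    series with b q^2 at x / q. *)
Lemma relation_x_over_q a b c x v v0 w : truncating q a b c ->
  converges x (coef a b c q) v -> converges x (coef (a * q) (b * q) (c * q) q) w ->
  converges (x / q) (coef (a * q) (b * q * q) (c * q) q) v0 ->
  (1 - b * q) * (q - x) * v0 =
  q * (1 - c) * v + q * (c - b * q + b * x * (1 - a)) * w.
Proof.
move=> t cv cw /converges_scale cv0; have q0 := qbase_neq0.
have qi i : q ^+ i != 0 by rewrite expf_neq0.
set W := coef (a * q) (b * q) (c * q) q in cw.
have cW : converges x (fun i => W i * q^-1 ^+ i) ((1 - b * q) * v0 + b * q * w).
  apply: converges_ext (convergesD (convergesZ (1 - b * q) cv0) (convergesZ (b * q) cw)) => i.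
  have := qpochSl (b * q) q i; rewrite qpochS => e.
  have -> : (1 - b * q) * (coef (a * q) (b * q * q) (c * q) q i * q^-1 ^+ i) =
      (1 - b * q * q ^+ i) * W i * q^-1 ^+ i.
    rewrite /W /coef; transitivity ((1 - b * q) * qpoch (b * q * q) q i
      * qpoch (a * q) q i / (qpoch q q i * qpoch (c * q) q i) * q^-1 ^+ i); first by ring.
    by rewrite -e; ring.
  by rewrite exprVn; field.
have cl := convergesD cW (convergesZ (- q^-1) (converges_delay cW)).
have cr := convergesD (convergesD (convergesZ (1 - c) cv) (convergesZ c cw))
  (convergesZ (- (a * b)) (converges_delay cw)).
have e := converges_unique cl (converges_ext _ cr).
set om := (1 - b * q) * v0 + b * q * w in e.
have {}e : om + - q^-1 * (x * om) = (1 - c) * v + c * w + - (a * b) * (x * w).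
  apply: e => i; have := contiguous_W_scaled q1 i t; rewrite -/W => r.
  apply: (mulfI (qi i)); rewrite !mulrDr [q ^+ i * ((1 - c) * _)]mulrCA mulrA -r exprVn.
  case: i {r} => [|i] /=; first by rewrite expr0; field.
  by rewrite exprVn exprS; field; rewrite qi q0.
have -> : (1 - b * q) * (q - x) * v0 = q * (om + - q^-1 * (x * om)) - b * q * (q - x) * w.
  by rewrite /om; field.
by rewrite e; ring.
Qed.

End Values.

(** * The coefficients of the three-term relations *)

Definition Q0002 : polyfun := fun T a b c q x =>
  - ((q + c - (a + b) * q * x) * (1 - a) * (1 - b) * x).
Definition DQ0002 : polyfun := fun T a b c q x => (c - a * b * q * x) * (1 - c).
Definition S0002 : polyfun := fun T a b c q x => c + q * x * (1 - a - b).
Definition DS0002 : polyfun := fun T a b c q x => c - a * b * q * x.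

(** The step from (V, W) to (V1, W1):
    D0110 V1 = Q0110 W + S0110 V and
    x (1 - b q) D0110 W1 = (1 - c q) (E0110 W + (1 - c) V).
    The polynomials for (0, 2, 2, 0) and (0, 3, 3, 0) are entries of the products of
    two and three of these matrices, taken at b, b q, b q^2 and c, c q, c q^2. *)
Definition Q0110 : polyfun := fun T a b c q x => (1 - a) * (c - a * b * x).
Definition S0110 : polyfun := fun T a b c q x => - (a * (1 - c)).
Definition D0110 : polyfun := fun T a b c q x => c - a.

Definition E0110 : polyfun := fun T a b c q x => c - 1 + (1 - a) * b * x.

Definition Q0220 : polyfun := fun T a b c q x =>
  (1 - c * q) * (Q0110 a (b * q) (c * q) q x * E0110 a b c q x
                 - a * (x * (1 - b * q)) * Q0110 a b c q x).
Definition S0220 : polyfun := fun T a b c q x =>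
  (1 - c * q) * (Q0110 a (b * q) (c * q) q x * (1 - c)
                 - a * (x * (1 - b * q)) * S0110 a b c q x).
Definition D0220 : polyfun := fun T a b c q x =>
  x * (1 - b * q) * (c - a) * (c * q - a).

Definition Q0330 : polyfun := fun T a b c q x =>
  (1 - c * q * q) * (Q0110 a (b * q * q) (c * q * q) q x * (1 - c * q)
    * (E0110 a (b * q) (c * q) q x * E0110 a b c q x + x * (1 - b * q) * Q0110 a b c q x)
  - a * (x * (1 - b * q * q)) * Q0220 a b c q x).
Definition S0330 : polyfun := fun T a b c q x =>
  (1 - c * q * q) * (Q0110 a (b * q * q) (c * q * q) q x * (1 - c * q)
    * (E0110 a (b * q) (c * q) q x * (1 - c) + x * (1 - b * q) * S0110 a b c q x)
  - a * (x * (1 - b * q * q)) * S0220 a b c q x).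
Definition D0330 : polyfun := fun T a b c q x =>
  D0220 a b c q x * (x * (1 - b * q * q) * (c * q * q - a)).

Definition Q1211 : polyfun := fun T a b c q x => q * (c - b * q + b * x * (1 - a)).
Definition S1211 : polyfun := fun T a b c q x => q * (1 - c).
Definition D1211 : polyfun := fun T a b c q x => (1 - b * q) * (q - x).

Ltac naturality := move=> T1 T2 f a b c q x;
  rewrite /= /Q0002 /DQ0002 /S0002 /DS0002 /Q0330 /S0330 /D0330 /Q0220 /S0220 /D0220
    /E0110 /Q0110 /S0110 /D0110 /Q1211 /S1211 /D1211;
  by rewrite !(rmorphN, rmorphB, rmorphM, rmorphD, rmorph1).

Lemma Q0002_natural : natural Q0002. Proof. naturality. Qed.
Lemma DQ0002_natural : natural DQ0002. Proof. naturality. Qed.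
Lemma S0002_natural : natural S0002. Proof. naturality. Qed.
Lemma DS0002_natural : natural DS0002. Proof. naturality. Qed.
Lemma Q0110_natural : natural Q0110. Proof. naturality. Qed.
Lemma S0110_natural : natural S0110. Proof. naturality. Qed.
Lemma D0110_natural : natural D0110. Proof. naturality. Qed.
Lemma Q0220_natural : natural Q0220. Proof. naturality. Qed.
Lemma S0220_natural : natural S0220. Proof. naturality. Qed.
Lemma D0220_natural : natural D0220. Proof. naturality. Qed.
Lemma Q0330_natural : natural Q0330. Proof. naturality. Qed.
Lemma S0330_natural : natural S0330. Proof. naturality. Qed.
Lemma D0330_natural : natural D0330. Proof. naturality. Qed.
Lemma Q1211_natural : natural Q1211. Proof. naturality. Qed.
Lemma S1211_natural : natural S1211. Proof. naturality. Qed.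
Lemma D1211_natural : natural D1211. Proof. naturality. Qed.

#[local] Hint Resolve Q0002_natural DQ0002_natural S0002_natural DS0002_natural
  Q0110_natural S0110_natural D0110_natural Q0220_natural S0220_natural D0220_natural
  Q0330_natural S0330_natural D0330_natural Q1211_natural S1211_natural D1211_natural : core.

Section ThreeTerm.
Variable C : numClosedFieldType.
Implicit Types (a b c q x y : C) (N D : polyfun).

Lemma shift_1110 a b c q x : Defs.shift 1 1 1 0 (Params a b c q x) = Params (a * q) (b * q) (c * q) q x.
Proof. by rewrite /Defs.shift /= !expr1z expr0z mulr1. Qed.

Lemma shift_0002 a b c q x : Defs.shift 0 0 0 2 (Params a b c q x) = Params a b c q (x * q ^+ 2).
Proof. by rewrite /Defs.shift /= !expr0z !mulr1. Qed.

Lemma shift_0110 a b c q x : Defs.shift 0 1 1 0 (Params a b c q x) = Params a (b * q) (c * q) q x.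
Proof. by rewrite /Defs.shift /= !expr1z !expr0z !mulr1. Qed.

Lemma shift_0220 a b c q x :
  Defs.shift 0 2 2 0 (Params a b c q x) = Params a (b * q * q) (c * q * q) q x.
Proof. by rewrite /Defs.shift /= !expr0z !mulr1 -!mulrA. Qed.

Lemma shift_0330 a b c q x :
  Defs.shift 0 3 3 0 (Params a b c q x) = Params a (b * q * q * q) (c * q * q * q) q x.
Proof. by rewrite /Defs.shift /= !expr0z !mulr1 -!mulrA. Qed.

Lemma shift_1211 a b c q x :
  Defs.shift 1 2 1 (-1) (Params a b c q x) = Params (a * q) (b * q * q) (c * q) q (x / q).
Proof. by rewrite /Defs.shift /= !expr1z -!mulrA. Qed.

Lemma one_plus_qexp_neq0 q i : `|q| < 1 -> 1 + q ^+ i != 0.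
Proof.
move=> q1; case: i => [|i]; first by rewrite expr0 -[1 + 1]/(2%:R) pnatr_eq0.
rewrite addrC addr_eq0; apply/eqP => e; have := norm_exp_lt1 q1 (ltn0Sn i).
by rewrite e normrN1 ltxx.
Qed.

Section Defined.
Variables (N D : polyfun) (a b c q x y : C).
Hypotheses (natN : natural N) (natD : natural D) (D0 : mpoly_of C D != 0).
Hypothesis ey : ratfun_eval (quotient C N D) (Params a b c q x) y.

(** If S = N / D has a value, then no factor of D vanishes. The curve of
    undefined_on_curve moves a to 0, c to -1 and x to 0, where the numerators of
    interest factor completely, and keeps the vanishing factor 0; for the factors
    c q^j - a it has to move a to - q^j instead. *)
Lemma defined_x : (forall (T : comNzRingType) (a b c q : T), @D T a b c q 0 = 0) ->
  @N C 0 b (-1) q 0 != 0 -> x != 0.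
Proof.
move=> Dx Nn; apply/eqP => x0; move: ey.
apply: (@undefined_on_curve _ N D _ _ (line a 0) b%:P (line c (-1)) 0 1) => //=;
  rewrite ?line0 ?line1 ?hornerC ?horner0 ?x0 //.
exact: Dx.
Qed.

Lemma defined_b j : (forall (T : comNzRingType) (a b c q x : T), b * q ^+ j = 1 -> @D T a b c q x = 0) ->
  @N C 0 b (-1) q 0 != 0 -> b * q ^+ j != 1.
Proof.
move=> Db Nn; apply/eqP => b1; move: ey.
apply: (@undefined_on_curve _ N D _ _ (line a 0) b%:P (line c (-1)) (line x 0) 1) => //=;
  rewrite ?line0 ?line1 ?hornerC //.
by apply: Db; rewrite -polyC_exp -polyCM b1.
Qed.

Lemma defined_c j : (forall (T : comNzRingType) (a b c q x : T), c * q ^+ j = a -> @D T a b c q x = 0) ->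
  @N C (- q ^+ j) b (-1) q 0 != 0 -> c * q ^+ j != a.
Proof.
move=> Dc Nn; apply/eqP => ca; move: ey.
apply: (@undefined_on_curve _ N D _ _ (line c (-1) * (q ^+ j)%:P) b%:P (line c (-1)) (line x 0) 1) => //=;
  rewrite ?hornerM ?line0 ?line1 ?hornerC ?mulN1r //.
by apply: Dc; rewrite -polyC_exp.
Qed.

End Defined.

Lemma DS0002_neq0 : mpoly_of C DS0002 != 0.
Proof.
apply: (@mpoly_of_neq0 _ _ (Params 0 0 1 0 0)) => //.
by rewrite /at_point /DS0002 /= !mul0r subr0 oner_neq0.
Qed.

Lemma DQ0002_neq0 : mpoly_of C DQ0002 != 0.
Proof.
apply: (@mpoly_of_neq0 _ _ (Params 0 0 (-1) 0 0)) => //.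
by rewrite /at_point /DQ0002 /= !mul0r subr0 opprK mulf_neq0 ?oppr_eq0 ?oner_neq0// -[1 + 1]/(2%:R) pnatr_eq0.
Qed.

Lemma D0110_neq0 : mpoly_of C D0110 != 0.
Proof.
apply: (@mpoly_of_neq0 _ _ (Params 0 0 1 0 0)) => //.
by rewrite /at_point /D0110 /= subr0 oner_neq0.
Qed.

Lemma D0220_neq0 : mpoly_of C D0220 != 0.
Proof.
apply: (@mpoly_of_neq0 _ _ (Params 0 0 1 1 1)) => //.
by rewrite /at_point /D0220 /= !mul0r !subr0 !mulr1 oner_neq0.
Qed.

Lemma D0330_neq0 : mpoly_of C D0330 != 0.
Proof.
apply: (@mpoly_of_neq0 _ _ (Params 0 0 1 1 1)) => //.
by rewrite /at_point /D0330 /D0220 /= !mul0r !subr0 !mulr1 oner_neq0.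
Qed.

Lemma D1211_neq0 : mpoly_of C D1211 != 0.
Proof.
apply: (@mpoly_of_neq0 _ _ (Params 0 0 0 1 0)) => //.
by rewrite /at_point /D1211 /= !mul0r !subr0 !mulr1 oner_neq0.
Qed.

Lemma three_term_0002 : three_term 0 0 0 2 (quotient C Q0002 DQ0002) (quotient C S0002 DS0002).
Proof.
move=> [a b c q x] v0 v1 v y z /= q01; rewrite shift_0002 shift_1110 => h0 h1 h ey ez.
have t := is_phi21_truncating q01 h h1; have c1 := is_phi21_neq1 q01 h.
have cv := is_phi21_converges q01 h; have cw := is_phi21_converges q01 h1.
have cv0 := is_phi21_converges q01 h0.
have rel := relation_xq2 q01 t cv cw cv0.
have /eqP D0 : c - a * b * q * x != 0.
  apply/eqP => e; move: ez; pose A := line a 0; pose B := line b 0; pose X := line x 1.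
  (* The curve c = a b q x with a, b -> 0 and x -> 1 ends where the numerator is q. *)
  apply: (@undefined_on_curve _ _ _ _ _ A B (A * B * q%:P * X) X 1) => //=.
  - exact: DS0002_neq0.
  - exact: line0.
  - exact: line0.
  - by rewrite !hornerM !line0 hornerC; apply/esym/eqP; rewrite -subr_eq0 e.
  - exact: line0.
  - by rewrite /DS0002 subrr.
  - rewrite /S0002 /A /B /X !hornerM !line1 hornerC !mul0r !subr0 add0r !mulr1.
    exact: qbase_neq0 q01.
have c1' : 1 - c != 0 by rewrite subr_eq0 eq_sym.
have := quotient_eval_inv Q0002_natural DQ0002_natural DQ0002_neq0 ey.
have := quotient_eval_inv S0002_natural DS0002_natural DS0002_neq0 ez.
rewrite /at_point /Q0002 /DQ0002 /S0002 /DS0002 /= => eS eQ.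
have n0 : (c - a * b * q * x) * (1 - c) != 0 by rewrite mulf_neq0//; apply/eqP.
apply: (mulfI n0); rewrite rel [RHS]mulrDr.
have -> : (c - a * b * q * x) * (1 - c) * (z * v) = (1 - c) * v * (z * (c - a * b * q * x)).
  by ring.
have -> : (c - a * b * q * x) * (1 - c) * (y * v1) = v1 * (y * ((c - a * b * q * x) * (1 - c))).
  by ring.
by rewrite eS eQ; ring.
Qed.

Lemma three_term_0110 : three_term 0 1 1 0 (quotient C Q0110 D0110) (quotient C S0110 D0110).
Proof.
move=> [a b c q x] v0 v1 v y z /= q01; rewrite shift_0110 shift_1110 => h0 h1 h ey ez.
have t := is_phi21_truncating q01 h h1.
have cv := is_phi21_converges q01 h; have cw := is_phi21_converges q01 h1.
have ca : c != a.
  have := @defined_c _ _ _ _ _ _ _ _ S0110_natural D0110_natural D0110_neq0 ez 0.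
  rewrite expr0 mulr1; apply.
    by move=> T a' b' c' q' x'; rewrite expr0 mulr1 /D0110 => ->; rewrite subrr.
  rewrite /S0110 opprK mulN1r opprK -[1 + 1]/(2%:R) pnatr_eq0//.
have ca' : c - a != 0 by rewrite subr_eq0.
have := quotient_eval_inv Q0110_natural D0110_natural D0110_neq0 ey.
have := quotient_eval_inv S0110_natural D0110_natural D0110_neq0 ez.
rewrite /at_point /Q0110 /S0110 /D0110 /= => eS eQ.
rewrite (converges_unique (is_phi21_converges q01 h0) (converges_V1 q01 t ca cv cw)).
apply: (mulfI ca'); rewrite mulrCA mulfV// mulr1 [RHS]mulrDr !mulrA [(c - a) * y]mulrC [(c - a) * z]mulrC.
by rewrite eS eQ; ring.
Qed.

Lemma three_term_1211 : three_term 1 2 1 (-1) (quotient C Q1211 D1211) (quotient C S1211 D1211).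
Proof.
move=> [a b c q x] v0 v1 v y z /= q01; rewrite shift_1211 shift_1110 => h0 h1 h ey ez.
have t := is_phi21_truncating q01 h h1; have c1 := is_phi21_neq1 q01 h.
have rel := relation_x_over_q q01 t (is_phi21_converges q01 h)
  (is_phi21_converges q01 h1) (is_phi21_converges q01 h0).
have c1' : 1 - c != 0 by rewrite subr_eq0 eq_sym.
have D0 : (1 - b * q) * (q - x) != 0.
  apply/eqP => e; move: ez.
  (* The numerator q (1 - c) is not 0 at P itself: a constant curve suffices. *)
  apply: (@undefined_on_curve _ _ _ _ _ a%:P b%:P c%:P x%:P 0) => //=; rewrite ?hornerC//.
  - exact: D1211_neq0.
  - transitivity (D1211 a b c q x)%:P; last by rewrite /D1211 e polyC0.
    exact/esym/(D1211_natural polyC).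
  - by rewrite /S1211 mulf_neq0// (qbase_neq0 q01).
have := quotient_eval_inv Q1211_natural D1211_natural D1211_neq0 ey.
have := quotient_eval_inv S1211_natural D1211_natural D1211_neq0 ez.
rewrite /at_point /Q1211 /S1211 /D1211 /= => eS eQ.
by apply: (mulfI D0); rewrite rel -eS -eQ; ring.
Qed.

(** At x = 0 and c = -1 the factors 1 - c q^j become 1 + q^j, which do not vanish. *)
Lemma S0220_at q a b : S0220 a b (-1) q 0 = - ((1 - a) * q * (1 + q ^+ 1) * (1 + q ^+ 0)).
Proof. by rewrite /S0220 /Q0110 /S0110 expr1 expr0; ring. Qed.

Lemma S0330_at q a b : S0330 a b (-1) q 0 =
  (1 - a) * q ^+ 2 * (1 + q ^+ 1) ^+ 2 * (1 + q ^+ 0) * (1 + q ^+ 2).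
Proof. by rewrite /S0330 /S0220 /Q0110 /E0110 /S0110 expr1 expr0; ring. Qed.

Lemma three_term_0220 : three_term 0 2 2 0 (quotient C Q0220 D0220) (quotient C S0220 D0220).
Proof.
move=> [a b c q x] v0 v1 v y z /= q01; rewrite shift_0220 shift_1110 => h0 h1 h ey ez.
have t := is_phi21_truncating q01 h h1; have q1 : `|q| < 1 by case/andP: q01.
have cv := is_phi21_converges q01 h; have cw := is_phi21_converges q01 h1.
have Sn a' b' : 1 - a' != 0 -> S0220 a' b' (-1) q 0 != 0.
  by move=> a1; rewrite S0220_at oppr_eq0 !mulf_neq0 ?one_plus_qexp_neq0// (qbase_neq0 q01).
have Sn0 b' : S0220 0 b' (-1) q 0 != 0 by apply: Sn; rewrite subr0 oner_neq0.
have Snq j b' : S0220 (- q ^+ j) b' (-1) q 0 != 0 by apply: Sn; rewrite opprK one_plus_qexp_neq0.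
have x0 : x != 0.
  apply: (defined_x S0220_natural D0220_natural D0220_neq0 ez) => // T a' b' c' q'.
  by rewrite /D0220 !mul0r.
have bq : b * q != 1.
  rewrite -[q in b * q]expr1; apply: (defined_b S0220_natural D0220_natural D0220_neq0 ez) => //.
  by move=> T a' b' c' q' x'; rewrite expr1 /D0220 => ->; rewrite subrr mulr0 !mul0r.
have ca : c != a.
  rewrite -[c]mulr1 -[1](expr0 q).
  apply: (defined_c S0220_natural D0220_natural D0220_neq0 ez) => //.
  by move=> T a' b' c' q' x'; rewrite expr0 mulr1 /D0220 => ->; rewrite subrr mulr0 !mul0r.
have cqa : c * q != a.
  rewrite -[q in c * q]expr1.
  apply: (defined_c S0220_natural D0220_natural D0220_neq0 ez) => //.
  by move=> T a' b' c' q' x'; rewrite expr1 /D0220 => ->; rewrite subrr mulr0.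
have [t1 cq1] := truncating_step t (distinct_zeros ca) bq.
have n1 : 1 - b * q != 0 by rewrite subr_eq0 eq_sym.
have n2 : c - a != 0 by rewrite subr_eq0.
have n3 : c * q - a != 0 by rewrite subr_eq0.
have cv1 := converges_V1 q01 t ca cv cw.
have cw1 := converges_W1 q01 t ca cq1 (mulf_neq0 x0 n1) cv cw.
have cv2 := converges_V1 q01 t1 cqa cv1 cw1.
rewrite (converges_unique (is_phi21_converges q01 h0) cv2).
have D0 : at_point D0220 (Params a b c q x) != 0 by rewrite /at_point /D0220 /= !mulf_neq0.
have := quotient_eval_inv Q0220_natural D0220_natural D0220_neq0 ey.
have := quotient_eval_inv S0220_natural D0220_natural D0220_neq0 ez.
move=> /(canRL (mulfK D0)) -> /(canRL (mulfK D0)) ->.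
rewrite /at_point /Q0220 /S0220 /D0220 /Q0110 /S0110 /E0110 /=.
by field; rewrite x0 n1 n2 n3.
Qed.

Lemma three_term_0330 : three_term 0 3 3 0 (quotient C Q0330 D0330) (quotient C S0330 D0330).
Proof.
move=> [a b c q x] v0 v1 v y z /= q01; rewrite shift_0330 shift_1110 => h0 h1 h ey ez.
have t := is_phi21_truncating q01 h h1; have q1 : `|q| < 1 by case/andP: q01.
have cv := is_phi21_converges q01 h; have cw := is_phi21_converges q01 h1.
have Sn a' b' : 1 - a' != 0 -> S0330 a' b' (-1) q 0 != 0.
  have q0 := qbase_neq0 q01; move=> a1.
  by rewrite S0330_at !mulf_neq0 ?(expf_neq0, one_plus_qexp_neq0).
have Sn0 b' : S0330 0 b' (-1) q 0 != 0 by apply: Sn; rewrite subr0 oner_neq0.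
have Snq j b' : S0330 (- q ^+ j) b' (-1) q 0 != 0 by apply: Sn; rewrite opprK one_plus_qexp_neq0.
have x0 : x != 0.
  apply: (defined_x S0330_natural D0330_natural D0330_neq0 ez) => // T a' b' c' q'.
  by rewrite /D0330 /D0220 !mul0r.
have bq : b * q != 1.
  rewrite -[q in b * q]expr1; apply: (defined_b S0330_natural D0330_natural D0330_neq0 ez) => //.
  by move=> T a' b' c' q' x'; rewrite expr1 /D0330 /D0220 => ->; rewrite subrr mulr0 !mul0r.
have bqq : b * q * q != 1.
  rewrite -mulrA -[q * q]/(q ^+ 2); apply: (defined_b S0330_natural D0330_natural D0330_neq0 ez) => //.
  by move=> T a' b' c' q' x'; rewrite /D0330 -[b' * q' * q']mulrA => ->; rewrite subrr mulr0 mul0r mulr0.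
have ca : c != a.
  rewrite -[c]mulr1 -[1](expr0 q).
  apply: (defined_c S0330_natural D0330_natural D0330_neq0 ez) => //.
  by move=> T a' b' c' q' x'; rewrite expr0 mulr1 /D0330 /D0220 => ->; rewrite subrr mulr0 !mul0r.
have cqa : c * q != a.
  rewrite -[q in c * q]expr1.
  apply: (defined_c S0330_natural D0330_natural D0330_neq0 ez) => //.
  by move=> T a' b' c' q' x'; rewrite expr1 /D0330 /D0220 => ->; rewrite subrr mulr0 !mul0r.
have cqqa : c * q * q != a.
  rewrite -mulrA -[q * q]/(q ^+ 2); apply: (defined_c S0330_natural D0330_natural D0330_neq0 ez) => //.
  by move=> T a' b' c' q' x'; rewrite /D0330 -[c' * q' * q']mulrA => ->; rewrite subrr !mulr0.
have [t1 cq1] := truncating_step t (distinct_zeros ca) bq.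
have [t2 cqq1] := truncating_step t1 (distinct_zeros cqa) bqq.
have n1 : 1 - b * q != 0 by rewrite subr_eq0 eq_sym.
have n1' : 1 - b * q * q != 0 by rewrite subr_eq0 eq_sym.
have n2 : c - a != 0 by rewrite subr_eq0.
have n3 : c * q - a != 0 by rewrite subr_eq0.
have n4 : c * q * q - a != 0 by rewrite subr_eq0.
have cv1 := converges_V1 q01 t ca cv cw.
have cw1 := converges_W1 q01 t ca cq1 (mulf_neq0 x0 n1) cv cw.
have cv2 := converges_V1 q01 t1 cqa cv1 cw1.
have cw2 := converges_W1 q01 t1 cqa cqq1 (mulf_neq0 x0 n1') cv1 cw1.
have cv3 := converges_V1 q01 t2 cqqa cv2 cw2.
rewrite (converges_unique (is_phi21_converges q01 h0) cv3).
have D0 : at_point D0330 (Params a b c q x) != 0 by rewrite /at_point /D0330 /D0220 /= !mulf_neq0.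
have := quotient_eval_inv Q0330_natural D0330_natural D0330_neq0 ey.
have := quotient_eval_inv S0330_natural D0330_natural D0330_neq0 ez.
move=> /(canRL (mulfK D0)) -> /(canRL (mulfK D0)) ->.
rewrite /at_point /Q0330 /S0330 /D0330 /Q0220 /S0220 /D0220 /Q0110 /S0110 /E0110 /=.
by field; rewrite x0 n1 n1' n2 n3 n4.
Qed.

End ThreeTerm.

(** * Dense sets of parameters *)

Section Density.
Variable C : numClosedFieldType.

Lemma fraction_rep (T : idomainType) (f : {fraction T}) :
  exists n d : T, d != 0 /\ f = FracField.tofrac n / FracField.tofrac d.
Proof.
elim/quotW: f => r; exists (frac r).1, (frac r).2.
have d0 : (frac r).2 != 0 by [].
split=> //; apply: (mulIf (_ : FracField.tofrac (frac r).2 != 0)); first by rewrite tofrac_eq0.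
rewrite mulfVK ?tofrac_eq0// /GRing.mul /=.
rewrite !piE; apply/eqmodP; rewrite /= FracField.equivfE /FracField.mulf.
have o := oner_neq0 T.
by rewrite !(numer_Ratio _ o, denom_Ratio _ o) !mulr1 numer_Ratio// denom_Ratio// mulrC.
Qed.

Lemma poly_eq0_infinite (p : {poly C}) (u : nat -> C) :
  injective u -> (forall j, p.[u j] = 0) -> p = 0.
Proof.
move=> uI pu; apply/eqP; apply: contraT => p0.
have := @max_poly_roots _ p (map u (iota 0 (size p))) p0.
rewrite size_map size_iota ltnn map_inj_uniq// iota_uniq => H.
by apply: H => //; apply/allP => _ /mapP[j _ ->]; apply/rootP.
Qed.

(** As a polynomial in u the sum has infinitely many zeros. Applied once for each
    variable, this isolates a single coefficient of a polynomial. *)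
Lemma extract_exponent (I : Type) (s : seq I) (P : pred I) (g : I -> C)
    (e : I -> nat) (u : nat -> C) (k : nat) :
  injective u -> (forall j, \sum_(m <- s | P m) g m * u j ^+ e m = 0) ->
  \sum_(m <- s | P m && (e m == k)) g m = 0.
Proof.
move=> uI H; have : \sum_(m <- s | P m) g m *: 'X^(e m) = 0 :> {poly C}.
  apply: (poly_eq0_infinite uI) => j; rewrite -[RHS](H j) horner_sum.
  by apply: eq_bigr => m _; rewrite hornerZ hornerXn.
by move=> /(congr1 (fun p : {poly C} => p`_k)); rewrite coef_sumMXn coef0.
Qed.

Definition exponent (i : nat) (m : multinom 5) : nat := m (inord i : 'I_5).

(** The powers stand in the order in which extract_exponent removes them, the last
    one first: a = q^-r depends on q, so q comes last. *)
Lemma meval_expand (p : mpoly 5 C) a b c q x : meval (coords (Params a b c q x)) p =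
  \sum_(m <- msupp p) mcoeff m p * q ^+ exponent 3 m * a ^+ exponent 0 m
     * b ^+ exponent 1 m * c ^+ exponent 2 m * x ^+ exponent 4 m.
Proof.
rewrite mevalE; apply: eq_bigr => m _; rewrite -!mulrA; congr (_ * _).
rewrite !big_ord_recl big_ord0 mulr1 /coords !(tnth_nth 0) /exponent /=.
have I i (i5 : (i < 5)%N) : inord i = Ordinal i5 :> 'I_5 by apply/val_inj; rewrite /= inordK.
rewrite (I 0%N isT) (I 1%N isT) (I 2 isT) (I 3 isT) (I 4 isT) [in RHS]mulrCA.
rewrite [X in _ = _ * X]mulrCA [X in _ = _ * (_ * X)]mulrCA.
by congr (_ ^+ _ * (_ ^+ _ * (_ ^+ _ * (_ ^+ _ * _ ^+ _)))); congr (m _); exact: val_inj.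
Qed.

Lemma meval_poly_x (p : mpoly 5 C) a b c q : exists2 f : {poly C},
  (size f <= msize p)%N & forall x, meval (coords (Params a b c q x)) p = f.[x].
Proof.
pose g m := mcoeff m p * q ^+ exponent 3 m * a ^+ exponent 0 m
     * b ^+ exponent 1 m * c ^+ exponent 2 m.
exists (\sum_(m <- msupp p) g m *: 'X^(exponent 4 m)); last first.
  move=> x; rewrite meval_expand horner_sum; apply: eq_bigr => m _.
  by rewrite hornerZ hornerXn.
apply/leq_sizeP => k pk; rewrite coef_sumMXn big_seq_cond big_pred0 // => m.
apply/negbTE/negP => /andP[/msize_mdeg_lt mp /andP[_ /eqP mk]].
have : (exponent 4 m <= mdeg m)%N by rewrite mdegE (bigD1 (inord 4 : 'I_5)) //= leq_addr.
by rewrite mk leqNgt (leq_trans mp pk).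
Qed.

(** A grid with q positive, b negative and c imaginary, so that neither b nor c nor
    c / b is a power of q. *)
Definition qgrid (n : nat) : C := n.+2%:R^-1.
Definition bgrid (n : nat) : C := - n.+1%:R.
Definition cgrid (n : nat) : C := 'i * n.+1%:R.

Lemma qgrid_bounds n : 0 < `|qgrid n| < 1.
Proof.
rewrite /qgrid normfV normr_nat invr_gt0 ltr0n /= invf_lt1 ?ltr0n//.
by rewrite ltr1n.
Qed.

Lemma mpoly_dense (p : mpoly 5 C) (r0 : nat) :
  (forall n r k k' x, (r0 <= r)%N ->
   meval (coords (Params (qgrid n ^- r) (bgrid k) (cgrid k') (qgrid n) x)) p = 0) -> p = 0.
Proof.
move=> H; have ii : ('i : C) != 0.
  by apply/eqP => i0; have := sqrCi C; rewrite i0 expr0n => /eqP; rewrite eq_sym oppr_eq0 oner_eq0.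
have qI : injective qgrid by move=> i j /invr_inj /eqP; rewrite eqr_nat => /eqP[].
have bI : injective bgrid by move=> i j /oppr_inj /eqP; rewrite eqr_nat => /eqP[].
have cI : injective cgrid by move=> i j /(mulfI ii) /eqP; rewrite eqr_nat => /eqP[].
have aI n : injective (fun r => qgrid n ^- (r0 + r)).
  by move=> i j /invr_inj /(qexp_inj (qgrid_bounds n)) /addnI.
have xI : injective (fun j : nat => j%:R : C) by move=> i j /eqP; rewrite eqr_nat => /eqP.
apply/eqP; apply: contraT => p0.
have [m0 m0p] : exists m0, m0 \in msupp p.
  by move: p0; rewrite -msupp_eq0; case: (msupp p) => [//|m0 s] _; exists m0; rewrite mem_head.
have H4 n r k k' : \sum_(m <- msupp p | true && (exponent 4 m == exponent 4 m0))
    mcoeff m p * qgrid n ^+ exponent 3 m * (qgrid n ^- (r0 + r)) ^+ exponent 0 m * bgrid k ^+ exponent 1 m * cgrid k' ^+ exponent 2 m = 0.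
  by apply: (extract_exponent _ xI) => j; rewrite -meval_expand H// leq_addr.
have H2 n r k := extract_exponent (exponent 2 m0) cI (H4 n r k).
have H1 n r := extract_exponent (exponent 1%N m0) bI (H2 n r).
have H0 n := extract_exponent (exponent 0%N m0) (aI n) (H1 n).
have := extract_exponent (exponent 3 m0) qI H0.
rewrite big_mkcond (bigD1_seq m0 m0p (msupp_uniq p)) /= !eqxx /= big1 ?addr0.
  by move=> e; move: m0p; rewrite mcoeff_msupp e eqxx.
move=> m ne; case: ifP => // /andP[/andP[/andP[/andP[e4 e2] e1] e0] e3].
case/eqP: ne; apply/mnmP => i; have iE : i = inord i by apply/val_inj; rewrite /= inordK.
rewrite iE; case: i {iE} => [[|[|[|[|[|i]]]]] i5] //=; exact/eqP.
Qed.

End Density.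

(** * Linear independence of the two series and uniqueness *)

Section Independence.
Variables (C : numClosedFieldType) (q : C).
Hypothesis q01 : 0 < `|q| < 1.
Implicit Types (a b c x : C).

Let q1 : `|q| < 1. Proof. by case/andP: q01. Qed.
Let q0 : q != 0. Proof. exact: qbase_neq0 q01. Qed.

Lemma coef_terminates a b c r i : a * q ^+ r = 1 -> (r < i)%N -> coef a b c q i = 0.
Proof. by move=> e ri; rewrite /coef (qpoch_vanishes e ri) !mul0r. Qed.

Lemma is_phi21_terminating a b c x r : a * q ^+ r = 1 ->
  (forall j, c * q ^+ j != 1) -> is_phi21 (Params a b c q x) (psum x (coef a b c q) r.+1).
Proof.
move=> e ne; apply: is_phi21_generic => //.
by apply: converges_finite => i; apply: coef_terminates.
Qed.

Variables (r : nat) (b c : C).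
Hypothesis b_gen : forall j : int, b != q ^ j.
Hypothesis c_gen : forall j : int, c != q ^ j.
Hypothesis bc_gen : forall j : int, c != b * q ^ j.

Lemma gen_neq1 y : (forall j : int, y != q ^ j) -> forall j : nat, y * q ^+ j != 1.
Proof.
move=> ne j; rewrite -eq_expNr//.
by have := ne (- j%:Z); rewrite -exprnN.
Qed.

Let a := q ^- r.
Let V := coef a b c q.
Let W := coef (a * q) (b * q) (c * q) q.

Definition vpoly := \poly_(i < r.+1) coef (q ^- r) b c q i.
Definition wpoly := \poly_(i < r) coef (q ^- r * q) (b * q) (c * q) q i.

Let aq : a * q ^+ r = 1. Proof. by rewrite /a mulVf// expf_neq0. Qed.

Lemma vpolyE x : vpoly.[x] = psum x V r.+1.
Proof. exact: horner_poly. Qed.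

Lemma wpolyE x : wpoly.[x] = psum x W r.
Proof. exact: horner_poly. Qed.

Lemma converges_vpoly x : converges x V vpoly.[x].
Proof. by rewrite vpolyE; apply: converges_finite => i; apply: coef_terminates aq. Qed.

Hypothesis r_gt0 : (0 < r)%N.

Lemma converges_wpoly x : converges x W wpoly.[x].
Proof.
rewrite wpolyE; apply: converges_finite => i ri.
apply: (@coef_terminates _ _ _ r.-1); last by rewrite prednK.
by rewrite -mulrA -exprS prednK.
Qed.

Lemma truncating_gen : truncating q a b c.
Proof. by move=> i e; have := gen_neq1 c_gen i; rewrite e eqxx. Qed.

Lemma vpoly0 : vpoly.[0] = 1.
Proof.
rewrite vpolyE /psum big_ord_recl big1 => [|i _]; last by rewrite expr0n /= mulr0.
by rewrite expr0 mulr1 addr0 /V /coef !qpoch0 !mulr1 divr1.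
Qed.

Lemma vpoly_neq0 : vpoly != 0.
Proof. by apply/eqP => e; have := vpoly0; rewrite e horner0 => /esym/eqP; rewrite oner_eq0. Qed.

Lemma vpoly_relation x : (c - a * b * q * x) * vpoly.[x * q ^+ 2] =
  q * (x - 1) * vpoly.[x] + (q + c - (a + b) * q * x) * vpoly.[x * q].
Proof.
exact: (q_difference q01 truncating_gen (@converges_vpoly x)
  (@converges_vpoly (x * q)) (@converges_vpoly (x * q ^+ 2))).
Qed.

(** A common root x of V and W is not 0, and x q is a root of V, too. The second-order
    q-difference equation propagates the pair of roots x, x q to all x q^j or to all
    x / q^j: its extreme coefficients vanish at x = c / (a b q) and at x = 1, whose
    ratio is no power of q, so one of the directions is never blocked. *)
Lemma coprime_vw : coprimep vpoly wpoly.
Proof.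
apply: Pdiv.ClosedField.root_coprimep => x /rootP vx; apply/eqP => wx.
have x0 : x != 0.
  by apply/eqP => e; have := vpoly0; rewrite -e vx => /esym/eqP; rewrite oner_eq0.
have vxq : vpoly.[x * q] = 0.
  have c1 : c != 1 by have := gen_neq1 c_gen 0; rewrite expr0 mulr1.
  have := converges_xq q01 c1 (@converges_vpoly x) (@converges_wpoly x).
  by rewrite vx wx !mulr0 subr0; apply: converges_unique; exact: converges_vpoly.
have [[j jE]|up] := pselect (exists j : nat, c = a * b * q * (x * q ^+ j)).
  have root2 i : vpoly.[x / q ^+ i] = 0 /\ vpoly.[x / q ^+ i * q] = 0.
    elim: i => [|i [ih1 ih2]]; first by rewrite expr0 divr1.
    have e1 : x / q ^+ i.+1 * q = x / q ^+ i by rewrite exprS invfM; field; rewrite q0 expf_neq0.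
    have e2 : x / q ^+ i.+1 * q ^+ 2 = x / q ^+ i * q by rewrite -e1 expr2 mulrA.
    rewrite e1; split=> //.
    have := vpoly_relation (x / q ^+ i.+1); rewrite e1 e2 ih1 ih2 !mulr0 addr0 => /esym/eqP.
    rewrite !mulf_eq0 (negPf q0) /= subr_eq0 => /orP[/eqP xq|/eqP //].
    have xE : x = q ^+ i.+1 by rewrite -[LHS](mulfVK (expf_neq0 i.+1 q0)) xq mul1r.
    have := bc_gen ((i.+1 + j).+1%:Z - r%:Z); rewrite jE xE /a.
    rewrite expfzDr// -exprnN -exprnP [q ^+ (_ + _).+1]exprS exprD => /eqP; case; ring.
  have uI : injective (fun i => x / q ^+ i).
    by move=> i i' /(mulfI x0) /invr_inj; exact: qexp_inj.
  by case/eqP: vpoly_neq0; apply: (poly_eq0_infinite uI) => i; case: (root2 i).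
have root2 i : vpoly.[x * q ^+ i] = 0 /\ vpoly.[x * q ^+ i.+1] = 0.
  elim: i => [|i [ih1 ih2]]; first by rewrite expr0 mulr1 expr1.
  split=> //; have := vpoly_relation (x * q ^+ i).
  have -> : x * q ^+ i * q = x * q ^+ i.+1 by rewrite -mulrA -exprSr.
  have -> : x * q ^+ i * q ^+ 2 = x * q ^+ i.+2 by rewrite -mulrA -exprD addn2.
  rewrite ih1 ih2 !mulr0 addr0.
  by move=> /eqP; rewrite mulf_eq0 subr_eq0 => /orP[/eqP e|/eqP //]; case: up; exists i.
have uI : injective (fun i => x * q ^+ i).
  by move=> i i' /(mulfI x0); exact: qexp_inj.
by case/eqP: vpoly_neq0; apply: (poly_eq0_infinite uI) => i; case: (root2 i).
Qed.

Lemma size_vpoly : size vpoly = r.+1.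
Proof.
apply: size_poly_eq; rewrite /coef !mulf_neq0 ?invr_eq0 ?mulf_neq0 ?qpoch_qq_neq0 //.
- apply: qpoch_neq0 => j; rewrite /= => jr; rewrite -(subnK (ltnW jr)) exprD invfM mulfVK ?expf_neq0//.
  by rewrite invr_eq1 qexp_neq1// subn_gt0.
- by apply: qpoch_neq0 => j _; exact: gen_neq1.
- by apply: qpoch_neq0 => j _; exact: gen_neq1.
Qed.

(** V divides F W, hence F, whose degree is smaller. *)
Lemma independence (F G : {poly C}) : (size F <= r)%N ->
  (forall x, F.[x] * wpoly.[x] + G.[x] * vpoly.[x] = 0) -> F = 0 /\ G = 0.
Proof.
move=> Fr H; have nI : injective (fun j : nat => j%:R : C).
  by move=> i j /eqP; rewrite eqr_nat => /eqP.
have e : F * wpoly + G * vpoly = 0.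
  by apply: (poly_eq0_infinite nI) => j; rewrite !hornerE H.
have F0 : F = 0.
  apply/eqP; apply: contraT => F0.
  have : vpoly %| F.
    rewrite -(Gauss_dvdpl _ coprime_vw) (_ : F * wpoly = - G * vpoly) ?dvdp_mull//.
    by apply/eqP; rewrite mulNr -addr_eq0 e.
  by move=> /(dvdp_leq F0); rewrite size_vpoly ltnNge Fr.
split=> //; move/eqP: e; rewrite F0 mul0r add0r mulf_eq0 (negPf vpoly_neq0) orbF.
by move/eqP.
Qed.

End Independence.

Section Uniqueness.
Variable C : numClosedFieldType.

Lemma bgrid_gen n k (j : int) : bgrid C k != qgrid C n ^ j.
Proof.
apply/eqP => e; have : 0 < qgrid C n ^ j by rewrite exprz_gt0// invr_gt0 ltr0n.
by rewrite -e /bgrid oppr_gt0 ltrn0.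
Qed.

Lemma cgrid_sqr k : cgrid C k ^+ 2 < 0.
Proof. by rewrite /cgrid exprMn sqrCi mulN1r oppr_lt0 exprn_gt0// ltr0n. Qed.

Lemma cgrid_gen n k (j : int) : cgrid C k != qgrid C n ^ j.
Proof.
apply/eqP => e; have := cgrid_sqr k; rewrite e.
have : 0 < qgrid C n ^ j by rewrite exprz_gt0// invr_gt0 ltr0n.
by move=> /(exprn_gt0 2) /lt_trans h /h; rewrite ltxx.
Qed.

Lemma cgrid_bgrid_gen n k k' (j : int) : cgrid C k != bgrid C k' * qgrid C n ^ j.
Proof.
apply/eqP => e; have := cgrid_sqr k; rewrite e.
have h0 : 0 < qgrid C n ^ j by rewrite exprz_gt0// invr_gt0 ltr0n.
have : 0 < (bgrid C k' * qgrid C n ^ j) ^+ 2.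
  by rewrite /bgrid mulNr sqrrN exprn_gt0// mulr_gt0// ltr0n.
by move=> /lt_trans h /h; rewrite ltxx.
Qed.

Lemma shifted_terminates (q : C) (r : nat) (k : int) : q != 0 -> (`|k| <= r)%N ->
  exists r', q ^- r * q ^ k * q ^+ r' = 1.
Proof.
move=> q0 kr; exists `|r%:Z - k|%N.
have -> : q ^+ `|r%:Z - k|%N = q ^ (r%:Z - k).
  by rewrite exprnP; congr (q ^ _); lia.
rewrite exprnN -!expfzDr//; have -> : - r%:Z + k + (r%:Z - k) = 0 by lia.
by rewrite expr0z.
Qed.

(** The difference of the relations, cleared of denominators, is F W + G V = 0. The
    product H of all denominators is a factor of F and G so that the points where the
    coefficients have no values need no exception. *)
Lemma three_term_unique k l m n (Q S Q' S' : ratfun C) :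
  three_term k l m n Q S -> three_term k l m n Q' S' -> Q' = Q /\ S' = S.
Proof.
have [n1 [d1 [d1n0 ->]]] := fraction_rep Q; have [n2 [d2 [d2n0 ->]]] := fraction_rep S.
have [n3 [d3 [d3n0 ->]]] := fraction_rep Q'; have [n4 [d4 [d4n0 ->]]] := fraction_rep S'.
move=> T T'.
pose H := d1 * d2 * d3 * d4.
have H0 : H != 0 by rewrite !mulf_neq0.
pose F := (n3 * d1 - n1 * d3) * d2 * d4 * H.
pose G := (n4 * d2 - n2 * d4) * d1 * d3 * H.
(* r exceeds the degree of F in x, and is large enough for the series at a q^k and at
   a q to terminate. *)
have key i r k1 k2 x : (maxn (msize F) (maxn `|k| 1) <= r)%N ->
  let P := Params (qgrid C i ^- r) (bgrid C k1) (cgrid C k2) (qgrid C i) x in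
  meval (coords P) F = 0 /\ meval (coords P) G = 0.
  rewrite !geq_max => /andP[Fr /andP[kr r0]]; move: (x) => /=.
  set q := qgrid C i; set b := bgrid C k1; set c := cgrid C k2.
  have q01 : 0 < `|q| < 1 := qgrid_bounds C i.
  have q0 : q != 0 := qbase_neq0 q01.
  have [f fF fE] := meval_poly_x F (q ^- r) b c q.
  have [g _ gE] := meval_poly_x G (q ^- r) b c q.
  have cg := cgrid_gen i k2.
  suff [f0 g0] : f = 0 /\ g = 0 by move=> y; rewrite fE gE f0 g0 !horner0.
  apply: (independence q01 (bgrid_gen i k1) cg (cgrid_bgrid_gen i k2 k1) r0) => [|y].
    exact: leq_trans fF Fr.
  rewrite -fE -gE; set P := Params _ _ _ _ _.
  case: (eqVneq (meval (coords P) H) 0) => [h0|].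
    by rewrite /F /G !(mevalM (coords P) _ H) h0 !mulr0 !mul0r addr0.
  move=> h0; have [e1 e2 e3 e4] : [/\ meval (coords P) d1 != 0, meval (coords P) d2 != 0,
      meval (coords P) d3 != 0 & meval (coords P) d4 != 0].
    by split; apply: contraNneq h0 => e; rewrite /H !mevalM e !(mul0r, mulr0).
  have cgn := gen_neq1 q01 cg.
  have [r' r'E] := shifted_terminates q0 kr.
  have cgn' j : c * q ^ m * q ^+ j != 1.
    apply/eqP => e; have /eqP := cg (- (m + j%:Z)); apply.
    rewrite -/c -/q -invr_expz expfzDr// -exprnP -[LHS]mulr1.
    by rewrite -[X in _ * X](@mulfV _ (q ^ m * q ^+ j)) ?mulf_neq0 ?expfz_neq0 ?expf_neq0// mulrA mulrA e mul1r.
  have i0 := is_phi21_terminating q01 (b * q ^ l) (y * q ^ n) r'E cgn'.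
  have i1 : is_phi21 (Defs.shift 1 1 1 0 P) (wpoly q r b c).[y].
    rewrite shift_1110; apply: (is_phi21_generic q01); last exact: converges_wpoly.
    by move=> j; rewrite -mulrA -exprS.
  have iv : is_phi21 P (vpoly q r b c).[y].
    by apply: (is_phi21_generic q01) => //; exact: converges_vpoly.
  have ev (n' d' : mpoly 5 C) : meval (coords P) d' != 0 ->
      ratfun_eval (tofrac n' / tofrac d' : ratfun C) P (meval (coords P) n' / meval (coords P) d').
    by move=> d'0; exists n', d'.
  have E1 := T P _ _ _ _ _ q01 i0 i1 iv (ev n1 d1 e1) (ev n2 d2 e2).
  have E2 := T' P _ _ _ _ _ q01 i0 i1 iv (ev n3 d3 e3) (ev n4 d4 e4).
  rewrite /F /G !(mevalM (coords P) _ H) !(mevalM, mevalB) -/b -/c.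
  move: (wpoly q r b c).[y] (vpoly q r b c).[y] E1 E2 {i1 iv ev} => w v E1 E2.
  have := subrr (psum (y * q ^ n) (coef (q ^- r * q ^ k) (b * q ^ l) (c * q ^ m) q) r'.+1).
  rewrite {1}E2 E1 => E.
  rewrite -(mul0r ((meval (coords P) d1 * meval (coords P) d2 * meval (coords P) d3
    * meval (coords P) d4) ^+ 2)) -E.
  by field; rewrite e1 e2 e3 e4.
have F0 : F = 0.
  by apply: mpoly_dense => i r k1 k2 x hr; case: (key i r k1 k2 x hr).
have G0 : G = 0.
  by apply: mpoly_dense => i r k1 k2 x hr; case: (key i r k1 k2 x hr).
by split; apply/eqP; rewrite eqr_div ?tofrac_eq0// -!tofracM tofrac_eq -subr_eq0;
  [move/eqP: F0|move/eqP: G0]; rewrite !mulf_eq0 ?(negPf d1n0) ?(negPf d2n0)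
    ?(negPf d3n0) ?(negPf d4n0) !orbF.
Qed.

Lemma three_term_unique_pair k l m n (Q S : ratfun C) :
  three_term k l m n Q S -> unique_three_term k l m n Q S.
Proof. by move=> T; split=> // Q' S' T'; exact: three_term_unique T T'. Qed.

End Uniqueness.

(** * Points where Q vanishes and S factors *)

Section SpecialPoints.
Variable C : numClosedFieldType.
Implicit Types (a b c q x w : C).

Lemma quotient_value N D P (y : C) : natural N -> natural D -> at_point D P != 0 ->
  y * at_point D P = at_point N P -> ratfun_eval (quotient C N D) P y.
Proof.
move=> natN natD D0 e; rewrite (_ : y = at_point N P / at_point D P).
  exact: quotient_eval.
by rewrite -e mulfK.
Qed.

Lemma one_plus_q q : `|q| < 1 -> 1 + q != 0.
Proof. by move=> q1; have := one_plus_qexp_neq0 1 q1; rewrite expr1. Qed.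

Lemma special_0002 a q x : 0 < `|q| < 1 -> a ^+ 2 * x != 1 ->
  let P := Params a (- a) (- q) q x in
  ratfun_eval (quotient C Q0002 DQ0002) P 0 /\
  ratfun_eval (quotient C S0002 DS0002) P ((1 - x) / (1 - a ^+ 2 * x)).
Proof.
move=> q01 ax P; have q0 := qbase_neq0 q01; have /andP[_ q1] := q01.
have ax' : 1 - a ^+ 2 * x != 0 by rewrite subr_eq0 eq_sym.
have dS : at_point DS0002 P = - (q * (1 - a ^+ 2 * x)) by rewrite /at_point /DS0002 /=; ring.
have dQ : at_point DQ0002 P = - (q * (1 - a ^+ 2 * x)) * (1 + q).
  by rewrite /at_point /DQ0002 /=; ring.
split; apply: quotient_value => //; rewrite ?dQ ?dS.
- by rewrite mulf_neq0 ?oppr_eq0 ?mulf_neq0 ?(one_plus_q q1).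
- by rewrite /at_point /Q0002 /=; ring.
- by rewrite oppr_eq0 mulf_neq0.
- by rewrite /at_point /S0002 /=; field.
Qed.

Lemma special_0110 a b c q : a != 0 -> b != 0 -> c != a ->
  let P := Params a b c q (c / (a * b)) in
  ratfun_eval (quotient C Q0110 D0110) P 0 /\
  ratfun_eval (quotient C S0110 D0110) P (- (a * (1 - c)) / (c - a)).
Proof.
move=> a0 b0 ca P; have ca' : at_point D0110 P != 0 by rewrite /at_point /D0110 /= subr_eq0.
rewrite /at_point /D0110 /= in ca'.
split; apply: quotient_value => //; rewrite /at_point /Q0110 /S0110 /D0110 /=.
  by field; rewrite a0 b0.
by field.
Qed.

Definition bailey_daum_point a b q : params C := Params a b (b * q / a) q (- (q / a)).

Lemma special_0220 a b q : q != 0 -> a != 0 -> b * q != 1 -> b * q / a != a -> b * q / a * q != a ->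
  ratfun_eval (quotient C Q0220 D0220) (bailey_daum_point a b q) 0 /\
  ratfun_eval (quotient C S0220 D0220) (bailey_daum_point a b q)
    ((1 - b * q / a) * (1 - b * q / a * q) / ((1 - b * q) * (1 - b * q / a * q / a))).
Proof.
move=> q0 a0 bq ca cqa.
have n1 : 1 - b * q != 0 by rewrite subr_eq0 eq_sym.
have n2 : b * q / a - a != 0 by rewrite subr_eq0.
have n3 : b * q / a * q - a != 0 by rewrite subr_eq0.
have D0 : at_point D0220 (bailey_daum_point a b q) != 0.
  by rewrite /at_point /D0220 /= !mulf_neq0 ?oppr_eq0 ?mulf_neq0 ?invr_eq0.
have n4 : b * q - a * a != 0.
  by move: n2; rewrite (_ : _ - a = (b * q - a * a) / a) ?mulf_eq0 ?negb_or; [case/andP|field].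
have n5 : b * q * q - a * a != 0.
  by move: n3; rewrite (_ : _ - a = (b * q * q - a * a) / a) ?mulf_eq0 ?negb_or; [case/andP|field].
have n6 : a * a - b * q * q != 0 by rewrite -opprB oppr_eq0.
split; apply: quotient_value => //; rewrite /at_point /Q0220 /S0220 /E0110 /Q0110 /S0110 /D0220 /=.
  by field; rewrite a0.
by field; rewrite a0 n1 n6.
Qed.

Lemma special_1211 a b q : q != 0 -> a != 0 -> b * q != 1 -> 1 + a != 0 ->
  ratfun_eval (quotient C Q1211 D1211) (bailey_daum_point a b q) 0 /\
  ratfun_eval (quotient C S1211 D1211) (bailey_daum_point a b q)
    ((a - b * q) / ((1 - b * q) * (1 + a))).
Proof.
move=> q0 a0 bq a1.
have n1 : 1 - b * q != 0 by rewrite subr_eq0 eq_sym.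
have D0 : at_point D1211 (bailey_daum_point a b q) != 0.
  rewrite /at_point /D1211 /= mulf_neq0// (_ : _ - _ = q * (1 + a) / a); last by field.
  by rewrite !mulf_neq0 ?invr_eq0.
have n2 : a + 1 != 0 by rewrite addrC.
have n3 : q * a + q != 0 by rewrite -[X in _ + X]mulr1 -mulrDr mulf_neq0.
split; apply: quotient_value => //; rewrite /at_point /Q1211 /S1211 /D1211 /=.
  by field.
by field; rewrite a0 n1 a1.
Qed.

Definition cubic_point w b q : params C := Params (w * q) b (w * b) q 1.

Lemma cubic_root w : w ^+ 3 = 1 -> w != 1 -> w * w = - w - 1.
Proof.
move=> w3 w1; apply/eqP; rewrite -subr_eq0; apply/eqP.
apply: (mulfI (_ : w - 1 != 0)); first by rewrite subr_eq0.
by rewrite mulr0; transitivity (w ^+ 3 - 1); [ring|rewrite w3 subrr].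
Qed.

Lemma special_0330 w b q : q != 0 -> w ^+ 3 = 1 -> w != 1 ->
  b != 1 -> b * q != 1 -> b * q * q != 1 -> b != q ->
  ratfun_eval (quotient C Q0330 D0330) (cubic_point w b q) 0 /\
  ratfun_eval (quotient C S0330 D0330) (cubic_point w b q)
    (((1 - w * b) * (1 - w * b * q) * (1 - w * b * q * q))
     / ((1 - b) * (1 - b * q) * (1 - b * q * q))).
Proof.
move=> q0 w3 w1 b1 bq bqq bq'; have w2 := cubic_root w3 w1.
have w0 : w != 0 by apply/eqP => w0; move: w3; rewrite w0 expr0n => /esym/eqP; rewrite oner_eq0.
have D0 : at_point D0330 (cubic_point w b q) != 0.
  rewrite /at_point /D0330 /D0220 /= (_ : w * b * q * q - w * q = w * q * (b * q - 1)); last by ring.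
  rewrite (_ : w * b * q - w * q = w * q * (b - 1)); last by ring.
  rewrite (_ : w * b - w * q = w * (b - q)); last by ring.
  by rewrite !mulf_neq0 ?subr_eq0 // ?oner_neq0 // 1?eq_sym.
have n1 : 1 - b != 0 by rewrite subr_eq0 eq_sym.
have n2 : 1 - b * q != 0 by rewrite subr_eq0 eq_sym.
have n3 : 1 - b * q * q != 0 by rewrite subr_eq0 eq_sym.
split; apply: quotient_value => //;
  rewrite /at_point /Q0330 /S0330 /D0330 /Q0220 /S0220 /D0220 /E0110 /Q0110 /S0110 /=.
  (* Q vanishes modulo w^2 + w + 1 only, and likewise S factors modulo it. *)
  by ring: w2.
rewrite mulrAC; apply: (mulIf (_ : (1 - b) * (1 - b * q) * (1 - b * q * q) != 0)).
  by rewrite !mulf_neq0.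
rewrite mulfVK ?mulf_neq0//.
by ring: w2.
Qed.

End SpecialPoints.

(** * Iteration of a three-term relation *)

Section Chains.
Variable C : numClosedFieldType.
Implicit Types (a b c q x w : C).

Lemma ebisu_pointS k l m n (P : params C) nu : pq P != 0 ->
  Defs.shift k l m n (ebisu_point k l m n P nu) = ebisu_point k l m n P nu.+1.
Proof.
move=> q0; rewrite /ebisu_point /Defs.shift /=.
have e (i : int) (y : C) : y * pq P ^ (i * (nu%:Z - 1)) * pq P ^ i = y * pq P ^ (i * (nu.+1%:Z - 1)).
  by rewrite -mulrA -expfzDr//; congr (_ * _ ^ _); lia.
by rewrite !e.
Qed.

(** The series W has to be defined at each point although its coefficient Q is 0
    there: the three-term relation is asserted only where all its terms are. *)
Lemma ebisu_chainI k l m n (Q S : ratfun C) (P : params C) (K : nat) :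
  three_term k l m n Q S -> 0 < `|pq P| < 1 ->
  (forall N, (N <= K)%N -> exists v, is_phi21 (ebisu_point k l m n P N.+1) v) ->
  (forall N, (N < K)%N -> ratfun_eval Q (ebisu_point k l m n P N.+1) 0) ->
  (forall N, (N < K)%N -> exists2 r, ratfun_eval S (ebisu_point k l m n P N.+1) r & r != 0) ->
  (forall N, (N < K)%N -> exists v,
    is_phi21 (Defs.shift 1 1 1 0 (ebisu_point k l m n P N.+1)) v) ->
  ebisu_chain k l m n Q S P K.
Proof.
move=> T q01 hphi hQ hS hW.
have /choice[phi phiE] N : exists v, (N <= K)%N -> is_phi21 (ebisu_point k l m n P N.+1) v.
  by case: (leqP N K) => [/hphi[v]|_]; [exists v|exists 0].
have /choice[r rE] N : exists y, (N < K)%N ->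
    ratfun_eval S (ebisu_point k l m n P N.+1) y /\ y != 0.
  by case: (ltnP N K) => [/hS[y]|_]; [exists y|exists 0].
have q0 : pq P != 0 by rewrite -normr_gt0; case/andP: q01.
have rel N : (N < K)%N -> phi N.+1 = r N * phi N.
  move=> NK; have [v vE] := hW N NK; have [ry _] := rE N NK.
  have h0 : is_phi21 (Defs.shift k l m n (ebisu_point k l m n P N.+1)) (phi N.+1).
    by rewrite ebisu_pointS//; exact: phiE.
  have := T _ _ _ _ _ _ _ h0 vE (phiE N (ltnW NK)) (hQ N NK) ry.
  by rewrite mul0r add0r; apply.
exists (fun nu => r nu.-1), (fun nu => phi nu.-1); split.
- by case=> [//|N] /=; rewrite ltnS; exact: phiE.
- case=> [//|N] /= NK; have [ry r0] := rE N NK.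
  by split=> //; [exact: hQ|exact: rel].
- case=> [//|N] /=; have key M : (M <= K)%N ->
      (\prod_(1 <= j < M.+1) r j.-1 != 0) /\ (\prod_(1 <= j < M.+1) r j.-1) * phi 0%N = phi M.
    elim: M => [|M ih] MK; first by rewrite big_geq// oner_neq0 mul1r.
    have [p0 pE] := ih (ltnW MK); have [_ r0] := rE M MK.
    rewrite big_nat_recr //=; split; first by rewrite mulf_neq0.
    by rewrite mulrAC pE rel// mulrC.
  by move=> /key[p0 <-]; rewrite mulKf.
Qed.

Lemma ebisu_point0002 a b c q x N :
  ebisu_point 0 0 0 2 (Params a b c q x) N.+1 = Params a b c q (x * q ^+ (2 * N)).
Proof.
rewrite /ebisu_point /Defs.shift /= !mul0r !expr0z !mulr1; congr Params.
by rewrite exprnP; congr (_ * _ ^ _); lia.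
Qed.

Lemma ebisu_point0110 a b c q x N :
  ebisu_point 0 1 1 0 (Params a b c q x) N.+1 = Params a (b * q ^+ N) (c * q ^+ N) q x.
Proof.
rewrite /ebisu_point /Defs.shift /= !mul0r !mul1r !expr0z !mulr1.
by rewrite exprnP; congr Params; congr (_ * _ ^ _); lia.
Qed.

Lemma ebisu_point0220 a b q N : ebisu_point 0 2 2 0 (bailey_daum_point a b q) N.+1 =
  bailey_daum_point a (b * q ^+ (2 * N)) q.
Proof.
rewrite /ebisu_point /Defs.shift /bailey_daum_point /= !mul0r !expr0z !mulr1.
have -> : q ^ (2 * (N.+1%:Z - 1)) = q ^+ (2 * N) by rewrite exprnP; congr (_ ^ _); lia.
by congr Params; ring.
Qed.

Lemma ebisu_point1211 a b q N : q != 0 -> a != 0 -> ebisu_point 1 2 1 (-1) (bailey_daum_point a b q) N.+1 =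
  bailey_daum_point (a * q ^+ N) (b * q ^+ (2 * N)) q.
Proof.
move=> q0 a0; rewrite /ebisu_point /Defs.shift /bailey_daum_point /=.
have -> : q ^ (2 * (N.+1%:Z - 1)) = q ^+ (2 * N) by rewrite exprnP; congr (_ ^ _); lia.
have -> : q ^ (1 * (N.+1%:Z - 1)) = q ^+ N by rewrite exprnP; congr (_ ^ _); lia.
have -> : q ^ (-1 * (N.+1%:Z - 1)) = q ^- N by rewrite exprnN; congr (_ ^ _); lia.
have qN : q ^+ N != 0 by rewrite expf_neq0.
congr Params; rewrite ?mul2n -?addnn ?exprD; field; by rewrite a0 qN.
Qed.

Lemma ebisu_point0330 w b q N : ebisu_point 0 3 3 0 (cubic_point w b q) N.+1 =
  cubic_point w (b * q ^+ (3 * N)) q.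
Proof.
rewrite /ebisu_point /Defs.shift /cubic_point /= !mul0r !expr0z !mulr1.
have -> : q ^ (3 * (N.+1%:Z - 1)) = q ^+ (3 * N) by rewrite exprnP; congr (_ ^ _); lia.
by congr Params; ring.
Qed.

End Chains.

(** * Terminating series *)

Section Terminating.
Variables (C : numClosedFieldType) (q : C).
Hypothesis q01 : 0 < `|q| < 1.
Implicit Types (a b c x w : C).

Let q1 : `|q| < 1. Proof. by case/andP: q01. Qed.
Let q0 : q != 0. Proof. exact: qbase_neq0 q01. Qed.
Let qn0 n : q ^+ n != 0. Proof. by rewrite expf_neq0. Qed.

Lemma is_phi21_extended a b c x r s : (r < s)%N -> a = q ^- r \/ b = q ^- r -> c = q ^- s ->
  is_phi21 (Params a b c q x) (\sum_(i < r.+1) phi21_term (Params a b c q x) i).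
Proof. by move=> rs ab cs; right; exists r, s. Qed.

Lemma qexpN_neq1 n : (0 < n)%N -> q ^- n != 1.
Proof. by move=> n0; rewrite invr_eq1 qexp_neq1. Qed.

Lemma one_plus_qexpN_neq0 n : 1 + q ^- n != 0.
Proof.
rewrite (_ : 1 + _ = (1 + q ^+ n) / q ^+ n); last by field.
by rewrite mulf_neq0 ?invr_eq0// one_plus_qexp_neq0.
Qed.

Lemma shift_bailey_daum a b : a != 0 -> Defs.shift 1 2 1 (-1) (bailey_daum_point a b q) = bailey_daum_point (a * q) (b * q * q) q.
Proof.
move=> a0; rewrite shift_1211 /bailey_daum_point; by congr Params; field; rewrite a0 q0.
Qed.

Lemma step_1211 a b v v1 v' : a != 0 -> b * q != 1 -> 1 + a != 0 ->
  is_phi21 (bailey_daum_point a b q) v -> is_phi21 (Defs.shift 1 1 1 0 (bailey_daum_point a b q)) v1 ->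
  is_phi21 (bailey_daum_point (a * q) (b * q * q) q) v' ->
  (1 - b * q) * (1 + a) * v' = (a - b * q) * v.
Proof.
move=> a0 bq a1 h h1; rewrite -shift_bailey_daum// => h'.
have [eQ eS] := special_1211 q0 a0 bq a1.
have -> := @three_term_1211 C (bailey_daum_point a b q) _ _ _ _ _ q01 h' h1 h eQ eS.
by field; rewrite a1 subr_eq0 eq_sym bq.
Qed.

Lemma bd_pos_c m s : q ^- s * q / q ^+ (m + 2) = q ^- (s + m + 1).
Proof. by rewrite !exprD expr1 expr2; field; rewrite q0 !qn0. Qed.

Lemma bd_pos_exists m s : is_phi21 (bailey_daum_point (q ^+ (m + 2)) (q ^- s) q)
  (\sum_(i < s.+1) phi21_term (bailey_daum_point (q ^+ (m + 2)) (q ^- s) q) i).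
Proof.
apply: (@is_phi21_extended _ _ _ _ s (s + m + 1)); first lia; first by right.
exact: bd_pos_c.
Qed.

Lemma bd_pos_shift_exists m s :
  exists v, is_phi21 (Defs.shift 1 1 1 0 (bailey_daum_point (q ^+ (m + 2)) (q ^- s.+1) q)) v.
Proof.
eexists; rewrite shift_1110; apply: (@is_phi21_extended _ _ _ _ s (s + m + 1)); first lia.
  by right; rewrite exprS invfM mulrAC mulVf// mul1r.
by rewrite bd_pos_c addSn exprS invfM mulrAC mulVf// mul1r.
Qed.

Lemma bd_pos_step m s v v' :
  is_phi21 (bailey_daum_point (q ^+ (m + 2)) (q ^- s.+2) q) v ->
  is_phi21 (bailey_daum_point (q ^+ (m.+1 + 2)) (q ^- s) q) v' ->
  v = (1 - q ^+ s.+1) * (1 + q ^+ (m + 2)) / (1 - q ^+ (m + s + 3)) * v'.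
Proof.
move=> h h'; have [v1 h1] := bd_pos_shift_exists m s.+1.
have eb : q ^- s.+2 * q = q ^- s.+1 by rewrite exprS invfM mulrAC mulVf// mul1r.
have eb' : q ^- s.+1 * q = q ^- s by rewrite exprS invfM mulrAC mulVf// mul1r.
have rel : (1 - q ^- s.+2 * q) * (1 + q ^+ (m + 2)) * v' = (q ^+ (m + 2) - q ^- s.+2 * q) * v.
  apply: (step_1211 (v1 := v1)) => //.
  - by rewrite eb qexpN_neq1.
  - exact: one_plus_qexp_neq0.
  - by rewrite eb eb' -exprSr.
have n1 : 1 - q ^+ (m + s + 3) != 0 by rewrite addnS subr_qexp_neq0.
rewrite eb in rel; apply: (mulfI n1).
transitivity (- q ^+ s.+1 * ((q ^+ (m + 2) - q ^- s.+1) * v)).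
  have -> : q ^+ (m + s + 3) = q ^+ s.+1 * q ^+ (m + 2) by rewrite -exprD; congr (_ ^+ _); lia.
  by field.
by rewrite -rel; field; rewrite n1 qn0.
Qed.

(** A step of the chain turns (M, N) into (M + 1, N - 1), and the series at N = 0 is 1. *)
Lemma value_4a M N : is_phi21 (bailey_daum_point (q ^+ (M + 2)) (q ^- (2 * N)) q)
  (qpoch (- q ^+ (M + 2)) q N * qpoch q (q ^+ 2) N / qpoch (q ^+ (M + N + 2)) q N).
Proof.
elim: N M => [|N ih] M.
  have := bd_pos_exists M 0; rewrite muln0 big_ord_recl big_ord0 /phi21_term /= !qpoch0 expr0.
  by rewrite !(mul1r, mulr1, addr0) invr1.
have h := bd_pos_exists M (2 * N).+2; rewrite (_ : 2 * N.+1 = (2 * N).+2)%N; last lia.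
suff -> : qpoch (- q ^+ (M + 2)) q N.+1 * qpoch q (q ^+ 2) N.+1 / qpoch (q ^+ (M + N.+1 + 2)) q N.+1 =
  \sum_(i < (2 * N).+3) phi21_term (bailey_daum_point (q ^+ (M + 2)) (q ^- (2 * N).+2) q) i by [].
rewrite (bd_pos_step h (ih M.+1)).
rewrite qpochSl (qpochS q) (qpochS (q ^+ _)) -exprM -exprS opprK.
have -> : - q ^+ (M + 2) * q = - q ^+ (M.+1 + 2) by rewrite mulNr -exprSr.
have -> : (M.+1 + N + 2 = M + N.+1 + 2)%N by lia.
have -> : q ^+ (M + N.+1 + 2) * q ^+ N = q ^+ (M + 2 * N + 3) by rewrite -exprD; congr (_ ^+ _); lia.
have n1 : 1 - q ^+ (M + 2 * N + 3) != 0 by rewrite addnS subr_qexp_neq0.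
have n2 : qpoch (q ^+ (M + N.+1 + 2)) q N != 0.
  by apply: qpoch_neq0 => j _; rewrite -exprD qexp_neq1// addn2.
have -> : (2 * N).+1 = (2 * N.+1).-1 by lia.
by field; rewrite n1 n2.
Qed.

(** The chain ends at b = 1 / q, where the two terms of the series cancel. *)
Lemma value_4b M N : is_phi21 (bailey_daum_point (q ^+ (M + 2)) (q ^- (2 * N + 1)) q) 0.
Proof.
elim: N M => [|N ih] M.
  have := bd_pos_exists M 1; rewrite !big_ord_recl big_ord0 /phi21_term /= /bump /= bd_pos_c.
  rewrite !qpochS !qpoch0 !expr0 !expr1 !(mul1r, mulr1, addr0) invr1.
  rewrite [X in is_phi21 _ X](_ : _ = 0)//.
  have n1 : 1 - q != 0 by have := subr_qexp_neq0 q1 0; rewrite expr1.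
  have n2 : 1 - q ^+ (M + 2) != 0 by rewrite addn2 subr_qexp_neq0.
  have -> : (1 + M + 1 = M + 2)%N by lia.
  by field; rewrite q0 n1 qn0 /= -opprB oppr_eq0 n2.
have h := bd_pos_exists M (2 * N + 1).+2; rewrite (_ : 2 * N.+1 + 1 = (2 * N + 1).+2)%N; last lia.
by move: (h); rewrite (bd_pos_step h (ih M.+1)) mulr0.
Qed.

Lemma bd_neg_c m n : q ^- (m + 2 * n + 2) * q / q ^- n = q ^- (m + n + 1).
Proof. by rewrite mul2n -addnn !exprD expr1 expr2; field; rewrite q0 !qn0. Qed.

Lemma bd_neg_exists m n : is_phi21 (bailey_daum_point (q ^- n) (q ^- (m + 2 * n + 2)) q)
  (\sum_(i < n.+1) phi21_term (bailey_daum_point (q ^- n) (q ^- (m + 2 * n + 2)) q) i).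
Proof.
apply: (@is_phi21_extended _ _ _ _ n (m + n + 1)); first lia; first by left.
exact: bd_neg_c.
Qed.

Lemma expNr_predM n : q ^- n.+1 * q = q ^- n.
Proof. by rewrite exprS invfM mulrAC mulVf// mul1r. Qed.

Lemma bd_neg_shift_exists m n :
  exists v, is_phi21 (Defs.shift 1 1 1 0 (bailey_daum_point (q ^- n.+1) (q ^- (m + 2 * n.+1 + 2)) q)) v.
Proof.
eexists; rewrite shift_1110; apply: (@is_phi21_extended _ _ _ _ n (m + n + 1)); first lia.
  by left; rewrite expNr_predM.
by rewrite bd_neg_c (_ : m + n.+1 + 1 = (m + n + 1).+1)%N ?expNr_predM//; lia.
Qed.

(** A step of the chain turns (M, N) into (M, N - 1), and the series at N = 0 is 1. *)
Lemma value_4c M N : is_phi21 (bailey_daum_point (q ^- N) (q ^- (M + 2 * N + 2)) q)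
  (qpoch (- q) q N * qpoch (q ^+ (M + 3)) (q ^+ 2) N
   / (q ^+ (N * (N + 1) %/ 2) * qpoch (q ^+ (M + 2)) q N)).
Proof.
elim: N => [|N ih].
  have := bd_neg_exists M 0; rewrite big_ord_recl big_ord0 /phi21_term /= !qpoch0.
  by rewrite !expr0 !(mul1r, mulr1, addr0) invr1.
have h := bd_neg_exists M N.+1; have [v1 h1] := bd_neg_shift_exists M N.
have eb : q ^- (M + 2 * N.+1 + 2) * q = q ^- (M + 2 * N + 3).
  by rewrite (_ : M + 2 * N.+1 + 2 = (M + 2 * N + 3).+1)%N ?expNr_predM//; lia.
have eb' : q ^- (M + 2 * N + 3) * q = q ^- (M + 2 * N + 2).
  by rewrite addnS expNr_predM.
have := step_1211 _ _ _ h h1; rewrite expNr_predM eb eb' => /(_ _ _ _ _ ih) rel.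
move: (h); set v := \sum_(i < _) _ in h rel *; set v' := (X in is_phi21 _ X) in ih rel.
suff -> : v = (1 + q ^+ N.+1) * (1 - q ^+ (M + 2 * N + 3))
    / (q ^+ N.+1 * (1 - q ^+ (M + N + 2))) * v' => [|].
  move=> h'; rewrite [X in is_phi21 _ X](_ : _ = (1 + q ^+ N.+1) * (1 - q ^+ (M + 2 * N + 3))
    / (q ^+ N.+1 * (1 - q ^+ (M + N + 2))) * v')//.
  have -> : (N.+1 * (N.+1 + 1) %/ 2 = N.+1 + N * (N + 1) %/ 2)%N.
    by rewrite -(@divnMDl N.+1 (N * (N + 1)) 2)//; congr (_ %/ _)%N; lia.
  rewrite /v' !qpochS -!exprM mulNr opprK -exprS -!exprD.
  have -> : (M + 3 + 2 * N = M + 2 * N + 3)%N by lia.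
  have -> : (M + 2 + N = M + N + 2)%N by lia.
  have n2 : qpoch (q ^+ (M + 2)) q N != 0.
    by apply: qpoch_neq0 => j _; rewrite -exprD qexp_neq1// addn2.
  have n1 : 1 - q ^+ (M + N + 2) != 0 by rewrite addn2 subr_qexp_neq0.
  by rewrite [q ^+ (N.+1 + _)]exprD; field; rewrite n1 n2 !qn0.
have n1 : 1 - q ^+ (M + N + 2) != 0 by rewrite addn2 subr_qexp_neq0.
have {}rel : (1 - q ^- (M + 2 * N + 3)) * (1 + q ^- N.+1) * v' =
    (q ^- N.+1 - q ^- (M + 2 * N + 3)) * v.
  apply: rel; first by rewrite invr_eq0.
    by rewrite addnS qexpN_neq1.
  exact: one_plus_qexpN_neq0.
apply: (mulfI n1).
have eX : q ^+ (M + 2 * N + 3) = q ^+ (M + N + 2) * q ^+ N.+1.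
  by rewrite -exprD; congr (_ ^+ _); lia.
transitivity (- q ^+ (M + 2 * N + 3) * ((q ^- N.+1 - q ^- (M + 2 * N + 3)) * v)).
  by rewrite eX; field; rewrite !qn0.
by rewrite -rel eX; field; rewrite n1 !qn0.
Qed.

Section CubicRoot.
Variable w : C.
Hypotheses (w3 : w ^+ 3 = 1) (w1 : w != 1).

(** As |w| = 1, w q^j = q^s forces j = s by comparing absolute values, and then w = 1. *)
Lemma omega_generic s j : w * q ^- s * q ^+ j != 1.
Proof.
apply/eqP => e; have wE : w * q ^+ j = q ^+ s.
  by rewrite -[LHS](mulfK (qn0 s)) mulrAC -[w * _ * _]mulrA [q ^+ j / _]mulrC mulrA e mul1r.
have nw : `|w| = 1.
  by apply/eqP; rewrite -(@pexpr_eq1 _ _ 3)// -normrX w3 normr1.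
have := congr1 Num.norm wE; rewrite normrM nw mul1r !normrX => /(@qexp_inj C).
rewrite normr_id => /(_ q01) js; move: e; rewrite js mulfVK// => e.
by move: w1; rewrite e eqxx.
Qed.

Lemma omega_exists s : is_phi21 (cubic_point w (q ^- s) q)
  (psum 1 (coef (w * q) (q ^- s) (w * q ^- s) q) s.+1).
Proof.
apply: is_phi21_generic => //; first exact: omega_generic.
apply: converges_finite => i si.
rewrite /coef (@qpoch_vanishes _ _ (q ^- s) s)// ?mulVf//.
by rewrite mulr0 mul0r.
Qed.

Lemma omega_shift_exists s :
  exists v, is_phi21 (Defs.shift 1 1 1 0 (cubic_point w (q ^- s.+1) q)) v.
Proof.
exists (psum 1 (coef (w * q * q) (q ^- s) (w * q ^- s) q) s.+1).
rewrite shift_1110 expNr_predM (_ : w * q ^- s.+1 * q = w * q ^- s); last first.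
  by rewrite -mulrA expNr_predM.
apply: is_phi21_generic => //; first exact: omega_generic.
apply: converges_finite => i si.
rewrite /coef (@qpoch_vanishes _ _ (q ^- s) s)// ?mulVf//.
by rewrite mulr0 mul0r.
Qed.

Lemma omega_special s : ratfun_eval (quotient C Q0330 D0330) (cubic_point w (q ^- s.+3) q) 0 /\
  ratfun_eval (quotient C S0330 D0330) (cubic_point w (q ^- s.+3) q)
    (qpoch (w * q ^- s.+3) q 3 / qpoch (q ^- s.+3) q 3).
Proof.
have [||||eQ eS] := @special_0330 C w (q ^- s.+3) q q0 w3 w1; rewrite ?expNr_predM ?qexpN_neq1//.
  apply/eqP => e; have := expNr_predM s.+2; rewrite e => e2.
  have : `|q ^- s.+2| > 1 by rewrite normfV invf_gt1 ?normr_gt0// norm_exp_lt1.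
  rewrite -e2 => /lt_trans h; have := h _ (norm_exp_lt1 q1 (isT : (0 < 2)%N)).
  by rewrite ltxx.
split=> //; move: eS; rewrite !qpochS !qpoch0 !mul1r expr0 !mulr1 expr1 expr2.
by rewrite !mulrA.
Qed.

Lemma shift_omega b : Defs.shift 0 3 3 0 (cubic_point w b q) = cubic_point w (b * q * q * q) q.
Proof. by rewrite shift_0330 /cubic_point !mulrA. Qed.

(** The value is 0 when N is 2 modulo 3. *)
Definition omega_value N := (1 - w ^+ (N + 1)) / (1 - w)
  * (qpoch (q ^- N) q N / qpoch (w * q ^- N) q N).

(** Steps N -> N - 3 multiply the value by a ratio of shifted factorials, as w^N is
    unchanged; the sums for N = 0, 1, 2 are computed. *)
Lemma value_5 N : is_phi21 (cubic_point w (q ^- N) q) (omega_value N).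
Proof.
have w1' : 1 - w != 0 by rewrite subr_eq0 eq_sym.
have n1 : 1 - q != 0 by have := subr_qexp_neq0 q1 0; rewrite expr1.
have n2 : 1 - q ^+ 2 != 0 by exact: subr_qexp_neq0.
have g s j : 1 - w * q ^- s * q ^+ j != 0 by rewrite subr_eq0 eq_sym omega_generic.
have w2 := cubic_root w3 w1.
suff : [/\ is_phi21 (cubic_point w (q ^- N) q) (omega_value N),
    is_phi21 (cubic_point w (q ^- N.+1) q) (omega_value N.+1) &
    is_phi21 (cubic_point w (q ^- N.+2) q) (omega_value N.+2)] by case.
elim: N => [|N [h0 h1 h2]]; last first.
  split=> //; have hv := omega_exists N.+3; have [v1 hv1] := omega_shift_exists N.+2.
  have [eQ eS] := omega_special N.
  have h0' : is_phi21 (Defs.shift 0 3 3 0 (cubic_point w (q ^- N.+3) q)) (omega_value N).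
    by rewrite shift_omega !expNr_predM.
  have rel := @three_term_0330 C (cubic_point w (q ^- N.+3) q) _ _ _ _ _ q01 h0' hv1 hv eQ eS.
  suff -> : omega_value N.+3 = psum 1 (coef (w * q) (q ^- N.+3) (w * q ^- N.+3) q) N.+4 by [].
  have nb : qpoch (q ^- N.+3) q 3 != 0.
    by apply: qpoch_neq0 => -[|[|[|j]]] // _; rewrite ?expr0 ?mulr1 ?expr1 ?expr2 ?mulrA ?expNr_predM qexpN_neq1.
  have nw s i : qpoch (w * q ^- s) q i != 0 by apply: qpoch_neq0 => j _; exact: omega_generic.
  move: rel; rewrite mul0r add0r => rel.
  rewrite -[RHS](mulKf (_ : qpoch (w * q ^- N.+3) q 3 / qpoch (q ^- N.+3) q 3 != 0)); last first.
    by rewrite mulf_neq0 ?invr_eq0.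
  rewrite -rel /omega_value -[N.+3]/(3 + N)%N !(qpochD _ q 3 N).
  have -> : q ^- (3 + N) * q ^+ 3 = q ^- N by rewrite exprD; field; rewrite q0 qn0.
  have -> : w * q ^- (3 + N) * q ^+ 3 = w * q ^- N by rewrite exprD; field; rewrite q0 qn0.
  have -> : w ^+ (3 + N + 1) = w ^+ (N + 1) by rewrite -addnA exprD w3 mul1r.
  by field; rewrite w1' !nw nb.
have e0 := omega_exists 0; have e1 := omega_exists 1; have e2 := omega_exists 2.
have g1 := g 1%N 0%N; have g2 := g 2 0%N; have g3 := g 2 1%N.
rewrite expr0 mulr1 expr1 in g1; rewrite expr0 mulr1 in g2; rewrite expr1 in g3.
have g1' : q - w != 0.
  by move: g1; rewrite (_ : 1 - _ = (q - w) / q) ?mulf_eq0 ?negb_or; [case/andP|field].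
have g2' : q ^+ 2 - w != 0.
  by move: g2; rewrite (_ : 1 - _ = (q ^+ 2 - w) / q ^+ 2) ?mulf_eq0 ?negb_or; [case/andP|field].
have E0 : omega_value 0 = psum 1 (coef (w * q) (q ^- 0) (w * q ^- 0) q) 1.
  rewrite /psum big_ord_recl big_ord0 /coef /omega_value /= !qpoch0 !expr0 !expr1.
  by field; exact: w1'.
have E1 : omega_value 1 = psum 1 (coef (w * q) (q ^- 1) (w * q ^- 1) q) 2.
  rewrite /psum !big_ord_recl big_ord0 /coef /omega_value /= /bump /= !qpochS !qpoch0 !expr0 !expr1.
  by field; rewrite q0 n1 g1' w1'.
have E2 : omega_value 2 = psum 1 (coef (w * q) (q ^- 2) (w * q ^- 2) q) 3.
  rewrite [LHS](_ : _ = 0); last by rewrite /omega_value addn1 w3 subrr !mul0r.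
  rewrite /psum !big_ord_recl big_ord0 /coef /= /bump /= !qpochS !qpoch0 !expr0 !expr1.
  by field: w2; rewrite q0 n1 g1' g2' -expr2 n2.
by split; rewrite ?E0 ?E1 ?E2.
Qed.

End CubicRoot.

End Terminating.

(** * Nonterminating series *)

Section Nonterminating.
Variables (R : realType).
Local Notation C := (Cplx R).
Implicit Types (a b c q x w : C).

Lemma phi21_exists a b c q x : 0 < `|q| < 1 -> `|x| < 1 ->
  (forall j, c * q ^+ j != 1) -> exists v, is_phi21 (Params a b c q x) v.
Proof.
move=> q01 x1 ne; have /andP[_ q1] := q01.
by have [v cv] := coef_converges a b c q1 x1; exists v; exact: is_phi21_generic.
Qed.

Lemma generic_shift c q n : (forall j, c * q ^+ j != 1) -> forall j, c * q ^+ n * q ^+ j != 1.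
Proof. by move=> ne j; rewrite -mulrA -exprD. Qed.

Lemma generic_shift1 c q : (forall j, c * q ^+ j != 1) -> forall j, c * q * q ^+ j != 1.
Proof. by move=> ne; have := generic_shift 1 ne; rewrite expr1. Qed.

Lemma generic_truncating a b c q : (forall j, c * q ^+ j != 1) -> truncating q a b c.
Proof. by move=> ne i e; have := ne i; rewrite e eqxx. Qed.

Lemma minus_q_generic q : `|q| < 1 -> forall j, - q * q ^+ j != 1.
Proof.
move=> q1 j; have := one_plus_qexp_neq0 j.+1 q1; rewrite addrC addr_eq0 exprS.
by rewrite mulNr eqr_oppLR.
Qed.

Lemma chain_0002 a q x K : 0 < `|q| < 1 -> `|x| < 1 ->
  (forall j : nat, a ^+ 2 * x * (q ^+ 2) ^+ j != 1) ->
  ebisu_solution 0 0 0 2 (quotient C Q0002 DQ0002) (Params a (- a) (- q) q x) /\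
  ebisu_chain 0 0 0 2 (quotient C Q0002 DQ0002) (quotient C S0002 DS0002)
    (Params a (- a) (- q) q x) K.
Proof.
move=> q01 x1 ne; have /andP[q0 q1] := q01.
have xN N : `|x * q ^+ (2 * N)| < 1.
  by rewrite normrM (le_lt_trans _ x1)// ler_piMr// normrX exprn_ile1// ltW.
have axN N : a ^+ 2 * (x * q ^+ (2 * N)) != 1 by rewrite mulrA exprM.
split.
  by case=> [//|N] _; rewrite ebisu_point0002; have [] := special_0002 q01 (axN N).
apply: ebisu_chainI => //.
- exact: three_term_0002.
- move=> N _; rewrite ebisu_point0002; apply: phi21_exists => //.
  exact: minus_q_generic.
- by move=> N _; rewrite ebisu_point0002; have [] := special_0002 q01 (axN N).
- move=> N _; rewrite ebisu_point0002; have [_ eS] := special_0002 q01 (axN N).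
  eexists; first exact: eS.
  rewrite mulf_neq0 ?invr_eq0 ?subr_eq0 1?eq_sym//.
  by apply: contraTneq (xN N) => ->; rewrite normr1 ltxx.
- move=> N _; rewrite ebisu_point0002 shift_1110; apply: phi21_exists => //.
  exact/generic_shift1/minus_q_generic.
Qed.

Lemma qpoch_square a q i : qpoch a q i * qpoch (- a) q i = qpoch (a ^+ 2) (q ^+ 2) i.
Proof.
rewrite /qpoch -big_split; apply: eq_bigr => j _ /=.
by rewrite -exprM mulnC exprM; ring.
Qed.

(** By (a; q)_i (- a; q)_i = (a^2; q^2)_i, for a and for q, this is the q-binomial
    series in base q^2. *)
Lemma identity_0002 a q x : 0 < `|q| < 1 -> `|x| < 1 ->
  is_phi21 (Params a (- a) (- q) q x)
    (qpochinf (a ^+ 2 * x) (q ^+ 2) / qpochinf x (q ^+ 2)).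
Proof.
move=> q01 x1; have /andP[q0 q1] := q01.
apply: is_phi21_generic => //; first exact: minus_q_generic.
have q2 : 0 < `|q ^+ 2| < 1 by rewrite norm_exp_lt1// normrX exprn_gt0.
apply: converges_ext (@q_binomial _ (a ^+ 2) _ _ q2 x1) => i.
by rewrite /coef !qpoch_square.
Qed.

Lemma chain_0110 a b c q K : 0 < `|q| < 1 -> a != 0 -> b != 0 ->
  (forall j : nat, c * q ^+ j != 1) -> `|c / (a * b)| < 1 ->
  (forall j : nat, c / a != q ^- j) ->
  ebisu_solution 0 1 1 0 (quotient C Q0110 D0110) (Params a b c q (c / (a * b))) /\
  ebisu_chain 0 1 1 0 (quotient C Q0110 D0110) (quotient C S0110 D0110)
    (Params a b c q (c / (a * b))) K.
Proof.
move=> q01 a0 b0 ne x1 nca; have q0 := qbase_neq0 q01.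
have xE N : c / (a * b) = c * q ^+ N / (a * (b * q ^+ N)).
  by field; rewrite a0 b0 expf_neq0.
have ca N : c * q ^+ N != a.
  have := nca N; rewrite eq_expNr//; apply: contraNneq => e.
  by rewrite mulrAC e divff.
have bN N : b * q ^+ N != 0 by rewrite mulf_neq0// expf_neq0.
have c1 N : c * q ^+ N != 1 := ne N.
have spec N := special_0110 q a0 (bN N) (ca N).
split.
  by case=> [//|N] _; rewrite ebisu_point0110 (xE N); have [] := spec N.
apply: ebisu_chainI => //.
- exact: three_term_0110.
- move=> N _; rewrite ebisu_point0110; apply: phi21_exists => //.
  exact: generic_shift.
- by move=> N _; rewrite ebisu_point0110 (xE N); have [] := spec N.
- move=> N _; rewrite ebisu_point0110 (xE N); have [_ eS] := spec N.
  eexists; first exact: eS.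
  by rewrite mulf_neq0 ?invr_eq0 ?oppr_eq0 ?mulf_neq0 ?subr_eq0 1?eq_sym// ?ca// eq_sym.
- move=> N _; rewrite ebisu_point0110 shift_1110; apply: phi21_exists => //.
  exact/generic_shift1/generic_shift.
Qed.

(** Unlike converges_V1, this holds at c = a, too, where the three-term relation says
    nothing but the summation formulas still hold. *)
Lemma relation_V1 a b c q x v w v1 : 0 < `|q| < 1 -> (forall j, c * q ^+ j != 1) ->
  converges x (coef a b c q) v -> converges x (coef (a * q) (b * q) (c * q) q) w ->
  converges x (coef a (b * q) (c * q) q) v1 ->
  (c - a) * v1 = (1 - a) * (c - a * b * x) * w - a * (1 - c) * v.
Proof.
move=> /andP[_ q1] ne cv cw cv1.
have sep j : c * q ^+ j = 1 -> a * q ^+ j != 1 by move=> e; have := ne j; rewrite e eqxx.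
have cl := convergesD (convergesD (convergesZ ((1 - a) * c) cw) (convergesZ (- (a * (1 - c))) cv))
  (convergesZ (- ((1 - a) * (a * b))) (converges_delay cw)).
have e := converges_unique (convergesZ (c - a) cv1) (converges_eq cl _ erefl).
rewrite e => [|i]; first by ring.
by rewrite (contiguous_V1 q1 i (generic_truncating a b ne) sep); ring.
Qed.

Lemma relation_W1 a b c q x w v1 w1 : 0 < `|q| < 1 -> (forall j, c * q ^+ j != 1) ->
  converges x (coef (a * q) (b * q) (c * q) q) w ->
  converges x (coef a (b * q) (c * q) q) v1 ->
  converges x (coef (a * q) (b * q * q) (c * q * q) q) w1 ->
  a * x * (1 - b * q) * w1 = (1 - c * q) * (w - v1).
Proof.
move=> /andP[_ q1] ne cw cv1 cw1.
have cq : c * q != 1 by have := ne 1%N; rewrite expr1.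
have cl := convergesZ (1 - c * q) (convergesD cw (convergesZ (-1) cv1)).
have e := converges_unique (convergesZ (a * (1 - b * q)) (converges_delay cw1))
  (converges_eq cl _ erefl).
transitivity (a * (1 - b * q) * (x * w1)); first by ring.
rewrite e => [|i]; first by ring.
by rewrite (contiguous_W1_V1 q1 _ _ _ cq); ring.
Qed.

Lemma qpochinf_x_neq0 q x : `|q| < 1 -> `|x| < 1 -> qpochinf x q != 0.
Proof.
move=> q1 x1; apply: qpochinf_neq0 => // j; apply/eqP => e.
have : `|x * q ^+ j| < 1.
  by rewrite normrM (le_lt_trans _ x1)// ler_piMr// normrX exprn_ile1// ltW.
by rewrite e normr1 ltxx.
Qed.

Lemma bailey_daum_quotient (u v w y z : C) : u != 0 -> z != 0 ->
  v * w * (y / z) = u * (y * v * w / (z * u)).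
Proof. by move=> u0 z0; field; rewrite u0 z0. Qed.

Lemma qgauss_quotient (u v y z : C) : u != 0 -> z != 0 ->
  v * (y / z) = u * (v * y / (u * z)).
Proof. by move=> u0 z0; field; rewrite u0 z0. Qed.

(** At x = c / (a b) the coefficient of W vanishes, so V at (b q^N, c q^N) satisfies a
    first-order equation in N, and its limit is a 1phi0. *)
Lemma qgauss a b c q : 0 < `|q| < 1 -> a != 0 -> b != 0 ->
  (forall j : nat, c * q ^+ j != 1) -> `|c / (a * b)| < 1 ->
  is_phi21 (Params a b c q (c / (a * b)))
    (qpochinf (c / a) q * qpochinf (c / b) q / (qpochinf c q * qpochinf (c / (a * b)) q)).
Proof.
move=> q01 a0 b0 ne x1; have /andP[_ q1] := q01; have q0 := qbase_neq0 q01.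
set x := c / (a * b) in x1 *.
have /choice[s sE] N := coef_converges a (b * q ^+ (1 * N)) (c * q ^+ (1 * N)) q1 x1.
have lim := phi21_limit_1phi0 q01 (isT : (0 < 1)%N) x1 ne sE.
have step N : (1 - c * q ^+ N) * s N = (1 - c / a * q ^+ N) * s N.+1.
  have := sE N; have := sE N.+1; rewrite !mul1n !exprSr !mulrA => h1 h.
  have [w cw] := coef_converges (a * q) (b * q ^+ N * q) (c * q ^+ N * q) q1 x1.
  have := relation_V1 q01 (generic_shift N ne) h cw h1.
  rewrite (_ : _ - a * _ * x = 0) ?mulr0 ?mul0r ?sub0r => [e|]; last first.
    by rewrite /x; field; rewrite a0 b0.
  apply: (mulfI a0); rewrite !mulrA -[LHS]opprK -e; field.
  exact: a0.
have prod N : qpoch c q N * s 0%N = qpoch (c / a) q N * s N.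
  elim: N => [|N ih]; first by rewrite !qpoch0.
  by rewrite !qpochS mulrAC ih mulrAC -mulrA step mulrA.
have limE : qpochinf c q * s 0%N = qpochinf (c / a) q * (qpochinf (a * x) q / qpochinf x q).
  apply: (@cvg_seq_unique _ (fun N => qpoch c q N * s 0%N)).
    by apply: cvg_seqM; [exact: cvg_qpoch|exact: cvg_seq_cst].
  rewrite (_ : (fun _ => _) = (fun N => qpoch (c / a) q N * s N)); last exact/funext.
  by apply: cvg_seqM; [exact: cvg_qpoch|].
have c0 : qpochinf c q != 0 by exact: qpochinf_neq0.
have x0 := qpochinf_x_neq0 q1 x1.
have <- : s 0%N = qpochinf (c / a) q * qpochinf (c / b) q / (qpochinf c q * qpochinf x q).
  apply: (mulfI c0); rewrite limE (_ : a * x = c / b); last by rewrite /x; field; rewrite a0 b0.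
  exact: (qgauss_quotient (qpochinf (c / a) q) (qpochinf (c / b) q) c0 x0).
apply: (is_phi21_generic q01 ne).
by have := sE 0%N; rewrite muln0 expr0 !mulr1; apply.
Qed.

Lemma bd_generic a b q N : (forall j, b * q / a * q ^+ j != 1) ->
  forall j, b * q ^+ (2 * N) * q / a * q ^+ j != 1.
Proof.
move=> ne j; have := ne (2 * N + j)%N; rewrite exprD; congr (_ != _); ring.
Qed.

Lemma chain_0220 a b q K : 0 < `|q| < 1 -> a != 0 ->
  (forall j : nat, b * q / a * q ^+ j != 1) -> `|- (q / a)| < 1 ->
  (forall j : nat, b * q != (q ^+ 2) ^- j) ->
  (forall j : nat, b * q / a ^+ 2 != q ^- j) ->
  ebisu_solution 0 2 2 0 (quotient C Q0220 D0220) (bailey_daum_point a b q) /\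
  ebisu_chain 0 2 2 0 (quotient C Q0220 D0220) (quotient C S0220 D0220) (bailey_daum_point a b q) K.
Proof.
move=> q01 a0 ne x1 nb nc; have q0 := qbase_neq0 q01.
have neN N := bd_generic N ne.
have bN N : b * q ^+ (2 * N) * q != 1.
  have := nb N; rewrite eq_expNr ?expf_neq0// -exprM; congr (~~ (_ == _)); ring.
have cN i N : b * q ^+ (2 * N) * q / a * q ^+ i != a.
  have := nc (2 * N + i)%N; rewrite eq_expNr//; apply: contraNneq => e.
  rewrite exprD (_ : _ * _ = b * q ^+ (2 * N) * q / a * q ^+ i / a); last by field.
  by rewrite e divff.
have cN0 N : b * q ^+ (2 * N) * q / a != a by have := cN 0%N N; rewrite expr0 mulr1.
have cN1 N : b * q ^+ (2 * N) * q / a * q != a by have := cN 1%N N; rewrite expr1.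
have spec N := special_0220 q0 a0 (bN N) (cN0 N) (cN1 N).
split.
  by case=> [//|N] _; rewrite ebisu_point0220; have [] := spec N.
apply: ebisu_chainI => //.
- exact: three_term_0220.
- by move=> N _; rewrite ebisu_point0220; apply: phi21_exists.
- by move=> N _; rewrite ebisu_point0220; have [] := spec N.
- move=> N _; rewrite ebisu_point0220; have [_ eS] := spec N.
  eexists; first exact: eS.
  have e1 : b * q ^+ (2 * N) * q / a != 1 by have := neN N 0%N; rewrite expr0 mulr1.
  have e2 : b * q ^+ (2 * N) * q / a * q != 1 by have := neN N 1%N; rewrite expr1.
  have e3 : b * q ^+ (2 * N) * q / a * q / a != 1.
    by apply: contra (cN1 N) => /eqP e; rewrite -[X in X == _](mulfVK a0) e mul1r.
  by rewrite !mulf_neq0 ?invr_eq0 ?mulf_neq0// subr_eq0 eq_sym.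
- move=> N _; rewrite ebisu_point0220 shift_1110; apply: phi21_exists => //.
  exact: generic_shift1.
Qed.

(** Two steps (b, c) -> (b q, c q) at once: W, V1 and W1 cancel, and no relation used
    divides by c - a or c q - a. *)
Lemma bailey_daum_step a b q v v2 : 0 < `|q| < 1 -> a != 0 -> `|- (q / a)| < 1 ->
  (forall j, b * q / a * q ^+ j != 1) ->
  converges (- (q / a)) (coef a b (b * q / a) q) v ->
  converges (- (q / a)) (coef a (b * q * q) (b * q / a * q * q) q) v2 ->
  (1 - b * q / a) * (1 - b * q / a * q) * v = (1 - b * q) * (1 - b * q / a * q / a) * v2.
Proof.
move=> q01 a0 x1 ne cv cv2; have /andP[_ q1] := q01; have q0 := qbase_neq0 q01.
set x := - (q / a) in x1 cv cv2; set c := b * q / a in ne cv cv2 *.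
have [w cw] := coef_converges (a * q) (b * q) (c * q) q1 x1.
have [v1 cv1] := coef_converges a (b * q) (c * q) q1 x1.
have [w1 cw1] := coef_converges (a * q) (b * q * q) (c * q * q) q1 x1.
have r0 := relation_V1 q01 ne cv cw cv1.
have r1 := relation_V1 q01 (generic_shift1 ne) cv1 cw1 cv2.
have r2 := relation_W1 q01 ne cw cv1 cw1.
have cq : 1 - c * q != 0 by rewrite subr_eq0 eq_sym; have := ne 1%N; rewrite expr1.
have e2 : - q * (1 - b * q) * w1 = (1 - c * q) * (w - v1).
  by rewrite -r2 /x; field.
have e0 : (1 - c) * v = (1 - a ^+ 2) * (c / a) * w - (c / a - 1) * v1.
  apply: (mulfI a0); transitivity ((1 - a) * (c - a * b * x) * w - (c - a) * v1).
    by rewrite r0; ring.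
  by rewrite /x /c; field.
have e1 : (c * q / a - 1) * v2 = (1 - a ^+ 2) * (c / a) * q * w1 - (1 - c * q) * v1.
  apply: (mulfI a0); transitivity ((c * q - a) * v2); first by field.
  by rewrite r1 /x /c; field.
transitivity (- (1 - b * q) * ((c * q / a - 1) * v2)); last by ring.
rewrite e1 mulrAC e0.
transitivity ((1 - a ^+ 2) * (c / a) * (- q * (1 - b * q) * w1) + (1 - b * q) * (1 - c * q) * v1).
  by rewrite e2 /c; field.
by ring.
Qed.

Lemma cvg_double (u : nat -> C) (v : C) : u N @[N --> \oo] --> v -> u (2 * N)%N @[N --> \oo] --> v.
Proof.
move=> /(@cvgrPdist_lt C C^o) H; apply/(@cvgrPdist_lt C C^o) => e e0.
have [J _ HJ] := H e e0; exists J => // N /= JN; apply: HJ => /=.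
by rewrite (leq_trans JN)// mul2n -addnn leq_addr.
Qed.

(** The same argument as for the q-Gauss sum, with steps (b, c) -> (b q^2, c q^2). *)
Lemma bailey_daum a b q : 0 < `|q| < 1 -> a != 0 ->
  (forall j : nat, b * q / a * q ^+ j != 1) -> `|- (q / a)| < 1 ->
  is_phi21 (bailey_daum_point a b q)
    (qpochinf (- q) q * qpochinf (b * q) (q ^+ 2) * qpochinf (b * q ^+ 2 / a ^+ 2) (q ^+ 2)
     / (qpochinf (- (q / a)) q * qpochinf (b * q / a) q)).
Proof.
move=> q01 a0 ne x1; have /andP[q0' q1] := q01; have q0 := qbase_neq0 q01.
set x := - (q / a) in x1 *; set c := b * q / a in ne *.
have q2 : `|q ^+ 2| < 1 by rewrite norm_exp_lt1.
have /choice[s sE] N := coef_converges a (b * q ^+ (2 * N)) (c * q ^+ (2 * N)) q1 x1.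
have lim := phi21_limit_1phi0 q01 (isT : (0 < 2)%N) x1 ne sE.
have step N : (1 - c * q ^+ (2 * N)) * (1 - c * q ^+ (2 * N).+1) * s N =
    (1 - b * q * (q ^+ 2) ^+ N) * (1 - b * q ^+ 2 / a ^+ 2 * (q ^+ 2) ^+ N) * s N.+1.
  have cE : c * q ^+ (2 * N) = b * q ^+ (2 * N) * q / a by rewrite /c; ring.
  have h := sE N; have h1 := sE N.+1; rewrite (_ : 2 * N.+1 = (2 * N).+2)%N in h1; last lia.
  rewrite !exprSr !mulrA cE in h h1.
  have neN := bd_generic N ne.
  have := bailey_daum_step q01 a0 x1 neN h h1 => e.
  rewrite exprSr mulrA cE -exprM e; congr (_ * _ * _); first by ring.
  by field.
have prod N : qpoch c q (2 * N) * s 0%N =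
    qpoch (b * q) (q ^+ 2) N * qpoch (b * q ^+ 2 / a ^+ 2) (q ^+ 2) N * s N.
  elim: N => [|N ih]; first by rewrite !qpoch0 !mul1r.
  rewrite (_ : 2 * N.+1 = (2 * N).+2)%N; last lia.
  rewrite !qpochS; transitivity ((1 - c * q ^+ (2 * N)) * (1 - c * q ^+ (2 * N).+1)
    * (qpoch c q (2 * N) * s 0%N)); first by ring.
  rewrite ih; transitivity (qpoch (b * q) (q ^+ 2) N * qpoch (b * q ^+ 2 / a ^+ 2) (q ^+ 2) N *
    ((1 - c * q ^+ (2 * N)) * (1 - c * q ^+ (2 * N).+1) * s N)); first by ring.
  by rewrite step; ring.
have limE : qpochinf c q * s 0%N = qpochinf (b * q) (q ^+ 2) *
    qpochinf (b * q ^+ 2 / a ^+ 2) (q ^+ 2) * (qpochinf (a * x) q / qpochinf x q).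
  apply: (@cvg_seq_unique _ (fun N => qpoch c q (2 * N) * s 0%N)).
    by apply: cvg_seqM; [exact: cvg_double (cvg_qpoch (a := c) q1)|exact: cvg_seq_cst].
  rewrite (_ : (fun _ => _) = (fun N => qpoch (b * q) (q ^+ 2) N
     * qpoch (b * q ^+ 2 / a ^+ 2) (q ^+ 2) N * s N)); last exact/funext.
  by apply: cvg_seqM; [apply: cvg_seqM; exact: cvg_qpoch|].
have c0 : qpochinf c q != 0 by exact: qpochinf_neq0.
have x0 := qpochinf_x_neq0 q1 x1.
have <- : s 0%N = qpochinf (- q) q * qpochinf (b * q) (q ^+ 2)
    * qpochinf (b * q ^+ 2 / a ^+ 2) (q ^+ 2) / (qpochinf x q * qpochinf c q).
  apply: (mulfI c0); rewrite limE (_ : a * x = - q); last by rewrite /x; field.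
  exact: (bailey_daum_quotient (qpochinf (b * q) (q ^+ 2)) (qpochinf (b * q ^+ 2 / a ^+ 2) (q ^+ 2))
    (qpochinf (- q) q) c0 x0).
apply: (is_phi21_generic q01 ne).
by have := sE 0%N; rewrite muln0 expr0 !mulr1; apply.
Qed.

End Nonterminating.

(** * Chains through terminating series *)

Section TerminatingChains.
Variables (C : numClosedFieldType) (q : C).
Hypothesis q01 : 0 < `|q| < 1.
Implicit Types (a b w : C).

Let q1 : `|q| < 1. Proof. by case/andP: q01. Qed.
Let q0 : q != 0. Proof. exact: qbase_neq0 q01. Qed.
Let qn0 n : q ^+ n != 0. Proof. by rewrite expf_neq0. Qed.

Lemma expNr_mul n j : (j <= n)%N -> q ^- n * q ^+ j = q ^- (n - j).
Proof. by move=> jn; rewrite -{1}(subnK jn) exprD invfM mulfVK. Qed.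

Lemma solution_1211 a b : a != 0 ->
  (forall j : nat, b * q != (q ^+ 2) ^- j) -> (forall j : nat, - a != q ^- j) ->
  ebisu_solution 1 2 1 (-1) (quotient C Q1211 D1211) (bailey_daum_point a b q).
Proof.
move=> a0 nb na [//|N] _; rewrite ebisu_point1211//.
have [] // := @special_1211 C (a * q ^+ N) (b * q ^+ (2 * N)) q q0.
- by rewrite mulf_neq0.
- have := nb N; rewrite eq_expNr ?expf_neq0// -exprM; congr (~~ (_ == _)); ring.
- have := na N; rewrite eq_expNr// mulNr; apply: contraNneq => e.
  by apply/eqP; rewrite -[RHS]subr0 -e; ring.
Qed.

Lemma chain_1211 a b K : a != 0 ->
  (forall N, (N <= K)%N ->
    exists v, is_phi21 (bailey_daum_point (a * q ^+ N) (b * q ^+ (2 * N)) q) v) ->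
  (forall N, (N < K)%N ->
    [/\ b * q ^+ (2 * N) * q != 1, 1 + a * q ^+ N != 0, a * q ^+ N != b * q ^+ (2 * N) * q
      & exists v, is_phi21 (Defs.shift 1 1 1 0 (bailey_daum_point (a * q ^+ N) (b * q ^+ (2 * N)) q)) v]) ->
  ebisu_chain 1 2 1 (-1) (quotient C Q1211 D1211) (quotient C S1211 D1211) (bailey_daum_point a b q) K.
Proof.
move=> a0 hv hN; have aN N : a * q ^+ N != 0 by rewrite mulf_neq0.
apply: ebisu_chainI => //; first exact: three_term_1211.
- by move=> N /hv; rewrite ebisu_point1211.
- by move=> N /hN[bN a1 _ _]; rewrite ebisu_point1211//; have [] := special_1211 q0 (aN N) bN a1.
- move=> N /hN[bN a1 ab _]; rewrite ebisu_point1211//.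
  have [_ eS] := special_1211 q0 (aN N) bN a1.
  eexists; first exact: eS.
  by rewrite mulf_neq0 ?invr_eq0 ?mulf_neq0 ?subr_eq0// eq_sym.
- by move=> N /hN[_ _ _]; rewrite ebisu_point1211.
Qed.

Lemma chain_ab M s K : (2 * K <= s)%N ->
  ebisu_chain 1 2 1 (-1) (quotient C Q1211 D1211) (quotient C S1211 D1211)
    (bailey_daum_point (q ^+ (M + 2)) (q ^- s) q) K.
Proof.
move=> Ks; have aE N : q ^+ (M + 2) * q ^+ N = q ^+ (M + N + 2) by rewrite -exprD addnAC.
apply: chain_1211 => [//|N NK|N NK]; rewrite aE expNr_mul; try lia.
  by eexists; exact: bd_pos_exists.
have -> : (s - 2 * N = (s - 2 * N).-2.+2)%N by lia.
rewrite expNr_predM//; split.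
- exact: qexpN_neq1.
- exact: one_plus_qexp_neq0.
- rewrite eq_expNr// -exprD qexp_neq1//; lia.
- exact: bd_pos_shift_exists.
Qed.

Lemma chain_4c M N :
  ebisu_chain 1 2 1 (-1) (quotient C Q1211 D1211) (quotient C S1211 D1211)
    (bailey_daum_point (q ^- N) (q ^- (M + 2 * N + 2)) q) N.
Proof.
apply: chain_1211 => [|j jN|j jN]; first by rewrite invr_eq0.
  rewrite !expNr_mul; try lia.
  have -> : (M + 2 * N + 2 - 2 * j = M + 2 * (N - j) + 2)%N by lia.
  by eexists; exact: bd_neg_exists.
rewrite !expNr_mul; try lia.
have -> : (M + 2 * N + 2 - 2 * j = M + 2 * (N - j) + 2)%N by lia.
have -> : (N - j = (N - j).-1.+1)%N by lia.
split; last exact: bd_neg_shift_exists.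
- by rewrite addn2 expNr_predM// qexpN_neq1.
- exact: one_plus_qexpN_neq0.
- set n := (N - j).-1; rewrite addn2 expNr_predM//.
  by rewrite (inj_eq invr_inj); apply/eqP => /(qexp_inj q01); lia.
Qed.

Lemma solution_0330 w b : w ^+ 3 = 1 -> w != 1 -> (forall j : int, b != q ^ j) ->
  ebisu_solution 0 3 3 0 (quotient C Q0330 D0330) (cubic_point w b q).
Proof.
move=> w3 w1 nb [//|N] _; rewrite ebisu_point0330.
have ne (i : int) : b * q ^+ (3 * N) != q ^ i.
  apply: contra (nb (i - (3 * N)%:Z)) => /eqP e; apply/eqP.
  by rewrite expfzDr// -e -exprnN mulfK.
have ne1 (i : nat) : b * q ^+ (3 * N) * q ^+ i != 1.
  by rewrite -eq_expNr// exprnN.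
have [] // := @special_0330 C w (b * q ^+ (3 * N)) q q0 w3 w1.
- by have := ne1 0%N; rewrite expr0 mulr1.
- by have := ne1 1%N; rewrite expr1.
- by have := ne1 2; rewrite expr2 mulrA.
- by have := ne 1; rewrite expr1z.
Qed.

Lemma chain_0330 w N : w ^+ 3 = 1 -> w != 1 ->
  ebisu_chain 0 3 3 0 (quotient C Q0330 D0330) (quotient C S0330 D0330)
    (cubic_point w (q ^- N) q) (N %/ 3).
Proof.
move=> w3 w1; have K3 := leq_divM N 3.
apply: ebisu_chainI => //; first exact: three_term_0330.
- move=> j jK; rewrite ebisu_point0330 expNr_mul; last by lia.
  by eexists; exact: omega_exists.
- move=> j jK; rewrite ebisu_point0330 expNr_mul; last by lia.
  have -> : (N - 3 * j = (N - 3 * j - 3).+3)%N by lia.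
  by have [] := omega_special q01 w3 w1 (N - 3 * j - 3).
- move=> j jK; rewrite ebisu_point0330 expNr_mul; last by lia.
  have -> : (N - 3 * j = (N - 3 * j - 3).+3)%N by lia.
  have [_ eS] := omega_special q01 w3 w1 (N - 3 * j - 3).
  eexists; first exact: eS.
  rewrite mulf_neq0 ?invr_eq0//; apply: qpoch_neq0 => i i3.
    exact: omega_generic.
  by rewrite expNr_mul ?qexpN_neq1//; lia.
- move=> j jK; rewrite ebisu_point0330 expNr_mul; last by lia.
  have -> : (N - 3 * j = (N - 3 * j).-1.+1)%N by lia.
  exact: omega_shift_exists.
Qed.

End TerminatingChains.

(** * The five families of identities *)

Theorem theorem1 (R : realType) :
  (exists Q S : ratfun (Cplx R),
     [/\ unique_three_term 0 0 0 2 Q S,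
         forall a q x : Cplx R, 0 < `|q| < 1 -> `|x| < 1 ->
           (forall j : nat, a ^+ 2 * x * (q ^+ 2) ^+ j != 1) ->
           ebisu_solution 0 0 0 2 Q (Params a (- a) (- q) q x) /\
           (forall K : nat,
              ebisu_chain 0 0 0 2 Q S (Params a (- a) (- q) q x) K)
       & forall a q x : Cplx R, 0 < `|q| < 1 -> `|x| < 1 ->
           is_phi21 (Params a (- a) (- q) q x)
             (qpochinf (a ^+ 2 * x) (q ^+ 2) / qpochinf x (q ^+ 2))]) /\
  (exists Q S : ratfun (Cplx R),
     [/\ unique_three_term 0 1 1 0 Q S,
         forall a b c q : Cplx R, 0 < `|q| < 1 -> a != 0 -> b != 0 ->
           (forall j : nat, c != q ^- j) -> `|c / (a * b)| < 1 ->
           (forall j : nat, c / a != q ^- j) ->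
           ebisu_solution 0 1 1 0 Q (Params a b c q (c / (a * b))) /\
           (forall K : nat,
              ebisu_chain 0 1 1 0 Q S (Params a b c q (c / (a * b))) K)
       & forall a b c q : Cplx R, 0 < `|q| < 1 -> a != 0 -> b != 0 ->
           (forall j : nat, c != q ^- j) -> `|c / (a * b)| < 1 ->
           is_phi21 (Params a b c q (c / (a * b)))
             (qpochinf (c / a) q * qpochinf (c / b) q
              / (qpochinf c q * qpochinf (c / (a * b)) q))]) /\
  (exists Q S : ratfun (Cplx R),
     [/\ unique_three_term 0 2 2 0 Q S,
         forall a b q : Cplx R, 0 < `|q| < 1 -> a != 0 ->
           (forall j : nat, b * q / a != q ^- j) -> `|- (q / a)| < 1 ->
           (forall j : nat, b * q != (q ^+ 2) ^- j) ->
           (forall j : nat, b * q / a ^+ 2 != q ^- j) ->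
           ebisu_solution 0 2 2 0 Q (Params a b (b * q / a) q (- (q / a))) /\
           (forall K : nat,
              ebisu_chain 0 2 2 0 Q S
                (Params a b (b * q / a) q (- (q / a))) K)
       & forall a b q : Cplx R, 0 < `|q| < 1 -> a != 0 ->
           (forall j : nat, b * q / a != q ^- j) -> `|- (q / a)| < 1 ->
           is_phi21 (Params a b (b * q / a) q (- (q / a)))
             (qpochinf (- q) q * qpochinf (b * q) (q ^+ 2)
                * qpochinf (b * q ^+ 2 / a ^+ 2) (q ^+ 2)
              / (qpochinf (- (q / a)) q * qpochinf (b * q / a) q))]) /\
  (exists Q S : ratfun (Cplx R),
     [/\ unique_three_term 1 2 1 (-1) Q S,
         forall a b q : Cplx R, 0 < `|q| < 1 -> a != 0 ->
           (forall j : nat, b * q != (q ^+ 2) ^- j) ->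
           (forall j : nat, - a != q ^- j) ->
           ebisu_solution 1 2 1 (-1) Q (Params a b (b * q / a) q (- (q / a))),
         forall (q a b : Cplx R) (M N : nat), 0 < `|q| < 1 ->
           a = q ^+ (M + 2) -> b = q ^- (2 * N) ->
           ebisu_chain 1 2 1 (-1) Q S
             (Params a b (b * q / a) q (- (q / a))) N /\
           is_phi21 (Params a b (b * q / a) q (- (q / a)))
             (qpoch (- q ^+ (M + 2)) q N * qpoch q (q ^+ 2) N
              / qpoch (q ^+ (M + N + 2)) q N),
         forall (q a b : Cplx R) (M N : nat), 0 < `|q| < 1 ->
           a = q ^+ (M + 2) -> b = q ^- (2 * N + 1) ->
           ebisu_chain 1 2 1 (-1) Q S
             (Params a b (b * q / a) q (- (q / a))) N /\
           is_phi21 (Params a b (b * q / a) q (- (q / a))) 0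
       & forall (q a b : Cplx R) (M N : nat), 0 < `|q| < 1 ->
           a = q ^- N -> b = q ^- (M + 2 * N + 2) ->
           ebisu_chain 1 2 1 (-1) Q S
             (Params a b (b * q / a) q (- (q / a))) N /\
           is_phi21 (Params a b (b * q / a) q (- (q / a)))
             (qpoch (- q) q N * qpoch (q ^+ (M + 3)) (q ^+ 2) N
              / (q ^+ (N * (N + 1) %/ 2) * qpoch (q ^+ (M + 2)) q N))]) /\
  (exists Q S : ratfun (Cplx R),
     [/\ unique_three_term 0 3 3 0 Q S,
         forall omega b q : Cplx R, 0 < `|q| < 1 ->
           omega ^+ 3 = 1 -> omega != 1 ->
           (forall j : int, b != q ^ j) ->
           ebisu_solution 0 3 3 0 Q (Params (omega * q) b (omega * b) q 1)
       & forall (omega q : Cplx R) (N : nat), 0 < `|q| < 1 ->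
           omega ^+ 3 = 1 -> omega != 1 ->
           ebisu_chain 0 3 3 0 Q S
             (Params (omega * q) (q ^- N) (omega * q ^- N) q 1) (N %/ 3) /\
           is_phi21 (Params (omega * q) (q ^- N) (omega * q ^- N) q 1)
             ((1 - omega ^+ (N + 1)) / (1 - omega)
              * (qpoch (q ^- N) q N / qpoch (omega * q ^- N) q N))]).
Proof.
have generic (c q : Cplx R) : 0 < `|q| < 1 -> (forall j : nat, c != q ^- j) ->
    forall j : nat, c * q ^+ j != 1.
  by move=> q01 ne j; have := ne j; rewrite eq_expNr// (qbase_neq0 q01).
split; last split; last split; last split.
- exists (quotient (Cplx R) Q0002 DQ0002), (quotient (Cplx R) S0002 DS0002); split.
  + exact/three_term_unique_pair/three_term_0002.
  + move=> a q x q01 x1 ne.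
    by split; [have [] := chain_0002 0 q01 x1 ne|move=> K; have [] := chain_0002 K q01 x1 ne].
  + exact: identity_0002.
- exists (quotient (Cplx R) Q0110 D0110), (quotient (Cplx R) S0110 D0110); split.
  + exact/three_term_unique_pair/three_term_0110.
  + move=> a b c q q01 a0 b0 ne x1 nca; have g := generic _ _ q01 ne.
    by split; [have [] := chain_0110 0 q01 a0 b0 g x1 nca
      |move=> K; have [] := chain_0110 K q01 a0 b0 g x1 nca].
  + by move=> a b c q q01 a0 b0 ne x1; apply: qgauss => //; exact: generic.
- exists (quotient (Cplx R) Q0220 D0220), (quotient (Cplx R) S0220 D0220); split.
  + exact/three_term_unique_pair/three_term_0220.
  + move=> a b q q01 a0 ne x1 nb nc; have g := generic _ _ q01 ne.
    by split; [have [] := chain_0220 0 q01 a0 g x1 nb nc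
      |move=> K; have [] := chain_0220 K q01 a0 g x1 nb nc].
  + by move=> a b q q01 a0 ne x1; apply: bailey_daum => //; exact: generic.
- exists (quotient (Cplx R) Q1211 D1211), (quotient (Cplx R) S1211 D1211); split.
  + exact/three_term_unique_pair/three_term_1211.
  + by move=> a b q q01 a0 nb na; exact: solution_1211.
  + move=> q a b M N q01 -> ->; split; last exact: value_4a.
    by apply: chain_ab.
  + move=> q a b M N q01 -> ->; split; last exact: value_4b.
    by apply: chain_ab => //; rewrite leq_addr.
  + move=> q a b M N q01 -> ->; split; last exact: value_4c.
    exact: chain_4c.
- exists (quotient (Cplx R) Q0330 D0330), (quotient (Cplx R) S0330 D0330); split.
  + exact/three_term_unique_pair/three_term_0330.
  + by move=> w b q q01 w3 w1 nb; exact: solution_0330.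
  + move=> w q N q01 w3 w1; split; last exact: value_5.
    exact: chain_0330.
Qed.
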